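(* Let $X$ be a spectrally negative Lévy process with Lévy triplet $(\gamma,\sigma,\Pi)$ such that $\Pi$ has a strictly positive density $\pi$ on $(0,\infty)$ with respect to Lebesgue measure. Let $q>0$ if $\Phi(0)=0$, and $q\ge0$ if $\Phi(0)>0$. Put $$\overline{\Pi}(x):=\int_x^\infty\pi(s)\,ds,\qquad g_q(x):=e^{-\Phi(q)x}W^{(q)}(x),\qquad x>0.$$ (1) If $\overline{\Pi}$ is log convex on $(0,\infty)$, then $g_q$ is concave on $(0,\infty)$. (2) If furthermore $\pi$ is log convex (and hence non-increasing), then $\overline{\Pi}$ is log convex, the first derivative of $g_q$ is non-increasing and convex, and the functions $W^{(q)}$ and $W^{(q)\prime}$ are strictly convex on the interval $(a^*,\infty)$, where $$a^*=\sup\left\{a\ge0: W^{(q)\prime}(a)\le W^{(q)\prime}(y)\text{ for all }y\ge0\right\}<\infty.$$ (3) If $\pi$ is log convex and the Gaussian coefficient $\sigma$ is strictly positive, then $W^{(q)}\in C^2(0,\infty)$.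
   Context: A spectrally negative Lévy process $X$ is a real-valued Lévy process with no positive jumps which, as usual, is not the negative of a subordinator (paths not monotone decreasing). Its triplet is $(\gamma,\sigma,\Pi)$ with $\gamma\in\mathbb{R}$, $\sigma\ge 0$, and $\Pi$ a measure on $(0,\infty)$ with $\int_0^\infty(1\wedge x^2)\Pi(dx)<\infty$ (the Lévy measure is carried by $(0,\infty)$ although jumps are negative); its Laplace exponent is $$\psi(\theta)=\log \mathbb{E}(e^{\theta X_1})=\gamma\theta+\tfrac12\sigma^2\theta^2-\int_0^\infty\left(1-e^{-\theta x}-\theta x1_{\{0<x<1\}}\right)\Pi(dx),\quad \theta\ge0.$$ $\Phi(0)\ge 0$ is the largest real root of $\psi$ on $[0,\infty)$; the restriction $\psi:[\Phi(0),\infty)\to[0,\infty)$ is a bijection with inverse $\Phi$. For $q\ge0$ the $q$-scale function $W^{(q)}:\mathbb{R}\to[0,\infty)$ is the unique function with $W^{(q)}(x)=0$ for $x<0$ which on $[0,\infty)$ is continuous and non-decreasing with $\int_0^\infty e^{-\theta x}W^{(q)}(x)\,dx=1/(\psi(\theta)-q)$ for $\theta>\Phi(q)$. $W^{(q)\prime}$ is its derivative on $(0,\infty)$, and $W^{(q)\prime}(0)$ is understood as $W^{(q)\prime}(0+)$ (possibly $+\infty$). *)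

(* Defs.v *)
From HB Require Import structures.
From mathcomp Require Export all_boot all_order all_algebra.
From mathcomp Require Export all_classical all_reals all_analysis.
Set Implicit Arguments.
Unset Strict Implicit.
Unset Printing Implicit Defensive.
Export Order.TTheory GRing.Theory Num.Theory.
Export numFieldNormedType.Exports.
Local Open Scope classical_set_scope.
Local Open Scope ring_scope.

(** * Convexity on a set of reals *)

Section convexity.
Context (R : realType).
Implicit Types (D : set R) (f : R -> R).

Definition convex_on D f : Prop := @convex_function R R^o D f.

Definition concave_on D f : Prop := convex_on D (fun x => - f x).

Definition strictly_convex_on D f : Prop :=
  forall (t : R) (x y : R), 0 < t -> t < 1 -> D x -> D y -> x != y ->
    f (t * x + (1 - t) * y) < t * f x + (1 - t) * f y.

(* [ln] is total in the library (0 at nonpositive arguments), hence the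
   positivity clause. *)
Definition log_convex_on D f : Prop :=
  (forall x, D x -> 0 < f x) /\ convex_on D (fun x => ln (f x)).

Definition nonincreasing_on D f : Prop :=
  forall x y, D x -> D y -> x <= y -> f y <= f x.

Definition derivable_on D f : Prop := forall x, D x -> derivable f x 1.

(* Class C^2 on an open set [D]. *)
Definition C2_on D f : Prop :=
  [/\ derivable_on D f, derivable_on D (derive1 f) &
      forall x, D x -> {for x, continuous (derive1n 2 f)}].

End convexity.

(** * Levy processes *)

Section levy_process.
Context (R : realType) (d : measure_display) (T : measurableType d)
  (P : probability T R).
Local Open Scope ereal_scope.

(* The time set is [0, +oo[; the values of [X] at negative times are never
   used.  Path properties are required almost surely. *)
Implicit Type X : R -> {RV P >-> R}.

Definition increment X (s t : R) : T -> R := fun w => (X t w - X s w)%R.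

(* Mutual independence of the increments over every finite subdivision
   0 <= t_0 <= ... <= t_n; the product rule for subfamilies is the case where
   some of the [B i] are [setT]. *)
Definition independent_increments X : Prop :=
  forall (n : nat) (t : nat -> R) (B : nat -> set R),
    (0 <= t 0%N)%R -> (forall i, t i <= t i.+1)%R ->
    (forall i, measurable (B i)) ->
    P (\bigcap_(i in `I_n) (increment X (t i) (t i.+1) @^-1` B i)) =
    \prod_(i < n) P (increment X (t i) (t i.+1) @^-1` B i).

Definition stationary_increments X : Prop :=
  forall (s h : R) (B : set R), (0 <= s)%R -> (0 <= h)%R -> measurable B ->
    P (increment X s (s + h) @^-1` B) = P (X h @^-1` B).

Definition cadlag (x : R -> R) : Prop :=
  (forall t : R, (0 <= t)%R -> x s @[s --> t^'+] --> x t) /\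
  (forall t : R, (0 < t)%R -> cvg (x s @[s --> t^'-])).

Record levy_process X : Prop := LevyProcess {
  levy_start : {ae P, forall w, X 0%R w = 0%R} ;
  levy_independent : independent_increments X ;
  levy_stationary : stationary_increments X ;
  levy_cadlag : {ae P, forall w, cadlag (fun t => X t w)} }.

Definition no_positive_jumps (x : R -> R) : Prop :=
  forall t : R, (0 < t)%R -> (x t <= lim (x s @[s --> t^'-]))%R.

Definition nonincreasing_path (x : R -> R) : Prop :=
  forall s t : R, (0 <= s)%R -> (s <= t)%R -> (x t <= x s)%R.

(* [snl_not_neg_subordinator] is the usual exclusion of negatives of
   subordinators (including the null process). *)
Record spectrally_negative_levy X : Prop := SpectrallyNegativeLevy {
  snl_levy : levy_process X ;
  snl_no_positive_jumps :
    {ae P, forall w, no_positive_jumps (fun t => X t w)} ;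
  snl_not_neg_subordinator :
    ~ {ae P, forall w, nonincreasing_path (fun t => X t w)} }.

End levy_process.

(** * Triplet, Laplace exponent and scale functions *)

Section laplace_exponent.
Context (R : realType).
Implicit Types (gamma sigma : R)
  (Pi : {measure set (measurableTypeR R) -> \bar R}) (pi : R -> R).

(* A measure on ]0, +oo[ is encoded as a Borel measure on the real line that
   does not charge ]-oo, 0]; it is the image under [x |-> - x] of the intensity
   of the (negative) jumps. *)
Definition levy_measure Pi : Prop :=
  Pi [set x | x <= 0] = 0%E /\
  (\int[Pi]_(x in `]0%R, +oo[) (Num.min 1 (x ^+ 2))%:E < +oo)%E.

Definition laplace_exponent gamma sigma Pi (theta : R) : R :=
  gamma * theta + 2^-1 * sigma ^+ 2 * theta ^+ 2
  - \int[Pi]_(x in `]0, +oo[)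
      (1 - expR (- theta * x) - theta * x * (\1_(`]0, 1[ : set R) x)).

(* [X] has triplet [(gamma, sigma, Pi)]: the identity
   E (e^{theta X_1}) = e^{psi(theta)}, theta >= 0, determines the law of a
   spectrally negative Levy process. *)
Definition has_triplet (d : measure_display) (T : measurableType d)
    (P : probability T R) (X : R -> {RV P >-> R}) gamma sigma Pi : Prop :=
  [/\ 0 <= sigma, levy_measure Pi &
      forall theta : R, 0 <= theta ->
        'M_P (X 1) theta = (expR (laplace_exponent gamma sigma Pi theta))%:E].

Definition positive_density Pi pi : Prop :=
  [/\ measurable_fun (`]0%R, +oo[ : set R) pi,
      forall x, 0 < x -> 0 < pi x &
      forall A : set (measurableTypeR R), measurable A -> A `<=` `]0%R, +oo[ ->
        Pi A = (\int[lebesgue_measure]_(x in A) (pi x)%:E)%E].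

Definition tail pi (x : R) : R :=
  \int[lebesgue_measure]_(s in `]x, +oo[) pi s.

(* Phi(0), the largest root on [0, +oo[, and Phi, the inverse of the
   restriction of [psi] to [Phi(0), +oo[. *)
Definition Phi0 (psi : R -> R) : R :=
  sup [set theta | 0 <= theta /\ psi theta = 0].

Definition Phi (psi : R -> R) : R -> R :=
  'pinv_(fun=> 0) `[Phi0 psi, +oo[ psi.

Record scale_function (psi : R -> R) (q : R) (W : R -> R) : Prop :=
  ScaleFunction {
  scale_ge0 : forall x, 0 <= W x ;
  scale_neg : forall x, x < 0 -> W x = 0 ;
  scale_continuous : {within `[0, +oo[, continuous W} ;
  scale_nondecreasing : forall x y, 0 <= x -> x <= y -> W x <= W y ;
  scale_laplace : forall theta, Phi psi q < theta ->
    (\int[lebesgue_measure]_(x in `[0%R, +oo[) (expR (- theta * x) * W x)%:E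
     = ((psi theta - q)^-1)%:E)%E }.

(* The derivative of [W] on [0, +oo[, read as W'(0+), possibly +oo, at 0. *)
Definition right_deriv0 (W : R -> R) : \bar R :=
  lim ((derive1 W y)%:E @[y --> 0^'+]).

Definition ext_deriv (W : R -> R) (x : R) : \bar R :=
  if x == 0 then right_deriv0 W else (derive1 W x)%:E.

Definition astar (W : R -> R) : \bar R :=
  ereal_sup [set a%:E | a in [set a : R | 0 <= a /\
    forall y : R, 0 <= y -> (ext_deriv W a <= ext_deriv W y)%E]].

End laplace_exponent.

(* Main.v *)
(* Fix [c = Phi(q)].  Integration by parts factors the Laplace exponent as
   [psi(th) - q = th (th - c) (sigma^2 / 2 + LV(th))], where [LV] is the Laplace
   transform of [V(x) = q / c + \int_0^oo e^(-c s) \bar\Pi(x + s) ds], which is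
   log-convex when [\bar\Pi] is.  At [th = l (1 - z)] a Laplace transform is the
   generating function of the Poisson masses [\int e^(-l x) (l x)^n / n! f(x) dx],
   so the identity [(psi - q) LW = 1] becomes a renewal equation
   [\sum_k u_k a_(n-k) = 1 / l], with [u_n = (l - c) w_n - l w_(n-1)] for the
   masses [w] of [W] and [a_n] those of [V] (plus [sigma^2 / 2] at [n = 0]).
   Poisson masses inherit log-convexity, and Kaluza's theorem then makes [u]
   nonnegative and nonincreasing; when [pi] is log-convex, so are the differences
   of [a], and the same argument one order higher makes [u] convex.  Since
   [rho^n u_n], [rho = 1 - c / l], are the increments of [l rho^n w_n], which
   converge to [g_q] as [l -> oo] with [n / l -> x] (Post-Widder), the concavity
   of [g_q] and the convexity of [g_q'] follow.

   Hence [W' = c W + s] with [s(x) = e^(c x) g_q'(x)] convex, nonincreasing and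
   nonnegative, and a comparison at an interior maximum shows that [W'] cannot
   increase and then decrease, which gives strict convexity beyond [a^*].  When
   [sigma > 0], the renewal equation bounds the second differences of [u] and
   makes [s] of class C^1. *)
From HB Require Import structures.
Require Import Defs.
From mathcomp Require Import ring lra zify measurable_realfun.
Set Implicit Arguments.
Unset Strict Implicit.
Unset Printing Implicit Defensive.
Local Open Scope classical_set_scope.
Local Open Scope ring_scope.

(** * Kaluza's theorem: renewal sequences of log-convex sequences *)

(** Of [W] only continuity, monotonicity and the transform are given, so regularity is the obstacle.
    Sequences have differences of every order, but only inequalities between them cross the
    pointwise limit. Hence convexity is kept in the derivative-free form [three_slope], and
    derivability is regained from bounds on second differences over a step [h]: of order [h ^+ 2]
    for [g], by telescoping at third order, and smaller than any multiple of [h] for [s] when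
    [sigma > 0]. In the latter case the renewal equation leaves boundary terms of order [h]; they
    cancel because [s] tends to [1 / b] at 0, with [b = sigma ^+ 2 / 2], and because [V] is
    continuous. The additive terms of the factorisation are harmless for log-convexity: [b] enters
    only the mass of index 0, an end term that may be raised freely, and adding the constant [q / c]
    preserves the product form of log-convexity for a nonincreasing function. Poisson masses inherit
    that form by splitting a squared bound with the arithmetic-geometric mean into linear ones,
    which can be integrated. *)

Section kaluza.
Context (R : realFieldType).
Implicit Types (a u F d : nat -> R) (c : R).

Definition log_convex_seq a := forall n, a n.+1 ^+ 2 <= a n * a n.+2.
Definition nonincreasing_from_start a := forall n, a n.+1 <= a n.

Lemma nonincreasing_from_startP a : nonincreasing_from_start a ->
  forall m n, (m <= n)%N -> a n <= a m.
Proof.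
move=> ha m n /subnKC <-; elim: (n - m)%N => [|k IH]; first by rewrite addn0.
by rewrite addnS; apply: le_trans IH; exact: ha.
Qed.

(** The ratios [a n.+1 / a n] are nondecreasing; this compares two of them, cleared of
    denominators. *)
Lemma log_convex_seq_ratio a : (forall n, 0 < a n) -> log_convex_seq a ->
  forall m n, (m <= n)%N -> a m.+1 * a n.+1 <= a m * a n.+2.
Proof.
move=> a0 la m n /subnKC <-; elim: (n - m)%N => [|k IH].
  by rewrite addn0 -expr2; exact: la.
rewrite addnS.
have h1 := la (m + k).+1; set x := a (m + k).+1 in IH h1; set y := a (m+k).+2 in IH h1 *.
set z := a (m + k).+3 in h1 *.
have y0 : 0 < y := a0 _. have x0 : 0 < x := a0 _.
rewrite -(ler_pM2r x0) -(ler_pM2r y0).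
(* The induction hypothesis is multiplied by [y ^+ 2 <= x * z]; cancelling [x * y] then moves the
   comparison one index up. *)
have H : a m.+1 * x * y ^+ 2 <= a m * y * (x * z).
  by apply: ler_pM => //; rewrite ?mulr_ge0 ?sqr_ge0// ltW.
apply: le_trans (le_trans _ H) _; rewrite le_eqVlt; apply/orP; left; apply/eqP; ring.
Qed.

(** Subtracting two consecutive equations turns a constant convolution into a renewal equation for
    the decrements of [u], the form to which Kaluza's theorem applies. *)
Lemma renewal_of_convolution a u c :
  (forall n, \sum_(k < n.+1) u k * a (n - k)%N = c) ->
  forall n, u 0%N * a n.+1 = \sum_(k < n.+1) (u k - u k.+1) * a (n - k)%N.
Proof.
move=> h n; under eq_bigr => k _ do rewrite mulrBl.
rewrite big_split/= sumrN h -(h n.+1) big_ord_recl/= subn0.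
by rewrite addrK.
Qed.

(** Eliminating [c] between the equations at [n] and [n.+1] expresses [F n.+1] through the earlier
    [F k], with coefficients that are nonnegative because the ratios of [a] are nondecreasing. *)
Lemma kaluza_ge0 a F c : (forall n, 0 < a n) -> log_convex_seq a -> 0 <= c ->
  (forall n, c * a n.+1 = \sum_(k < n.+1) F k * a (n - k)%N) ->
  forall n, 0 <= F n.
Proof.
move=> a0 la c0 hF n; elim/ltn_ind: n => -[_|n IH].
  have := hF 0%N; rewrite big_ord1 subn0 => h.
  by rewrite -(pmulr_lge0 _ (a0 0%N)) -h mulr_ge0// ltW.
have h : F n.+1 * (a 0%N * a n.+1) =
    \sum_(k < n.+1) F k * (a (n - k)%N * a n.+2 - a (n.+1 - k)%N * a n.+1).
  have h2 := hF n.+1; rewrite big_ord_recr/= subnn in h2.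
  under eq_bigr => k _ do rewrite mulrBr !mulrA.
  rewrite big_split/= sumrN -!mulr_suml -hF.
  have -> : \sum_(k < n.+1) F k * a (n.+1 - k)%N = c * a n.+2 - F n.+1 * a 0%N.
    by rewrite h2 addrK.
  ring.
rewrite -(pmulr_lge0 _ (mulr_gt0 (a0 0%N) (a0 n.+1))) h.
apply: sumr_ge0 => k _; apply: mulr_ge0; first by apply: IH.
rewrite subr_ge0 subSn -1?ltnS//.
by apply: log_convex_seq_ratio => //; rewrite leq_subr.
Qed.

(** In the equation at [n] every [a (n - k)] is at least [a n.+1], which can be divided out. *)
Lemma renewal_sum_le a F c : (forall n, 0 < a n) -> nonincreasing_from_start a ->
  (forall n, 0 <= F n) ->
  (forall n, c * a n.+1 = \sum_(k < n.+1) F k * a (n - k)%N) ->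
  forall n, \sum_(k < n.+1) F k <= c.
Proof.
move=> a0 na F0 hF n; rewrite -(ler_pM2r (a0 n.+1)) hF mulr_suml.
apply: ler_sum => k _; apply: ler_wpM2l => //.
by apply: nonincreasing_from_startP => //; lia.
Qed.

Lemma renewal_ge0 a u c : (forall n, 0 < a n) -> nonincreasing_from_start a ->
  log_convex_seq a -> 0 <= c ->
  (forall n, \sum_(k < n.+1) u k * a (n - k)%N = c) ->
  (forall n, 0 <= u n) /\ nonincreasing_from_start u.
Proof.
move=> a0 na la c0 h.
have u00 : 0 <= u 0%N.
  by rewrite -(pmulr_lge0 _ (a0 0%N)); have := h 0%N; rewrite big_ord1 => ->.
have hF := renewal_of_convolution h.
have F0 := @kaluza_ge0 a (fun k => u k - u k.+1) _ a0 la u00 hF.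
split=> n; last by rewrite -subr_ge0.
(* For the decrements of [u] the constant is [u 0], and the partial sums telescope: the bound reads
   [u 0 - u n.+1 <= u 0]. *)
case: n => [//|n]; have := @renewal_sum_le a (fun k => u k - u k.+1) _ a0 na F0 hF n.
have -> : \sum_(k < n.+1) (u k - u k.+1) = u 0%N - u n.+1.
  elim: n => [|n IH]; first by rewrite big_ord1.
  by rewrite big_ord_recr/= IH; ring.
by rewrite lerBlDr lerDl.
Qed.

(** Kaluza's elimination one order higher: [c] is eliminated between the equations for [d n.+1] and
    [d n.+2]. With [F] the decrements of [u], the conclusion is convexity of [u]. *)
Lemma renewal_convex a F c (d := fun n => a n - a n.+1) : (forall n, 0 < a n) ->
  log_convex_seq a -> (forall n, 0 < d n) -> log_convex_seq d -> 0 <= c ->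
  (forall n, c * a n.+1 = \sum_(k < n.+1) F k * a (n - k)%N) ->
  nonincreasing_from_start F.
Proof.
move=> a0 la d0 ld c0 hF.
have F0 := kaluza_ge0 a0 la c0 hF.
(* The induction compares the newest term with all earlier ones, since the sum in [e4] involves
   every [F k]. *)
suff H n : forall j, (j <= n)%N -> F n.+1 <= F j by move=> n; exact: H.
elim: n => [|n IH] j jn.
  move: jn; rewrite leqn0 => /eqP ->.
  have h0 := hF 0%N; have h1 := hF 1%N.
  rewrite big_ord1 subn0 in h0; rewrite !big_ord_recr big_ord0/= add0r subn0 subnn in h1.
  have d00 := d0 0%N; have d10 := d0 1%N; rewrite /d !subr_gt0 in d00 d10.
  have a00 := a0 0%N; have a10 := a0 1%N; have a20 := a0 2%N.
  rewrite -(ler_pM2r a00) -(ler_pM2r a10).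
  have -> : F 1%N * a 0%N * a 1%N = F 0%N * a 0%N * a 2%N - F 0%N * a 1%N ^+ 2.
    transitivity (a 1%N * (c * a 2%N) - F 0%N * a 1%N ^+2); first by rewrite h1; ring.
    by rewrite mulrCA (mulrA c) h0.
  have F00 := F0 0%N.
  have : F 0%N * a 0%N * a 2%N <= F 0%N * a 0%N * a 1%N.
    by apply: ler_wpM2l; [apply: mulr_ge0 => //; exact: ltW | exact: ltW].
  have : 0 <= F 0%N * a 1%N ^+ 2 by rewrite mulr_ge0// sqr_ge0.
  lra.
have Fn : F n.+2 <= F n.+1; last first.
  move: jn; rewrite leq_eqVlt => /orP[/eqP -> //|jn].
  by apply: le_trans Fn _; apply: IH; rewrite -ltnS.
have e1 : c * d n.+1 = \sum_(k < n.+1) F k * d (n - k)%N - F n.+1 * a 0%N.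
  rewrite /d mulrBr hF hF [X in _ - X]big_ord_recr/= subnn opprD addrA; congr (_ - _).
  rewrite -sumrN -big_split/=; apply: eq_bigr => k _.
  by rewrite subSn -1?ltnS// mulrBr.
have e2 : c * d n.+2 = \sum_(k < n.+1) F k * d (n.+1 - k)%N + F n.+1 * d 0%N
    - F n.+2 * a 0%N.
  rewrite /d mulrBr hF hF [X in _ - X]big_ord_recr/= subnn opprD addrA; congr (_ - _).
  rewrite -sumrN -big_split/= big_ord_recr/= subnn subSnn mulrBr; congr (_ + _).
  apply: eq_bigr => k _.
  by rewrite (subSn (n:=n.+1)) ?mulrBr// ltnW.
have e3 : d n.+1 * a 0%N * F n.+2 = F n.+1 * (d 0%N * d n.+1 + d n.+2 * a 0%N)
   - \sum_(k < n.+1) F k * (d n.+2 * d (n - k)%N - d n.+1 * d (n.+1 - k)%N).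
  under eq_bigr => k _ do rewrite mulrBr !(mulrCA (F k)).
  rewrite big_split/= sumrN -!mulr_sumr.
  have -> : \sum_(k < n.+1) F k * d (n - k)%N = c * d n.+1 + F n.+1 * a 0%N.
    by rewrite e1 subrK.
  have -> : \sum_(k < n.+1) F k * d (n.+1 - k)%N =
      c * d n.+2 - F n.+1 * d 0%N + F n.+2 * a 0%N by rewrite e2; ring.
  ring.
have s1 : \sum_(k < n.+1) d (n - k)%N = a 0%N - a n.+1.
  clear; elim: n => [|n IH]; first by rewrite big_ord1.
  by rewrite big_ord_recl/= subn0 IH /d; ring.
have s2 : \sum_(k < n.+1) d (n.+1 - k)%N = a 1%N - a n.+2.
  clear; elim: n => [|n IH]; first by rewrite big_ord1.
  by rewrite big_ord_recl/= subn0 IH /d; ring.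
(* The coefficients are nonnegative by log-convexity of [d], so each [F k] may be lowered to
   [F n.+1]; the sums of [d] left over telescope. *)
have e4 : F n.+1 * (d n.+2 * (a 0%N - a n.+1) - d n.+1 * (a 1%N - a n.+2)) <=
   \sum_(k < n.+1) F k * (d n.+2 * d (n - k)%N - d n.+1 * d (n.+1 - k)%N).
  rewrite -s1 -s2 !mulr_sumr -sumrN -big_split/= mulr_sumr.
  apply: ler_sum => k _; apply: ler_wpM2r.
    rewrite subr_ge0 subSn -1?ltnS// mulrC (mulrC (d n.+2)).
    by apply: log_convex_seq_ratio => //; rewrite leq_subr.
  by apply: IH; rewrite -ltnS.
(* This is log-convexity of [a] rewritten with [d]; it brings the factor of [F n.+1] down to
   [d n.+1 * a 0]. *)
have k1 : d n.+2 * a n.+1 <= d n.+1 * a n.+2.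
  have := la n.+1; rewrite /d; lra.
have da : 0 < d n.+1 * a 0%N by rewrite mulr_gt0.
rewrite -(ler_pM2l da) e3.
have := ler_wpM2l (F0 n.+1) k1.
move: e4; rewrite /d; lra.
Qed.

Lemma convex_seq_second_difference u :
  nonincreasing_from_start (fun n => u n - u n.+1) ->
  forall p m, 0 <= u (p + m + m)%N - 2 * u (p + m)%N + u p.
Proof.
move=> cu p m.
have tel k q : u q - u (q + k)%N = \sum_(j < k) (u (q + j)%N - u (q + j).+1).
  elim: k => [|k IH]; first by rewrite big_ord0 addn0 subrr.
  by rewrite big_ord_recr/= -IH addnS; ring.
have -> : u (p + m + m)%N - 2 * u (p + m)%N + u p =
  (u p - u (p + m)%N) - (u (p + m)%N - u (p + m + m)%N) by ring.
rewrite !tel subr_ge0; apply: ler_sum => j _.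
by apply: (nonincreasing_from_startP cu); lia.
Qed.

(* The terms of the convolution that a full second difference of [u] does not
   reach are the only ones that need not have a sign. *)
Lemma renewal_second_difference_le a u c : (forall n, 0 <= a n) ->
  nonincreasing_from_start a -> (forall n, 0 <= u n) ->
  nonincreasing_from_start u -> nonincreasing_from_start (fun n => u n - u n.+1) ->
  (forall n, \sum_(k < n.+1) u k * a (n - k)%N = c) ->
  forall p m, a 0%N * (u (p + m + m)%N - 2 * u (p + m)%N + u p) <=
    (2 * m)%:R * (u 0%N * a p - u (m + m)%N * a (p + m + m)%N).
Proof.
move=> a0 na u0 nu cu h p m.
have h' n : \sum_(k < n.+1) a k * u (n - k)%N = c.
  rewrite -(h n) (reindex_inj rev_ord_inj)/=; apply: eq_bigr => k _.
  by rewrite mulrC; congr (u _ * a _); rewrite subSS ?subKn// -ltnS.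
(* The first [p.+1] terms are those on which the second difference in [q] acts in full; the second
   sum is the overhang. *)
have spl q : \sum_(k < p.+1) a k * u (p + q - k)%N +
    \sum_(j < q) a (p.+1 + j)%N * u (q - j.+1)%N = c.
  rewrite -(h' (p + q)%N) -addSn big_split_ord/=; congr (_ + _).
  by apply: eq_bigr => j _; congr (_ * u _); lia.
have E0 := spl 0%N; have E1 := spl m; have E2 := spl (m + m)%N.
rewrite big_ord0 addr0 addn0 in E0; rewrite addnA in E2.
have A : a 0%N * (u (p + m + m)%N - 2 * u (p + m)%N + u p) <=
    \sum_(k < p.+1) a k * u (p + m + m - k)%N
    - 2 * (\sum_(k < p.+1) a k * u (p + m - k)%N) + \sum_(k < p.+1) a k * u (p - k)%N.
  rewrite mulr_sumr -sumrN -!big_split/= big_ord_recl/= !subn0.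
  have -> : a 0%N * u (p + m + m)%N - 2 * (a 0%N * u (p + m)%N) + a 0%N * u p =
     a 0%N * (u (p + m + m)%N - 2 * u (p + m)%N + u p) by ring.
  rewrite lerDl; apply: sumr_ge0 => k _.
  have k1 : (bump 0 k <= p)%N by rewrite /bump/= add1n.
  have := convex_seq_second_difference cu (p - bump 0 k) m.
  rewrite (_ : p - bump 0 k + m = p + m - bump 0 k)%N; last by lia.
  rewrite (_ : p + m - bump 0 k + m = p + m + m - bump 0 k)%N; last by lia.
  move: (u _) (u _) (u _) => x y z /(mulr_ge0 (a0 (bump 0 k))).
  by rewrite mulrDr mulrBr (mulrCA _ 2).
have B : 2 * (\sum_(j < m) a (p.+1 + j)%N * u (m - j.+1)%N) <= (2 * m)%:R * (u 0%N * a p).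
  rewrite natrM -mulrA ler_pM2l//.
  rewrite mulr_natl -[m in _ *+ m]card_ord -sumr_const.
  apply: ler_sum => j _; rewrite mulrC.
  by apply: ler_pM => //; [exact: (nonincreasing_from_startP nu)|apply: (nonincreasing_from_startP na); have := ltn_ord j; lia].
have C : (2 * m)%:R * (u (m + m)%N * a (p + m + m)%N) <=
    \sum_(j < m + m) a (p.+1 + j)%N * u (m + m - j.+1)%N.
  rewrite mulr_natl mul2n -addnn -[X in _ *+ X]card_ord -sumr_const.
  apply: ler_sum => j _; rewrite mulrC.
  by apply: ler_pM => //; [apply: (nonincreasing_from_startP na)|apply: (nonincreasing_from_startP nu)]; have := ltn_ord j; lia.
(* In [E2 - 2 E1 + E0] the constant [c] cancels, leaving twice the overhang at [m] minus the
   overhang at [m + m], bounded by [B] and [C]. *)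
lra.
Qed.

End kaluza.

(** * Convex functions on the positive half-line *)

Section convex_on_positive_reals.
Context (R : realType).
Implicit Types (f g : R -> R) (x y z d e : R).

(** The chord inequality, polynomial in points and values: it passes to pointwise limits and is
    directly usable by linear arithmetic. *)
Definition three_slope f := forall x y z, 0 < x -> x < y -> y < z ->
  (z - x) * f y <= (z - y) * f x + (y - x) * f z.

Lemma convex_onE (D : set R) f : convex_on D f <->
  forall t x y, 0 <= t -> t <= 1 -> D x -> D y ->
    f (t * x + (1 - t) * y) <= t * f x + (1 - t) * f y.
Proof.
split=> [cf t x y t0 t1 Dx Dy|cf t x y].
  by apply: (cf (Itv01 t0 t1)); rewrite inE.
rewrite !inE => Dx Dy; apply: (cf t%:num) => //.
Qed.

Lemma three_slopeP f : three_slope f <-> convex_on `]0, +oo[ f.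
Proof.
rewrite convex_onE; split=> [cf t x y t0 t1|cf x y z x0 xy yz].
  rewrite /= !in_itv/= !andbT => x0 y0.
  have [->|tn0] := eqVneq t 0; first by rewrite subr0 !mul0r !add0r !mul1r.
  have [->|tn1] := eqVneq t 1; first by rewrite subrr !mul0r !addr0 !mul1r.
  have {tn0}t0 : 0 < t by rewrite lt_def tn0.
  have {tn1}t1 : t < 1 by rewrite lt_neqAle tn1.
  have [xy|xy|->] := ltgtP x y; last by rewrite -!mulrDl addrC subrK !mul1r.
    have h1 : x < t * x + (1 - t) * y.
      by rewrite -subr_gt0 [X in 0 < X](_ : _ = (1 - t) * (y - x)) ?mulr_gt0 ?subr_gt0//; ring.
    have h2 : t * x + (1 - t) * y < y.
      by rewrite -subr_gt0 [X in 0 < X](_ : _ = t * (y - x)) ?mulr_gt0 ?subr_gt0//; ring.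
    have := cf _ _ _ x0 h1 h2.
    rewrite (_ : y - (t * x + (1 - t) * y) = t * (y - x)); last by ring.
    rewrite (_ : t * x + (1 - t) * y - x = (1 - t) * (y - x)); last by ring.
    rewrite -[X in _ -> is_true X](@ler_pM2l _ (y - x)) ?subr_gt0//.
    by move=> /le_trans; apply; rewrite le_eqVlt; apply/orP; left; apply/eqP; ring.
  have h1 : t * x + (1 - t) * y < x.
    by rewrite -subr_gt0 [X in 0 < X](_ : _ = (1 - t) * (x - y)) ?mulr_gt0 ?subr_gt0//; ring.
  have h2 : y < t * x + (1 - t) * y.
    by rewrite -subr_gt0 [X in 0 < X](_ : _ = t * (x - y)) ?mulr_gt0 ?subr_gt0//; ring.
  have := cf _ _ _ y0 h2 h1.
  rewrite (_ : t * x + (1 - t) * y - y = t * (x - y)); last by ring.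
  rewrite (_ : x - (t * x + (1 - t) * y) = (1 - t) * (x - y)); last by ring.
  rewrite -[X in _ -> is_true X](@ler_pM2l _ (x - y)) ?subr_gt0//.
  by move=> /le_trans; apply; rewrite le_eqVlt; apply/orP; left; apply/eqP; ring.
have xz := lt_trans xy yz.
have zx0 : 0 < z - x by rewrite subr_gt0.
have t0 : 0 <= (z - y) / (z - x) by rewrite divr_ge0 ?subr_ge0// ltW.
have t1 : (z - y) / (z - x) <= 1 by rewrite ler_pdivrMr// mul1r lerD2l lerN2 ltW.
have := cf _ x z t0 t1; rewrite /= !in_itv/= !andbT => /(_ x0 (lt_trans x0 xz)).
rewrite (_ : _ * x + _ * z = y); last by field; rewrite gt_eqF.
rewrite -[X in is_true X -> _](@ler_pM2l _ (z - x)) ?subr_gt0//.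
by move=> /le_trans; apply; rewrite le_eqVlt; apply/orP; left; apply/eqP; field; rewrite gt_eqF.
Qed.

Lemma derive1_approx f x : derivable f x 1 -> forall e, 0 < e ->
  exists2 d, 0 < d & forall h, `|h| < d ->
    `|f (x + h) - f x - derive1 f x * h| <= e * `|h|.
Proof.
move=> fx e e0.
have /cvgrPdist_le/(_ e e0) : (h^-1 *: ((f \o shift x) (h *: 1) - f x)) @[h --> 0^'] --> derive1 f x.
  by rewrite derive1E; exact: fx.
move=> /nbhs_ballP[d /= d0 hd]; exists d => // h hh.
have [->|h0] := eqVneq h 0; first by rewrite addr0 subrr mulr0 subr0 normr0 mulr0.
have := hd h; rewrite /ball/= sub0r normrN => /(_ hh h0).
rewrite /= scaler1 (addrC h); move: (derive1 f x) => l H.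
have -> : f (x + h) - f x - l * h = - h * (l - h^-1 *: (f (x + h) - f x)).
  by rewrite /GRing.scale/=; field.
by rewrite normrM normrN mulrC ler_wpM2r.
Qed.

Lemma derivable_approx f x l : (forall e, 0 < e ->
  exists2 d, 0 < d & forall h, `|h| < d -> `|f (x + h) - f x - l * h| <= e * `|h|) ->
  is_derive x 1 f l.
Proof.
move=> H.
have L : (h^-1 *: ((f \o shift x) (h *: 1) - f x)) @[h --> 0^'] --> l.
  apply/cvgrPdist_le => e e0; have [d d0 hd] := H e e0.
  apply/nbhs_ballP; exists d => //= h; rewrite /ball/= sub0r normrN => hh h0.
  rewrite scaler1 (addrC h).
  have := hd h hh.
  have -> : f (x + h) - f x - l * h = - h * (l - h^-1 *: (f (x + h) - f x)).
    by rewrite /GRing.scale/=; field.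
  by rewrite normrM normrN mulrC ler_pM2r ?normr_gt0.
by split; [apply/cvg_ex; exists l|exact/cvg_lim].
Qed.

Lemma three_slope_right f x h k : three_slope f -> 0 < x -> 0 < h -> h <= k ->
  (f (x + h) - f x) * k <= (f (x + k) - f x) * h.
Proof.
move=> cf x0 h0; rewrite le_eqVlt => /orP[/eqP -> //|hk].
by have := cf x (x + h) (x + k) x0 ltac:(lra) ltac:(lra); lra.
Qed.

Lemma three_slope_left f x h k : three_slope f -> 0 < h -> h <= k -> k < x ->
  (f x - f (x - k)) * h <= (f x - f (x - h)) * k.
Proof.
move=> cf h0; rewrite le_eqVlt => /orP[/eqP -> //|hk] kx.
by have := cf (x - k) (x - h) x ltac:(lra) ltac:(lra) ltac:(lra); lra.
Qed.

Lemma three_slope_mid f x h k : three_slope f -> 0 < h -> h < x -> 0 < k ->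
  (f x - f (x - h)) * k <= (f (x + k) - f x) * h.
Proof.
move=> cf h0 hx k0.
by have := cf (x - h) x (x + k) ltac:(lra) ltac:(lra) ltac:(lra); lra.
Qed.

(** Chord slopes from [x] over steps up to [k = x / 2] are controlled by the two slopes over step
    [k], so [f] is Lipschitz at [x] with constant [M]; the added 1 keeps [M] positive. *)
Lemma three_slope_continuous f x : three_slope f -> 0 < x -> {for x, continuous f}.
Proof.
move=> cf x0; apply/cvgrPdist_le => e e0.
pose k := x / 2.
have k0 : 0 < k by rewrite /k; lra.
have kx : k < x by rewrite /k; lra.
pose M := (`|f (x + k) - f x| + `|f x - f (x - k)|) / k + 1.
have M0 : 0 < M.
  have := divr_ge0 (addr_ge0 (normr_ge0 (f (x + k) - f x)) (normr_ge0 (f x - f (x - k)))) (ltW k0).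
  by rewrite /M; lra.
have A1 : f (x + k) - f x <= M * k.
  rewrite /M mulrDl divfK ?gt_eqF// mul1r.
  have := ler_norm (f (x + k) - f x); have := normr_ge0 (f x - f (x - k)); lra.
have A2 : - (f x - f (x - k)) <= M * k.
  rewrite /M mulrDl divfK ?gt_eqF// mul1r.
  have := ler_norm (- (f x - f (x - k))); rewrite normrN.
  have := normr_ge0 (f (x + k) - f x); lra.
have B h : 0 < h -> h <= k -> `|f (x + h) - f x| <= M * h /\ `|f (x - h) - f x| <= M * h.
  move=> h0 hk.
  have r := three_slope_right cf x0 h0 hk.
  have l := three_slope_left cf h0 hk kx.
  have m1 := three_slope_mid cf k0 kx h0.
  have m2 := three_slope_mid cf h0 (le_lt_trans hk kx) k0.
  have Mh1 : (f (x + k) - f x) * h <= M * k * h by rewrite ler_pM2r.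
  have Mh2 : - (f x - f (x - k)) * h <= M * k * h by rewrite ler_pM2r.
  by split; rewrite ler_norml; apply/andP; split;
    rewrite -(ler_pM2r k0); lra.
apply/nbhs_ballP; exists (Num.min k (e / M)).
  by rewrite /= lt_min k0 divr_gt0.
move=> y; rewrite /ball/= lt_min => /andP[yk ye].
have [<-|yx] := eqVneq y x; first by rewrite subrr normr0 ltW.
have {}ye : M * `|x - y| <= e by rewrite mulrC -ler_pdivlMr// ltW.
rewrite distrC; have [xy|xy] := ltP x y.
  have [+ _] := B (y - x) ltac:(lra) ltac:(move: yk; rewrite distrC gtr0_norm; lra).
  by rewrite (addrCA x) subrr addr0 => /le_trans; apply; move: ye; rewrite distrC gtr0_norm// subr_gt0.
have {}xy : y < x by rewrite lt_neqAle yx.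
have [_ +] := B (x - y) ltac:(lra) ltac:(move: yk; rewrite gtr0_norm; lra).
by rewrite subKr => /le_trans; apply; move: ye; rewrite gtr0_norm// subr_gt0.
Qed.

(** Left slopes stay below the infimum of the right slopes. One step [h] with a small second
    difference brings both within [e] of it, and monotonicity of slopes settles all smaller steps,
    so one [h] per [e] is enough. *)
Lemma three_slope_derivable f x : three_slope f -> 0 < x ->
  (forall e, 0 < e -> exists h, [/\ 0 < h, h < x &
     f (x + h) - 2 * f x + f (x - h) <= e * h]) ->
  derivable f x 1.
Proof.
move=> cf x0 H.
pose S := [set (f (x + h) - f x) / h | h in [set h | 0 < h]].
have S0 : S !=set0 by exists ((f (x + 1) - f x) / 1); exists 1 => //=; lra.
have Slb k : 0 < k -> k < x -> lbound S ((f x - f (x - k)) / k).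
  move=> k0 kx _ [h /= h0 <-].
  by rewrite ler_pdivrMr// mulrAC ler_pdivlMr//; exact: three_slope_mid.
have hS : has_inf S.
  by split => //; exists ((f x - f (x - x / 2)) / (x / 2)); apply: Slb; lra.
suff : is_derive x 1 f (inf S) by case.
apply: derivable_approx => e e0; have [k [k0 kx Hk]] := H e e0.
exists k => // h hk.
have l1 : inf S <= (f (x + k) - f x) / k by apply: ge_inf; [case: hS|exists k].
have l2 : (f x - f (x - k)) / k <= inf S by apply: lb_le_inf => //; exact: Slb.
move: l1 l2; rewrite ler_pdivrMr// ler_pdivlMr//; set L := inf S => l1 l2.
have [->|h0] := eqVneq h 0; first by rewrite addr0 subrr mulr0 subr0 normr0 mulr0.
have eh : 0 < `|h| by rewrite normr_gt0.
have [hp|hn] := ltP 0 h.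
  move: hk; rewrite gtr0_norm// => hk.
  have r := three_slope_right cf x0 hp (ltW hk).
  have m := three_slope_mid cf k0 kx hp.
  have H1 := ler_wpM2r (ltW hp) l1; have H2 := ler_wpM2r (ltW hp) l2.
  have H3 := ler_wpM2r (ltW hp) Hk.
  by rewrite ler_norml; apply/andP; split; rewrite -(ler_pM2r k0); lra.
have {}hn : h < 0 by rewrite lt_neqAle h0.
move: hk eh; rewrite ltr0_norm//; have -> : h = - (- h) by rewrite opprK.
move: (- h) => {h h0 hn} h; rewrite opprK => hk hp.
have r := three_slope_left cf hp (ltW hk) kx.
have m := three_slope_mid cf hp (lt_trans hk kx) k0.
have H1 := ler_wpM2r (ltW hp) l1; have H2 := ler_wpM2r (ltW hp) l2.
have H3 := ler_wpM2r (ltW hp) Hk.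
by rewrite ler_norml; apply/andP; split; rewrite -(ler_pM2r k0); lra.
Qed.

Lemma three_slope_tangent f x y : three_slope f -> 0 < x -> 0 < y ->
  derivable f x 1 -> f x + derive1 f x * (y - x) <= f y.
Proof.
move=> cf x0 y0 fx; apply/ler_addgt0Pr => e e0.
have [->|yx] := eqVneq y x; first by rewrite subrr mulr0 addr0 lerDl ltW.
have d0 : 0 < `|y - x| by rewrite normr_gt0 subr_eq0.
have [d dp hd] := derive1_approx fx (divr_gt0 e0 d0).
move: (derive1 f x) hd => D hd.
have [xy|xy] := ltP x y.
  pose h := Num.min (d / 2) (y - x).
  have h0 : 0 < h by rewrite /h lt_min subr_gt0 xy andbT; lra.
  have hy : h <= y - x by rewrite /h ge_min lexx orbT.
  have hd2 : h <= d / 2 by rewrite /h ge_min lexx.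
  have := hd h; rewrite gtr0_norm// => /(_ ltac:(lra)).
  have := three_slope_right cf x0 h0 hy; rewrite addrCA subrr addr0.
  rewrite (gtr0_norm (x := y - x)) ?subr_gt0// ler_norml => H1 /andP[H2 _].
  have yx0 : 0 < y - x by rewrite subr_gt0.
  rewrite -(ler_pM2r h0).
  have := ler_wpM2r (ltW yx0) H2.
  rewrite (_ : - (e / (y - x) * h) * (y - x) = - (e * h)); last by field; rewrite gt_eqF.
  lra.
have {}xy : y < x by rewrite lt_neqAle yx.
pose h := Num.min (d / 2) (x - y).
have h0 : 0 < h by rewrite /h lt_min subr_gt0 xy andbT; lra.
have hy : h <= x - y by rewrite /h ge_min lexx orbT.
have hd2 : h <= d / 2 by rewrite /h ge_min lexx.
have := hd (- h); rewrite normrN gtr0_norm// => /(_ ltac:(lra)).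
have xyx : x - y < x by rewrite gtrBl.
have := three_slope_left cf h0 hy xyx; rewrite subKr.
rewrite (ltr0_norm (x := y - x)) ?subr_lt0// opprB ler_norml => H1 /andP[H2 _].
have yx0 : 0 < x - y by rewrite subr_gt0.
rewrite -(ler_pM2r h0).
have := ler_wpM2r (ltW yx0) H2.
rewrite (_ : - (e / (x - y) * h) * (x - y) = - (e * h)); last by field; rewrite gt_eqF.
lra.
Qed.

(** Tangents lie below the graph, so the derivative at [y] is squeezed between the chord slopes over
    [[y - h, y]] and [[y, y + h]]. For fixed [h] these are continuous in [y], and at [x] they are
    within [e / 3] of the derivative. *)
Lemma three_slope_derive1_continuous f x : three_slope f ->
  (forall y, 0 < y -> derivable f y 1) -> 0 < x -> {for x, continuous (derive1 f)}.
Proof.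
move=> cf df x0; apply/cvgrPdist_le => e e0.
have e3 : 0 < e / 3 by rewrite divr_gt0.
have [d dp hd] := derive1_approx (df _ x0) e3.
pose h := Num.min (d / 2) (x / 3).
have h0 : 0 < h by rewrite /h lt_min; apply/andP; split; lra.
have hx : h <= x / 3 by rewrite /h ge_min lexx orbT.
have hd2 : h <= d / 2 by rewrite /h ge_min lexx.
have := hd h; rewrite gtr0_norm// => /(_ ltac:(lra)); rewrite ler_norml => /andP[P1 P2].
have := hd (- h); rewrite normrN gtr0_norm// => /(_ ltac:(lra)); rewrite ler_norml => /andP[N1 N2].
(* The error allowed on each endpoint of a chord: two of them, divided by [h], make [e / 3]. *)
have eh : 0 < e / 3 * h / 2 by rewrite !mulr_gt0.
have C0 := three_slope_continuous cf x0; move/cvgrPdist_le/(_ _ eh): C0 => C0.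
have shp : (y + h) @[y --> x] --> x + h by apply: cvgD; [exact: cvg_id|exact: cvg_cst].
have shn : (y - h) @[y --> x] --> x - h by apply: cvgB; [exact: cvg_id|exact: cvg_cst].
have xh0 : 0 < x + h by lra.
have xh1 : 0 < x - h by lra.
have : f (y + h) @[y --> x] --> f (x + h).
  by apply: cvg_comp shp _; exact: three_slope_continuous.
move/cvgrPdist_le/(_ _ eh) => Cp.
have : f (y - h) @[y --> x] --> f (x - h).
  by apply: cvg_comp shn _; exact: three_slope_continuous.
move/cvgrPdist_le/(_ _ eh) => Cn.
near=> y.
have y0 : h < y by near: y; apply: lt_nbhsr; lra.
have c0 : `|f x - f y| <= e / 3 * h / 2 by near: y.
have cp : `|f (x + h) - f (y + h)| <= e / 3 * h / 2 by near: y.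
have cn : `|f (x - h) - f (y - h)| <= e / 3 * h / 2 by near: y.
have yy : 0 < y := lt_trans h0 y0.
have yp : 0 < y + h by rewrite addr_gt0.
have ym : 0 < y - h by rewrite subr_gt0.
have T1 := three_slope_tangent cf yy yp (df _ yy).
have T2 := three_slope_tangent cf yy ym (df _ yy).
move: c0 cp cn; rewrite !ler_norml => /andP[a1 a2] /andP[a3 a4] /andP[a5 a6].
by apply/andP; split; rewrite -(ler_pM2r h0); lra.
Unshelve. all: by end_near.
Qed.

End convex_on_positive_reals.

(** * Limits of sequences along shrinking grids *)

Section grid_limits.
Context (R : realType).
Implicit Types (s G : nat -> nat -> R) (f g : R -> R) (x y z e h : R).

Definition grid_seq (n_ : nat -> nat) x := (n_ N)%:R / N%:R @[N --> \oo] --> x.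

(** All index sequences on the scale [N] are allowed, because limits are later taken along sums,
    differences and successors of [grid] indices. *)
Definition grid_limit s f := forall x (n_ : nat -> nat), 0 < x ->
  grid_seq n_ x -> s N (n_ N) @[N --> \oo] --> f x.

Definition grid (x : R) (N : nat) : nat := Num.trunc (N%:R * x).

Lemma grid_cvg x : 0 <= x -> grid_seq (grid x) x.
Proof.
move=> x0; rewrite /grid_seq/grid.
have inv0 : (N.+1%:R : R)^-1 @[N --> \oo] --> (0 : R) by exact: cvg_harmonic.
(* Shifting by one keeps the denominator positive. *)
rewrite -(cvg_shiftS (fun N => (Num.trunc (N%:R * x))%:R / N%:R : R)) /=.
apply: (@squeeze_cvgr _ _ _ _ (fun N => x - N.+1%:R^-1) (fun=> x)).
- near=> N.
  have N0 : 0 < N.+1%:R :> R by [].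
  have /andP[h1 h2] : (Num.trunc (N.+1%:R * x))%:R <= N.+1%:R * x < (Num.trunc (N.+1%:R * x)).+1%:R.
    by apply: truncn_itv; rewrite mulr_ge0.
  apply/andP; split; last by rewrite ler_pdivrMr// (mulrC x).
  by rewrite ler_pdivlMr// mulrBl mulVf ?gt_eqF// lerBlDr (mulrC x) natr1 ltW.
- by rewrite -[X in _ --> X](subr0 x); apply: cvgB => //; exact: cvg_cst.
- exact: cvg_cst.
Unshelve. all: by end_near.
Qed.

Lemma grid_seqD m_ n_ x y : grid_seq m_ x -> grid_seq n_ y ->
  grid_seq (fun N => (m_ N + n_ N)%N) (x + y).
Proof.
move=> hm hn; rewrite /grid_seq; under eq_fun do rewrite natrD mulrDl.
exact: cvgD.
Qed.

Lemma grid_seqMn k n_ x : grid_seq n_ x -> grid_seq (fun N => (k * n_ N)%N) (k%:R * x).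
Proof.
move=> hn; rewrite /grid_seq; under eq_fun do rewrite natrM -mulrA.
by apply: cvgM => //; exact: cvg_cst.
Qed.

Lemma grid_seqS n_ x : grid_seq n_ x -> grid_seq (fun N => (n_ N).+1) x.
Proof.
move=> hn; rewrite /grid_seq -[X in _ --> X]addr0.
under eq_fun do rewrite -natr1 mulrDl mul1r.
apply: cvgD => //; rewrite -(cvg_shiftS (fun N => N%:R^-1 : R)).
exact: cvg_harmonic.
Qed.

Lemma le_grid x y N : 0 <= x -> x <= y -> (grid x N <= grid y N)%N.
Proof. by move=> x0 xy; apply: le_truncn; rewrite ler_wpM2l. Qed.

Lemma convex_seq_three a : nonincreasing_from_start (fun n => a n - a n.+1) ->
  forall i j k, (i <= j)%N -> (j <= k)%N ->
  (k%:R - i%:R) * a j <= (k%:R - j%:R) * a i + (j%:R - i%:R) * (a k : R).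
Proof.
move=> ca i j k /subnKC <-; move: (j - i)%N => p /subnKC <-; move: (k - _)%N => q.
have tel r m : a r - a (r + m)%N = \sum_(l < m) (a (r + l)%N - a (r + l).+1).
  elim: m => [|m IH]; first by rewrite big_ord0 addn0 subrr.
  by rewrite big_ord_recr/= -IH addnS; ring.
set F := fun n => a n - a n.+1 in ca.
have h1 : p%:R * F (i + p)%N <= a i - a (i + p)%N.
  rewrite tel mulr_natl -[X in _ *+ X]card_ord -sumr_const; apply: ler_sum => l _.
  by apply: (nonincreasing_from_startP ca); rewrite leq_add2l ltnW.
have h2 : a (i + p)%N - a (i + p + q)%N <= q%:R * F (i + p)%N.
  rewrite tel mulr_natl -[X in _ *+ X]card_ord -sumr_const; apply: ler_sum => l _.
  by apply: (nonincreasing_from_startP ca); rewrite leq_addr.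
rewrite !natrD.
have := ler_wpM2l (ler0n R q) h1; have := ler_wpM2l (ler0n R p) h2.
lra.
Qed.

Lemma grid_limit_three_slope s f :
  (\forall N \near \oo, nonincreasing_from_start (fun n => s N n - s N n.+1)) ->
  grid_limit s f -> three_slope f.
Proof.
move=> cs lf x y z x0 xy yz.
have y0 := lt_trans x0 xy; have z0 := lt_trans y0 yz.
have cx := grid_cvg (ltW x0); have cy := grid_cvg (ltW y0); have cz := grid_cvg (ltW z0).
have sx := lf _ _ x0 cx; have sy := lf _ _ y0 cy; have sz := lf _ _ z0 cz.
apply: (ler_cvg_to (cvgM (cvgB cz cx) sy)
  (cvgD (cvgM (cvgB cz cy) sx) (cvgM (cvgB cy cx) sz))).
near=> N.
have cN : nonincreasing_from_start (fun n => s N n - s N n.+1) by near: N.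
have H := convex_seq_three cN (le_grid N (ltW x0) (ltW xy)) (le_grid N (ltW y0) (ltW yz)).
rewrite !fctE/=.
have N0 : 0 < N%:R^-1 :> R by rewrite invr_gt0 ltr0n; near: N; exact: nbhs_infty_gt.
by move: H; rewrite -(ler_pM2r N0); lra.
Unshelve. all: by end_near.
Qed.

Lemma grid_limit_ge0 s f : (\forall N \near \oo, forall n, 0 <= s N n) ->
  grid_limit s f -> forall x, 0 < x -> 0 <= f x.
Proof.
move=> s0 lf x x0; have := lf _ _ x0 (grid_cvg (ltW x0)).
by move/cvgr_to_ge; apply; near=> N; near: N; apply: filterS s0 => N; exact.
Unshelve. all: by end_near.
Qed.

Lemma grid_limit_nonincreasing s f :
  (\forall N \near \oo, nonincreasing_from_start (s N)) ->
  grid_limit s f -> forall x y, 0 < x -> x <= y -> f y <= f x.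
Proof.
move=> cs lf x y x0 xy; have y0 := lt_le_trans x0 xy.
apply: ler_cvg_to (lf _ _ y0 (grid_cvg (ltW y0))) (lf _ _ x0 (grid_cvg (ltW x0))) _.
near=> N; apply: nonincreasing_from_startP; last exact/le_grid/xy/ltW.
by near: N.
Unshelve. all: by end_near.
Qed.

(* Summing the nonincreasing second differences at [n], [n - m], ...,
   [n - (K - 1) m] telescopes. *)
Lemma second_difference_third a (D := fun n => a n.+1 - a n : R) :
  0 <= a 0%N -> (forall n, 0 <= D n) -> nonincreasing_from_start D ->
  nonincreasing_from_start (fun n => D n - D n.+1) ->
  forall p m K,
  p%:R * K%:R * (2 * a (p + K * m)%N - a (p + K * m + m)%N - a (p + K * m - m)%N)
    <= m%:R * a p.
Proof.
(* [K = 0] is apart: [p + K * m - m] may then be a truncated subtraction, but the factor [K] makes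
   the left side 0. *)
move=> a0 D0 nD cD p m [|K]; first by rewrite mulr0 mul0r mulr_ge0//;
  elim: p => // p IH; have := D0 p; rewrite /D subr_ge0; apply: le_trans.
have tel r q : a (r + q)%N - a r = \sum_(l < q) D (r + l)%N.
  elim: q => [|q IH]; first by rewrite big_ord0 addn0 subrr.
  by rewrite big_ord_recr/= -IH addnS /D; ring.
pose C r := 2 * a (r + m)%N - a (r + m + m)%N - a r.
have CE r : C r = \sum_(l < m) (D (r + l)%N - D (r + m + l)%N).
  by rewrite sumrB -!tel /C; ring.
have nC r q : C (r + q)%N <= C r.
  rewrite !CE; apply: ler_sum => l _.
  have tel2 t k : D t - D (t + k)%N = \sum_(i < k) (D (t + i)%N - D (t + i).+1).
    elim: k => [|k IH]; first by rewrite big_ord0 addn0 subrr.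
    by rewrite big_ord_recr/= -IH addnS; ring.
  rewrite (addnAC r m l) (addnAC (r + q)%N m l) !tel2; apply: ler_sum => i _.
  by apply: (nonincreasing_from_startP cD); lia.
have -> : 2 * a (p + K.+1 * m)%N - a (p + K.+1 * m + m)%N - a (p + K.+1 * m - m)%N =
    C (p + K * m)%N.
  rewrite /C (_ : p + K.+1 * m - m = p + K * m)%N; last by rewrite mulSn; lia.
  by rewrite (_ : p + K.+1 * m = p + K * m + m)%N// mulSn; lia.
have h1 : K.+1%:R * C (p + K * m)%N <= \sum_(i < K.+1) C (p + i * m)%N.
  rewrite mulr_natl -[X in _ *+ X]card_ord -sumr_const; apply: ler_sum => i _.
  have -> : (p + K * m = p + i * m + (K - i) * m)%N.
    by rewrite -addnA -mulnDl subnKC// -ltnS ltn_ord.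
  exact: nC.
have h2 : \sum_(i < K.+1) C (p + i * m)%N =
    (a (p + m)%N - a p) - (a (p + K.+1 * m + m)%N - a (p + K.+1 * m)%N).
  elim: K {h1} => [|K IH]; first by rewrite big_ord1 mul0n addn0 mul1n /C; ring.
  rewrite big_ord_recr/= IH /C.
  have -> : (p + K.+2 * m = p + K.+1 * m + m)%N by rewrite (mulSn K.+1); lia.
  ring.
have incr r q : 0 <= a (r + q)%N - a r by rewrite tel sumr_ge0.
have h3 : a (p + m)%N - a p <= m%:R * D p.
  rewrite tel mulr_natl -[X in _ *+ X]card_ord -sumr_const; apply: ler_sum => l _.
  by apply: (nonincreasing_from_startP nD); rewrite leq_addr.
(* The first [p] increments are all at least [D p] and add up to at most [a p]. *)
have h4 : p%:R * D p <= a p.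
  have : a p - a 0%N <= a p by rewrite lerBlDr lerDl.
  apply: le_trans; have := tel 0%N p; rewrite add0n => ->.
  rewrite mulr_natl -[X in _ *+ X]card_ord -sumr_const; apply: ler_sum => l _.
  by apply: (nonincreasing_from_startP nD); rewrite add0n ltnW.
have h5 := incr (p + K.+1 * m)%N m.
have h6 : K.+1%:R * C (p + K * m)%N <= m%:R * D p by move: h1; rewrite h2; lra.
rewrite -mulrA; apply: le_trans (ler_wpM2l (ler0n R p) h6) _.
by rewrite mulrCA ler_wpM2l.
Qed.

(** [second_difference_third] with [p] near [N x / 2] and [m] near [N h], where [K * h = x / 2],
    bounds the second difference of [- f] at [x] by [h * f (x / 2)] over [x / 2 * K], of order
    [h ^+ 2]. *)
Lemma grid_limit_derivable G f :
  (\forall N \near \oo, [/\ 0 <= G N 0%N,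
     (forall n, 0 <= G N n.+1 - G N n),
     nonincreasing_from_start (fun n => G N n.+1 - G N n) &
     nonincreasing_from_start (fun n => (G N n.+1 - G N n) - (G N n.+2 - G N n.+1))]) ->
  grid_limit G f -> three_slope (fun x => - f x) ->
  (forall x y, 0 < x -> x <= y -> f x <= f y) ->
  forall x, 0 < x -> derivable f x 1.
Proof.
move=> hG lf cf mf x x0.
suff : derivable (fun y => - f y) x 1.
  move=> /derivableN; rewrite (_ : - (fun y => - f y) = f)//.
  by apply/funext => y; rewrite !fctE opprK.
apply: three_slope_derivable => // e e0.
(* [K] makes that quotient at most [e * h]; the constant 4 leaves room. *)
have [K K0 hK] : exists2 K : nat, (0 < K)%N & 4 * f x / (x * e) < K%:R.
  exists (Num.trunc `|4 * f x / (x * e)|).+1 => //.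
  have /andP[_] := truncn_itv (normr_ge0 (4 * f x / (x * e))).
  exact/le_lt_trans/ler_norm.
have K0' : 0 < K%:R :> R by rewrite ltr0n.
exists (x / (2 * K%:R)); set h := x / _.
have h0 : 0 < h by rewrite divr_gt0// mulr_gt0.
have hx : h < x.
  rewrite /h ltr_pdivrMr ?mulr_gt0// ltr_pMr//.
  have : 1 <= K%:R :> R by rewrite ler1n.
  lra.
split => //.
have Kh : K%:R * h = x / 2 by rewrite /h; field; rewrite gt_eqF.
have x20 : 0 < x / 2 by rewrite divr_gt0.
have cp := grid_cvg (ltW x20); have cm := grid_cvg (ltW h0).
have cn : grid_seq (fun N => (grid (x / 2) N + K * grid h N)%N) x.
  by have := grid_seqD cp (grid_seqMn (k := K) cm); rewrite Kh -splitr.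
have cnp := grid_seqD cn cm.
(* The natural subtraction is exact because [K] is positive. *)
have cnm : grid_seq (fun N => (grid (x / 2) N + K * grid h N - grid h N)%N) (x - h).
  apply: cvg_trans (cvgB cn cm); apply: near_eq_cvg; near=> N.
  rewrite !fctE natrB ?mulrBl//; apply: leq_trans (leq_addl _ _).
  by rewrite -[leqLHS]mul1n leq_mul2r K0 orbT.
have xp : 0 < x + h by lra.
have xm : 0 < x - h by lra.
have H := ler_cvg_to
  (cvgM (cvgM cp (cvg_cst (K%:R : R))) (cvgB (cvgB (cvgM (cvg_cst (2 : R)) (lf _ _ x0 cn)) (lf _ _ xp cnp)) (lf _ _ xm cnm)))
  (cvgM cm (lf _ _ x20 cp)).
have {}H : x / 2 * K%:R * (2 * f x - f (x + h) - f (x - h)) <= h * f (x / 2).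
  apply: H; near=> N; rewrite !fctE/=.
  have [g0 g1 g2 g3] : [/\ 0 <= G N 0%N,
     (forall n, 0 <= G N n.+1 - G N n),
     nonincreasing_from_start (fun n => G N n.+1 - G N n) &
     nonincreasing_from_start (fun n => (G N n.+1 - G N n) - (G N n.+2 - G N n.+1))].
    by near: N.
  have := second_difference_third g0 g1 g2 g3 (grid (x / 2) N) (grid h N) K.
  have N0 : 0 <= N%:R^-1 :> R by rewrite invr_ge0.
  move=> /(ler_wpM2r N0); rewrite !(mulrAC _ _ N%:R^-1) => /le_trans; apply.
  by [].
have fx2 : f (x / 2) <= f x by apply: mf; lra.
have H2 : 2 * f x - f (x + h) - f (x - h) <= e * h.
  have : h * f (x / 2) <= h * f x by rewrite ler_pM2l.
  move=> /(le_trans H) H3.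
  rewrite -(@ler_pM2l _ (x / 2 * K%:R)) ?mulr_gt0//.
  apply: le_trans H3 _.
  move: hK; rewrite ltr_pdivrMr ?mulr_gt0// => hK.
  rewrite (_ : _ * (e * h) = h * (K%:R * (x * e) / 2)); last by field.
  rewrite ler_pM2l// ler_pdivlMr//.
  have fx0 : 0 <= f x; last by lra.
  apply: (cvgr_to_ge (lf _ _ x0 cn)); near=> N.
  have [g0 g1 _ _] : [/\ 0 <= G N 0%N,
     (forall n, 0 <= G N n.+1 - G N n),
     nonincreasing_from_start (fun n => G N n.+1 - G N n) &
     nonincreasing_from_start (fun n => (G N n.+1 - G N n) - (G N n.+2 - G N n.+1))].
    by near: N.
  by elim: (_ + _)%N => // p IH; have := g1 p; rewrite subr_ge0; apply: le_trans.
lra.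
Unshelve. all: by end_near.
Qed.

Lemma concave_seq_forward a : nonincreasing_from_start (fun n => a n.+1 - a n) ->
  forall n m, a (n + m)%N - a n <= m%:R * (a n.+1 - a n : R).
Proof.
move=> ca n m.
have tel : a (n + m)%N - a n = \sum_(l < m) (a (n + l).+1 - a (n + l)%N).
  elim: m => [|m IH]; first by rewrite big_ord0 addn0 subrr.
  by rewrite big_ord_recr/= -IH addnS; ring.
rewrite tel mulr_natl -[X in _ *+ X]card_ord -sumr_const; apply: ler_sum => l _.
by apply: (nonincreasing_from_startP ca); rewrite leq_addr.
Qed.

Lemma concave_seq_backward a : nonincreasing_from_start (fun n => a n.+1 - a n) ->
  forall n m, (m <= n)%N -> m%:R * (a n.+1 - a n) <= a n - a (n - m)%N :> R.
Proof.
move=> ca n m /subnK; move: (n - m)%N => p <-.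
have tel : a (p + m)%N - a p = \sum_(l < m) (a (p + l).+1 - a (p + l)%N).
  elim: m => [|m IH]; first by rewrite big_ord0 addn0 subrr.
  by rewrite big_ord_recr/= -IH addnS; ring.
rewrite tel mulr_natl -[X in _ *+ X]card_ord -sumr_const; apply: ler_sum => l _.
by apply: (nonincreasing_from_startP ca); rewrite leq_add2l ltnW.
Qed.

(** Pointwise limits cannot be differentiated in general, but concavity puts a one-step increment
    between the mean increments over [grid h N] steps on either side. These converge for fixed [h]
    to chord slopes of [f], which are close to the derivative for small [h]. *)
Lemma grid_limit_derive1 G f :
  (\forall N \near \oo, nonincreasing_from_start (fun n => G N n.+1 - G N n)) ->
  grid_limit G f -> (forall x, 0 < x -> derivable f x 1) ->
  grid_limit (fun N n => N%:R * (G N n.+1 - G N n)) (derive1 f).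
Proof.
move=> cG lf df x n_ x0 hn; apply/cvgrPdist_le => e e0.
have e3 : 0 < e / 2 by rewrite divr_gt0.
have [d dp hd] := derive1_approx (df _ x0) e3.
pose h := Num.min (d / 2) (x / 2).
have h0 : 0 < h by rewrite /h lt_min; apply/andP; split; lra.
have hx : h <= x / 2 by rewrite /h ge_min lexx orbT.
have hd2 : h <= d / 2 by rewrite /h ge_min lexx.
have := hd h; rewrite gtr0_norm// => /(_ ltac:(lra)); rewrite ler_norml => /andP[P1 _].
have := hd (- h); rewrite normrN gtr0_norm// => /(_ ltac:(lra)); rewrite ler_norml => /andP[N1 _].
have cm := grid_cvg (ltW h0).
have xp : 0 < x + h by lra.
have xm : 0 < x - h by lra.
have cd : ((n_ N)%:R / N%:R - (grid h N)%:R / N%:R : R) @[N --> \oo] --> x - h by exact: cvgB.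
have cnm : grid_seq (fun N => (n_ N - grid h N)%N) (x - h).
  have lt_mn : \forall N \near \oo, (grid h N)%:R / N%:R < (n_ N)%:R / N%:R :> R.
    move/cvgrPdist_lt/(_ _ xm): (cd); apply: filterS => N.
    by rewrite ltr_norml => /andP[_]; lra.
  apply: cvg_trans (cvgB hn cm); apply: near_eq_cvg; near=> N.
  rewrite !fctE natrB ?mulrBl//.
  have : (grid h N)%:R / N%:R < (n_ N)%:R / N%:R :> R by near: N.
  rewrite ltr_pM2r ?ltr_nat; first exact: ltnW.
  by rewrite invr_gt0 ltr0n; near: N; exact: nbhs_infty_gt.
have hne : h != 0 by rewrite gt_eqF.
have lp' : (G N (n_ N + grid h N)%N - G N (n_ N)) / ((grid h N)%:R / N%:R)
    @[N --> \oo] --> (f (x + h) - f x) / h.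
  by apply: cvgM; [apply: cvgB; [exact: (lf _ _ xp (grid_seqD hn cm))|exact: lf]|exact: (cvgV hne cm)].
have ln' : (G N (n_ N) - G N (n_ N - grid h N)%N) / ((grid h N)%:R / N%:R)
    @[N --> \oo] --> (f x - f (x - h)) / h.
  by apply: cvgM; [apply: cvgB; [exact: lf|exact: (lf _ _ xm cnm)]|exact: (cvgV hne cm)].
move/cvgrPdist_le/(_ _ e3): lp' => lp'; move/cvgrPdist_le/(_ _ e3): ln' => ln'.
have mpos : \forall N \near \oo, 0 < (grid h N)%:R / N%:R :> R.
  have := cm; rewrite /grid_seq => /cvgrPdist_lt/(_ _ h0); apply: filterS => N.
  by rewrite ltr_norml => /andP[_]; lra.
have mn : \forall N \near \oo, (grid h N)%:R / N%:R < (n_ N)%:R / N%:R :> R.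
  move/cvgrPdist_lt/(_ _ xm): (cd); apply: filterS => N.
  by rewrite ltr_norml => /andP[_]; lra.
near=> N.
have N0 : (0 < N)%N by near: N; exact: nbhs_infty_gt.
have N0' : 0 < N%:R :> R by rewrite ltr0n.
have m0 : 0 < (grid h N)%:R / N%:R :> R by near: N.
have cN : nonincreasing_from_start (fun n => G N n.+1 - G N n) by near: N.
have s1 := concave_seq_forward cN (n_ N) (grid h N).
have s2 : (grid h N)%:R * (G N (n_ N).+1 - G N (n_ N)) <= G N (n_ N) - G N (n_ N - grid h N)%N.
  apply: concave_seq_backward => //; have : (grid h N)%:R / N%:R < (n_ N)%:R / N%:R :> R by near: N.
  by rewrite ltr_pM2r ?invr_gt0// ltr_nat => /ltnW.
have E : (grid h N)%:R * (G N (n_ N).+1 - G N (n_ N)) =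
   N%:R * (G N (n_ N).+1 - G N (n_ N)) * ((grid h N)%:R / N%:R) by field; rewrite gt_eqF.
rewrite E in s1 s2; rewrite -ler_pdivrMr// in s1; rewrite -ler_pdivlMr// in s2.
have : `|(f (x + h) - f x) / h - (G N (n_ N + grid h N)%N - G N (n_ N)) / ((grid h N)%:R / N%:R)| <= e / 2 by near: N.
have : `|(f x - f (x - h)) / h - (G N (n_ N) - G N (n_ N - grid h N)%N) / ((grid h N)%:R / N%:R)| <= e / 2 by near: N.
move: s1 s2; set A := _ / _; set B := _ / (_ / _); set C := N%:R * _ => s1 s2.
have P : (f (x + h) - f x) / h >= derive1 f x - e / 2 by rewrite ler_pdivlMr//; lra.
have Q : (f x - f (x - h)) / h <= derive1 f x + e / 2 by rewrite ler_pdivrMr//; lra.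
move: P Q; set P := (_ / h); set Q := (_ / h); set D := derive1 f x.
move: A B C P Q D s1 s2 => A B C P Q D; clear; rewrite !ler_norml.
by move=> s1 s2 h1 h2 /andP[h3 h4] /andP[h5 h6]; apply/andP; split; lra.
Unshelve. all: by end_near.
Qed.

End grid_limits.

(** * Poisson weights and their Laplace transforms *)

Section lebesgue_on_the_line.
Context (R : realType).
Local Notation mu := (@lebesgue_measure R).
Local Open Scope ereal_scope.
Implicit Types (f h p : R -> \bar R).

(** Uniqueness of the measure giving half-open intervals their length, applied to the translated
    measure. *)
Lemma lebesgue_measureD (c : R) (A : set R) : measurable A ->
  pushforward mu ((fun x => c + x)%R : _ -> measurableTypeR R) A = mu A.
Proof.
move=> mA.
have mD : measurable_fun setT (fun x : R => (c + x)%R : measurableTypeR R).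
  by apply: measurable_funD => //; exact: measurable_cst.
pose mD_mixin := isMeasurableFun.Build _ _ _ _ _ mD.
pose D : {mfun _ >-> _} := HB.pack (fun x : R => (c + x)%R : measurableTypeR R) mD_mixin.
apply/esym/(@lebesgue_measure_unique _ (pushforward mu D)) => //= _ [[a b]] _ <-.
rewrite /pushforward/= (_ : _ @^-1` _ = `](a - c)%R, (b - c)%R]%classic).
  rewrite !lebesgue_measure_itv/= !lte_fin ltrD2r.
  by case: ifPn => // _; congr EFin; ring.
apply/seteqP; split => x /=; rewrite !in_itv/= => /andP[h1 h2]; apply/andP; split; lra.
Qed.

Lemma integral_translate f (c : R) : measurable_fun setT f -> (forall x, 0 <= f x) ->
  \int[mu]_x f (c + x)%R = \int[mu]_x f x.
Proof.
move=> mf f0.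
have mD : measurable_fun setT (fun x : R => (c + x)%R : measurableTypeR R).
  by apply: measurable_funD => //; exact: measurable_cst.
have := @ge0_integral_pushforward _ _ (measurableTypeR R) (measurableTypeR R) R _ mD mu setT f
  measurableT mf (fun y _ => f0 y).
rewrite preimage_setT => <-.
by apply: eq_measure_integral => //= A mA _; exact: lebesgue_measureD.
Qed.

Lemma measurable_translate2 p : measurable_fun setT p ->
  measurable_fun setT (fun z : R * R => p (z.1 + z.2)%R).
Proof. by move=> mp; apply: measurableT_comp => //; exact: measurable_funD. Qed.

Lemma measurable_shift_integral h p : measurable_fun setT h -> measurable_fun setT p ->
  (forall x, 0 <= h x) -> (forall x, 0 <= p x) ->
  measurable_fun setT (fun s : R => \int[mu]_t (h t * p (s + t)%R)).
Proof.
move=> mh mp h0 p0.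
apply: (@measurable_fun_fubini_tonelli_F _ _ _ _ _ mu
  (fun z : R * R => h z.2 * p (z.1 + z.2)%R)).
- apply: emeasurable_funM; first exact: measurableT_comp.
  exact: measurable_translate2.
- by move=> x; exact: mule_ge0.
Qed.

(** With [r = s + t], a smoothing of [p] by [h] is moved onto the weight [f], which becomes a
    convolution. All identities between kernels and transforms below are carried by this
    exchange. *)
Lemma tonelli_convolution f h p : measurable_fun setT f -> measurable_fun setT h ->
  measurable_fun setT p ->
  (forall x, 0 <= f x) -> (forall x, 0 <= h x) -> (forall x, 0 <= p x) ->
  \int[mu]_s (f s * \int[mu]_t (h t * p (s + t)%R)) =
  \int[mu]_r ((\int[mu]_s (f s * h (r - s)%R)) * p r).
Proof.
move=> mf mh mp f0 h0 p0.
have mB : measurable_fun setT (fun z : R * R => h (z.2 - z.1)%R).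
  by apply: measurableT_comp => //; exact: measurable_funB.
transitivity (\int[mu]_s \int[mu]_r (f s * h (r - s)%R * p r)).
  apply: eq_integral => s _; rewrite -[RHS](@integral_translate _ s).
  - rewrite -ge0_integralZl//.
    + by apply: eq_integral => t _; rewrite (_ : (s + t - s = t)%R) ?muleA//; ring.
    + apply: emeasurable_funM => //; apply: measurableT_comp => //.
      by apply: measurable_funD => //; exact: measurable_cst.
    + by move=> t _; exact: mule_ge0.
  - apply: emeasurable_funM => //; apply: emeasurable_funM => //.
    by apply: measurableT_comp => //; apply: measurable_funB => //; exact: measurable_cst.
  - by move=> x; rewrite !mule_ge0.
rewrite (@fubini_tonelli _ _ _ _ _ mu mu
  (fun z : R * R => f z.1 * h (z.2 - z.1)%R * p z.2)).
- apply: eq_integral => r _ /=; rewrite -ge0_integralZr//.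
  + apply: emeasurable_funM => //.
    by apply: measurableT_comp => //; apply: measurable_funB => //; exact: measurable_cst.
  + by move=> s _; exact: mule_ge0.
- apply: emeasurable_funM; last exact: measurableT_comp.
  by apply: emeasurable_funM => //; exact: measurableT_comp.
- by move=> x; rewrite !mule_ge0.
Qed.

Lemma integral_gt0 f : measurable_fun setT f -> (forall x, 0 <= f x) ->
  (forall x, (0 < x)%R -> 0 < f x) -> 0 < \int[mu]_x f x.
Proof.
move=> mf f0 fp; rewrite lt0e integral_ge0// andbT; apply/eqP => H.
have : \int[mu]_(x in setT) `|f x| = 0.
  by rewrite -H; apply: eq_integral => x _; rewrite gee0_abs.
move=> /(ae_eq_integral_abs mu measurableT mf).1 [N [mN N0 sN]].
have : mu `]0%R, 1%R] <= mu N.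
  apply: le_measure; rewrite ?inE//= => x/=; rewrite in_itv/= => /andP[x0 _].
  by apply: sN => /= /(_ I) fx0; have := fp _ x0; rewrite fx0 ltxx.
by rewrite N0 lebesgue_measure_itv/= lte_fin ltr01 oppr0 adde0 lee_fin ler10.
Qed.

Lemma integral_derive (F g : R -> R) (r : R) : (0 <= r)%R ->
  (forall x : R, is_derive x (1%R : R) F (g x)) -> continuous g ->
  \int[mu]_(s in `]0%R, r[) (g s)%:E = (F r - F 0)%:E.
Proof.
move=> r0 dF cg; have [->|rn0] := eqVneq r 0%R.
  by rewrite set_itvoo0 integral_set0 subrr.
have {rn0}r0 : (0 < r)%R by rewrite lt_def rn0.
have cF : continuous F.
  by move=> x; apply: differentiable_continuous; apply/derivable1_diffP; case: (dF x).
transitivity (\int[mu]_(s in `[0%R, r]) (g s)%:E).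
  have mg : measurable_fun `]0%R, r[ (fun s => (g s)%:E).
    by apply/measurable_EFinP/measurable_funTS; exact: continuous_measurable_fun.
  by rewrite [RHS]integral_itv_bndoo.
rewrite (continuous_FTC2 (F := F)) ?EFinB//.
- by apply: continuous_subspaceT.
- split; first by move=> x _; case: (dF x).
  + by apply: cvg_at_right_filter; exact: cF.
  + by apply: cvg_at_left_filter; exact: cF.
- by move=> x _; rewrite derive1E; case: (dF x).
Qed.

End lebesgue_on_the_line.

(** * Integration against a measure with a density *)

Section density.
Context (R : realType) (Pi : {measure set (measurableTypeR R) -> \bar R}) (pi : R -> R).
Hypothesis hpi : positive_density Pi pi.
Local Notation mu := (@lebesgue_measure R).
Local Open Scope ereal_scope.
Import HBNNSimple.

(** The density is extended by 0 so that translations and convolutions take place on the whole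
    line. *)
Lemma measurable_density : measurable_fun setT ((EFin \o pi) \_ `]0%R, +oo[).
Proof.
case: hpi => mpi _ _; apply/(measurable_restrictT _ _).1 => //.
exact/measurable_EFinP.
Qed.

Lemma density_ge0 x : 0 <= ((EFin \o pi) \_ `]0%R, +oo[) x.
Proof.
case: hpi => _ pi0 _; rewrite patchE; case: ifPn => //.
by rewrite inE/= in_itv/= andbT lee_fin => /pi0/ltW.
Qed.

(** The density formula for sets extends to simple functions by linearity and to nonnegative
    functions by monotone convergence. *)
Lemma integral_density (f : R -> \bar R) : measurable_fun setT f -> (forall x, 0 <= f x) ->
  \int[Pi]_(x in `]0%R, +oo[) f x = \int[mu]_x (f x * ((EFin \o pi) \_ `]0%R, +oo[) x).
Proof.
move=> mf f0; set p := _ \_ _.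
have mp : measurable_fun setT p := measurable_density.
have p0 x : 0 <= p x := density_ge0 x.
pose D : set R := `]0%R, +oo[%classic.
have mD : measurable D by exact: measurable_itv.
have mfD : measurable_fun D f by exact: measurable_funTS.
have PiE A : measurable A -> Pi (A `&` D) = \int[mu]_(x in A) p x.
  move=> mA; case: hpi => mpi pi0 ->; [|exact: measurableI|by move=> x []].
  rewrite [LHS]integral_mkcond [RHS]integral_mkcond; apply: eq_integral => x _.
  rewrite !patchE in_setI; rewrite /D; case: (x \in A) => //=.
pose g := @nnsfun_approx _ (measurableTypeR R) R D mD f mfD.
have sE (k : {nnsfun (measurableTypeR R) >-> R}) : \int[Pi]_(x in D) (k x)%:E = \int[mu]_(x in D) ((k x)%:E * p x).
  under eq_integral do rewrite fimfunE -fsumEFin//.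
  rewrite ge0_integral_fsum//; last 2 first.
  - by move=> r; apply/measurable_EFinP/measurable_funTS; exact: measurable_funM.
  - by move=> n x _; rewrite EFinM nnfun_muleindic_ge0.
  under [RHS]eq_integral.
    move=> x xD; rewrite fimfunE -fsumEFin// ge0_mule_fsuml; last first.
      by move=> r; rewrite EFinM nnfun_muleindic_ge0.
    over.
  rewrite [RHS]ge0_integral_fsum//; last 2 first.
  - move=> r; apply: emeasurable_funM; apply: measurable_funTS => //.
    by apply/measurable_EFinP; exact: measurable_funM.
  - by move=> r x _; rewrite EFinM mule_ge0// nnfun_muleindic_ge0.
  apply: eq_fsbigr => r _; rewrite integralZl_indic_nnsfun// integral_indic//.
  rewrite PiE; last exact: (measurable_funPTI k (measurable_set1 r)).
  under [RHS]eq_integral do rewrite EFinM -muleA.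
  have [->|r0] := eqVneq r 0%R.
    by rewrite mul0e integral0_eq// => x _; rewrite mul0e.
  have [k0|k0] := leP 0%R r; last first.
    rewrite (_ : k @^-1` [set r] = set0) ?integral_set0 ?mule0; last first.
      by rewrite preimage_nnfun0.
    by rewrite integral0_eq// => x _; rewrite indic0 mul0e mule0.
  rewrite ge0_integralZl//; last 2 first.
  - apply: emeasurable_funM; last exact: measurable_funTS.
    by apply/measurable_EFinP/measurable_funTS; exact: measurable_indic.
  - by move=> x _; rewrite mule_ge0.
  congr (_ * _); rewrite [LHS]integral_mkcond [RHS]integral_mkcond.
  apply: eq_integral => x _; rewrite !patchE indicE.
  have [xA|xA] := boolP (x \in k @^-1` [set r]); have [xD|xD] := boolP (x \in D) => //;
    rewrite ?mul1e ?mul0e//.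
  by rewrite /p patchE (negbTE xD).
transitivity (limn (fun n => \int[Pi]_(x in D) (g n x)%:E)).
  rewrite -monotone_convergence//.
  - apply: eq_integral => x /[!inE] xD; apply/esym/cvg_lim => //.
    by apply: cvg_nnsfun_approx => // *; exact: f0.
  - by move=> n; exact/measurable_EFinP/measurable_funP.
  - by move=> n x _; rewrite lee_fin.
  - by move=> x _ m n mn; rewrite lee_fin; exact/lefP/nd_nnsfun_approx.
under eq_fun do rewrite sE.
rewrite -monotone_convergence//; last 3 first.
- move=> n; apply: emeasurable_funM; last exact: measurable_funTS.
  exact/measurable_EFinP/measurable_funP.
- by move=> n x _; rewrite mule_ge0// lee_fin.
- move=> x _ m n mn; apply: lee_wpmul2r => //.
  by rewrite lee_fin; exact/lefP/nd_nnsfun_approx.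
rewrite [RHS](_ : _ = \int[mu]_(x in D) (f x * p x)).
  apply: eq_integral => x /[!inE] xD; apply/cvg_lim => //.
  apply: cvgeZr; last by apply: cvg_nnsfun_approx => // *; exact: f0.
  by rewrite /p patchE mem_set.
rewrite [RHS]integral_mkcond; apply: eq_integral => x _; rewrite patchE; case: ifPn => //.
by move=> xD; rewrite /p patchE (negbTE xD) mule0.
Qed.

End density.

(** * Power series with nonnegative coefficients *)

Section nonnegative_power_series.
Context (R : realType).
Implicit Types (a b : nat -> R) (z y : R).
Local Open Scope ereal_scope.

(** Extended-real values make rearrangements of nonnegative terms unconditional; finiteness is asked
    for separately. *)
Definition psum a z : \bar R := \sum_(n <oo) (a n * z ^+ n)%:E.

Lemma psum_term_ge0 a z : (forall n, 0 <= a n)%R -> (0 <= z)%R ->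
  forall n, 0 <= (a n * z ^+ n)%:E.
Proof. by move=> a0 z0 n; rewrite lee_fin mulr_ge0// exprn_ge0. Qed.

Lemma psum_ge0 a z : (forall n, 0 <= a n)%R -> (0 <= z)%R -> 0 <= psum a z.
Proof. by move=> a0 z0; apply: nneseries_ge0 => n _ _; exact: psum_term_ge0. Qed.

Lemma le_psum a z y : (forall k, 0 <= a k)%R -> (0 <= z)%R -> (z <= y)%R ->
  psum a z <= psum a y.
Proof.
move=> a0 z0 zy; apply: lee_nneseries => [k _ _|k _]; first exact: psum_term_ge0.
by rewrite lee_fin ler_wpM2l// lerXn2r// nnegrE// (le_trans z0).
Qed.

Lemma psum_recl a z : (forall k, 0 <= a k)%R -> (0 <= z)%R ->
  psum a z = (a 0%N)%:E + z%:E * psum (fun n => a n.+1) z.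
Proof.
move=> a0 z0; have T := psum_term_ge0 a0 z0.
rewrite {1}/psum nneseries_recl// expr0 mulr1 -nneseriesZl; last first.
  by move=> k _; exact: (psum_term_ge0 (fun k => a0 k.+1) z0).
congr (_ + _); rewrite -nneseries_addn//.
by apply: eq_eseriesr => k _; rewrite addn1 exprS -EFinM mulrCA.
Qed.

Lemma psum_recl_lty a z : (forall k, 0 <= a k)%R -> (0 < z)%R -> psum a z < +oo ->
  psum (fun n => a n.+1) z < +oo.
Proof.
move=> a0 z0; rewrite (psum_recl a0 (ltW z0)) => H.
rewrite ltey; apply/eqP => E; move: H; rewrite E gt0_muley ?lte_fin//.
Qed.

(** Letting [z] tend to 0 isolates the constant term: [M] is the shifted series at [z0 / 2], so
    [z <= e / (M + 1)] leaves a remainder of at most [e]. *)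
Let psum_head_le a b z0 : (forall n, 0 <= a n)%R -> (forall n, 0 <= b n)%R ->
  (0 < z0)%R ->
  (forall z, (0 < z < z0)%R -> psum a z = psum b z /\ psum a z < +oo) ->
  (a 0%N <= b 0%N)%R.
Proof.
move=> a0 b0 z00 H; apply/ler_addgt0Pr => e e0.
pose y := (z0 / 2)%R.
have y0 : (0 < y)%R by rewrite /y; lra.
have yz : (0 < y < z0)%R by rewrite y0/= /y; lra.
have [Ey fy] := H _ yz; rewrite Ey in fy.
have fS := psum_recl_lty b0 y0 fy.
have pS0 : 0 <= psum (fun n => b n.+1) y by apply: psum_ge0 => //; exact: ltW.
have pSE : psum (fun n => b n.+1) y \is a fin_num by rewrite ge0_fin_numE.
pose M := fine (psum (fun n => b n.+1) y).
have M0 : (0 <= M)%R by rewrite fine_ge0.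
have M1 : (0 < M + 1)%R by lra.
pose z := Num.min y (e / (M + 1))%R.
have z1 : (0 < z)%R by rewrite /z lt_min y0/= divr_gt0.
have zy : (z <= y)%R by rewrite /z ge_min lexx.
have ze : (z * M <= e)%R.
  have : (z <= e / (M + 1))%R by rewrite /z ge_min lexx orbT.
  rewrite ler_pdivlMr// => /(le_trans _); apply; rewrite ler_pM2l//; lra.
have [|Ez _] := H z; first by rewrite z1/=; move/andP: yz => [_]; exact: le_lt_trans.
rewrite -lee_fin; apply: (@le_trans _ _ (psum a z)).
  rewrite (psum_recl a0 (ltW z1)) leeDl// mule_ge0 ?lee_fin ?(ltW z1)//.
  by apply: psum_ge0 => //; exact: ltW.
rewrite Ez (psum_recl b0 (ltW z1)) EFinD leeD2l//.
apply: (@le_trans _ _ (z%:E * M%:E)); last by rewrite -EFinM lee_fin.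
apply: lee_wpmul2l; first by rewrite lee_fin ltW.
by rewrite fineK//; apply: le_psum => //; exact: ltW.
Qed.

(** Agreement to the right of 0 is all that transforms beyond [c] provide; constant terms are
    identified and stripped one at a time. *)
Lemma psum_unique a b z0 : (forall n, 0 <= a n)%R -> (forall n, 0 <= b n)%R ->
  (0 < z0)%R ->
  (forall z, (0 < z < z0)%R -> psum a z = psum b z /\ psum a z < +oo) ->
  forall n, a n = b n.
Proof.
move=> + + z00 + n; elim: n a b => [|n IH] a b a0 b0 H.
  apply/eqP; rewrite eq_le (psum_head_le a0 b0 z00 H) (psum_head_le b0 a0 z00)// => z zz.
  by have [<-] := H z zz.
apply: (IH (fun n => a n.+1) (fun n => b n.+1)) => // z zz.
have a00 : a 0%N = b 0%N.
  apply/eqP; rewrite eq_le (psum_head_le a0 b0 z00 H) (psum_head_le b0 a0 z00)// => y yy.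
  by have [<-] := H y yy.
have [z1 _] := andP zz.
have [E f] := H z zz; split; last exact: psum_recl_lty.
move: E; rewrite (psum_recl a0 (ltW z1)) (psum_recl b0 (ltW z1)) a00.
set A := psum _ _; set B := psum _ _ => AB.
have : (b 0%N)%:E + z%:E * A - (b 0%N)%:E = (b 0%N)%:E + z%:E * B - (b 0%N)%:E by rewrite AB.
rewrite ![(b 0%N)%:E + _]addeC !addeK// => E.
have zi C : (z^-1)%:E * (z%:E * C) = C by rewrite muleA -EFinM mulVf ?mul1e// gt_eqF.
by rewrite -[A]zi -[B]zi E.
Qed.

Lemma psum_cauchy a b z : (forall n, 0 <= a n)%R -> (forall n, 0 <= b n)%R -> (0 <= z)%R ->
  psum b z < +oo ->
  psum a z * psum b z = psum (fun n => \sum_(k < n.+1) a k * b (n - k)%N)%R z.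
Proof.
move=> a0 b0 z0 fb.
have Ta := psum_term_ge0 a0 z0; have Tb := psum_term_ge0 b0 z0.
have bfin : psum b z \is a fin_num by rewrite ge0_fin_numE// psum_ge0.
have -> : psum a z * psum b z = \sum_(k <oo) ((a k * z ^+ k)%:E * psum b z).
  rewrite -(fineK bfin) muleC -nneseriesZl; last by move=> k _; exact: Ta.
  by apply: eq_eseriesr => k _; rewrite muleC.
(* Padding with 0 for [n < k] makes the Cauchy product an interchange of two full series. *)
pose c k n : \bar R := if (k <= n)%N then (a k * b (n - k)%N * z ^+ n)%:E else 0.
have c0 k n : 0 <= c k n.
  by rewrite /c; case: ifP => // _; rewrite lee_fin !mulr_ge0// exprn_ge0.
have -> : \sum_(k <oo) ((a k * z ^+ k)%:E * psum b z) = \sum_(k <oo) \sum_(n <oo) c k n.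
  apply: eq_eseriesr => k _; rewrite (nneseries_split 0 k)//.
  rewrite add0n big_nat big1 ?add0e; last first.
    by move=> n /andP[_ nk]; rewrite /c leqNgt nk.
  rewrite -nneseries_addn// /psum -nneseriesZl; last by move=> n _; exact: Tb.
  apply: eq_eseriesr => n _; rewrite /c leq_addl addnK -EFinM exprD; congr EFin; ring.
rewrite nneseries_interchange//; apply: eq_eseriesr => n _.
rewrite (nneseries_split 0 n.+1)// add0n [X in _ + X]eseries0 ?adde0; last first.
  by move=> k nk _; rewrite /c leqNgt nk.
rewrite big_mkord mulr_suml -sumEFin; apply: eq_bigr => k _.
by rewrite /c -ltnS ltn_ord.
Qed.

End nonnegative_power_series.

(** * Poisson weights and their generating function *)

Section poissonization.
Context (R : realType).
Local Notation mu := (@lebesgue_measure R).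
Implicit Types (l x z : R) (n : nat) (f : R -> \bar R).

(** In [n], the Poisson probability with mean [l * x]; in [x], [1 / l] times the Gamma density of
    shape [n + 1] and rate [l]. *)
Definition gamma_kernel l n x : R := expR (- (l * x)) * (l * x) ^+ n / n`!%:R.

(** At [l = 0] this is the indicator of the positive half-line, so tails are treated as the case of
    rate 0. *)
Definition exp_pos l x : R := if 0 < x then expR (- (l * x)) else 0.

Definition pois l n x : R := if 0 < x then gamma_kernel l n x else 0.

Lemma pois0 l x : pois l 0 x = exp_pos l x.
Proof. by rewrite /pois /exp_pos /gamma_kernel expr0 fact0 mulr1 divr1. Qed.

Lemma pois_ge0 l n x : 0 <= l -> 0 <= pois l n x.
Proof.
move=> l0; rewrite /pois; case: ifP => // x0.
by rewrite /gamma_kernel !mulr_ge0 ?expR_ge0 ?invr_ge0// exprn_ge0// mulr_ge0// ltW.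
Qed.

Lemma pois_gt0 l n x : 0 < l -> 0 < x -> 0 < pois l n x.
Proof.
move=> l0 x0; rewrite /pois x0 /gamma_kernel !mulr_gt0 ?expR_gt0 ?invr_gt0 ?ltr0n ?fact_gt0//.
by rewrite exprn_gt0// mulr_gt0.
Qed.

Lemma exp_pos_ge0 l x : 0 <= exp_pos l x.
Proof. by rewrite /exp_pos; case: ifP => // _; exact: expR_ge0. Qed.

Lemma measurable_gamma_kernel l n : measurable_fun setT (gamma_kernel l n).
Proof.
apply: measurable_funM; last exact: measurable_cst.
have ml : measurable_fun setT (fun x : R => l * x) by exact: mulrl_measurable.
apply: measurable_funM; last exact: measurable_funX.
apply: measurableT_comp => //; exact: measurableT_comp.
Qed.

Lemma measurable_pois l n : measurable_fun setT (pois l n).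
Proof.
apply: measurable_fun_ifT; [|exact: measurable_gamma_kernel|exact: measurable_cst].
by apply: measurable_fun_ltr; [exact: measurable_cst|exact: measurable_id].
Qed.

Lemma measurable_exp_pos l : measurable_fun setT (exp_pos l).
Proof.
have -> : exp_pos l = pois l 0 by apply/funext => x; rewrite pois0.
exact: measurable_pois.
Qed.

(** The generating function of the Poisson law: [expR (z * (l * x))] is expanded in powers of
    [z]. *)
Lemma exp_pos_pois_series l z x : 0 <= l -> 0 <= z ->
  (exp_pos (l * (1 - z)) x)%:E = (\sum_(n <oo) (z ^+ n * pois l n x)%:E)%E.
Proof.
move=> l0 z0; rewrite /exp_pos /pois; have [x0|x0] := ltP 0 x; last first.
  by rewrite eseries0// => n _ _; rewrite mulr0.
have y0 : 0 <= z * (l * x) by rewrite !mulr_ge0// ltW.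
have C : (\sum_(0 <= k < n) exp_coeff (z * (l * x)) k)%R @[n --> \oo] --> expR (z * (l * x)).
  exact: is_cvg_series_exp_coeff.
have -> : expR (- (l * (1 - z) * x)) = expR (- (l * x)) * expR (z * (l * x)).
  by rewrite -expRD; congr expR; ring.
have G : ((\sum_(0 <= k < n) z ^+ k * gamma_kernel l k x)%:E @[n --> \oo] -->
    (expR (- (l * x)) * expR (z * (l * x)))%:E)%E.
  apply: cvg_EFin; first exact: nearW.
  rewrite (_ : fine \o _ = fun n => expR (- (l * x)) *
      \sum_(0 <= k < n) exp_coeff (z * (l * x)) k).
    by apply: cvgM => //; exact: cvg_cst.
  apply/funext => n /=; rewrite big_distrr/=; apply: eq_bigr => k _.
  by rewrite /gamma_kernel /exp_coeff/= [(z * (l * x)) ^+ k]exprMn; ring.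
by rewrite -(cvg_lim _ G)//; apply: congr_lim; apply/funext => n; rewrite sumEFin.
Qed.

Lemma laplace_pois l z f : 0 <= l -> 0 <= z -> measurable_fun setT f ->
  (forall x, (0 <= f x)%E) ->
  (\int[mu]_x ((exp_pos (l * (1 - z)) x)%:E * f x) =
   \sum_(n <oo) ((z ^+ n)%:E * \int[mu]_x ((pois l n x)%:E * f x)))%E.
Proof.
move=> l0 z0 mf f0.
have mp n : measurable_fun setT (fun x => ((pois l n x)%:E * f x)%E).
  by apply: emeasurable_funM => //; apply/measurable_EFinP; exact: measurable_pois.
have p0 n x : (0 <= (pois l n x)%:E * f x)%E by rewrite mule_ge0// lee_fin pois_ge0.
transitivity (\int[mu]_x (\sum_(n <oo) ((z ^+ n)%:E * ((pois l n x)%:E * f x))))%E.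
  apply: eq_integral => x _; rewrite exp_pos_pois_series//.
  have nn n : (0 <= (z ^+ n * pois l n x)%:E)%E by rewrite lee_fin mulr_ge0 ?exprn_ge0 ?pois_ge0.
  have [fx|] := boolP (f x \is a fin_num).
    rewrite -(fineK fx) muleC -nneseriesZl//.
    by apply: eq_eseriesr => n _; rewrite -!EFinM; congr EFin; ring.
  (* Where [f x] is infinite, both sides are 0 if every weight vanishes and infinite as soon as one
     is positive. *)
  rewrite ge0_fin_numE// -leNgt leye_eq => /eqP fx.
  rewrite fx.
  have [E|E] := eqVneq (\sum_(n <oo) (z ^+ n * pois l n x)%:E)%E 0%E.
    rewrite E mul0e eseries0// => n _ _.
    have : (z ^+ n * pois l n x = 0)%R.
      apply/eqP; rewrite eq_le mulr_ge0 ?exprn_ge0 ?pois_ge0// andbT.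
      suff : ((z ^+ n * pois l n x)%:E <= 0)%E by rewrite lee_fin.
      rewrite -E (@nneseriesD1 _ _ n)//= leeDl//.
      by apply: nneseries_ge0 => k _ _.
    by rewrite muleA -EFinM => ->; rewrite mul0e.
  rewrite gt0_muley; last by rewrite lt0e E/= nneseries_ge0.
  apply/esym/eqP; rewrite -leye_eq.
  have [n pn] : exists n, (0 < z ^+ n * pois l n x)%R.
    apply: contrapT => /forallNP H; move/eqP: E; apply.
    rewrite eseries0// => n _ _; congr EFin; apply/eqP; rewrite eq_le mulr_ge0 ?exprn_ge0 ?pois_ge0// andbT.
    by rewrite leNgt; apply/negP; exact: H.
  apply: (@le_trans _ _ ((z ^+ n)%:E * ((pois l n x)%:E * +oo))%E).
    by rewrite muleA -EFinM gt0_muley// lte_fin.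
  rewrite (@nneseriesD1 _ _ n)//=; last first.
    by move=> k _; rewrite muleA -EFinM mule_ge0.
  by rewrite leeDl//; apply: nneseries_ge0 => k _ _; rewrite muleA -EFinM mule_ge0.
rewrite integral_nneseries//; last 2 first.
- by move=> n; apply: emeasurable_funM; [exact: measurable_cst|exact: mp].
- by move=> n x _; rewrite mule_ge0// lee_fin exprn_ge0.
by apply: eq_eseriesr => n _; apply: ge0_integralZl => //; [exact: mp|rewrite lee_fin exprn_ge0].
Qed.

End poissonization.

(** * Convolutions of exponential and Gamma kernels *)

Section kernel_convolutions.
Context (R : realType).
Local Notation mu := (@lebesgue_measure R).
Implicit Types (l x y r th : R) (n : nat).

Lemma integral_pos_convolution (f h : R -> R) r :
  (\int[mu]_s ((if 0 < s then f s else 0)%:E * (if 0 < r - s then h (r - s) else 0)%:E) =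
   \int[mu]_(s in `]0%R, r[) (f s * h (r - s))%:E)%E.
Proof.
rewrite [RHS]integral_mkcond; apply: eq_integral => s _; rewrite patchE.
rewrite mem_setE in_itv/= subr_gt0; case: ifPn => s0; last by rewrite mul0e.
by case: ifPn => sr; rewrite ?mule0// EFinM.
Qed.

Lemma integral_pos_convolution_derive (f h F : R -> R) r :
  (forall s : R, is_derive s (1 : R) F (f s * h (r - s))) ->
  continuous (fun s => f s * h (r - s)) ->
  (\int[mu]_s ((if 0 < s then f s else 0)%:E * (if 0 < r - s then h (r - s) else 0)%:E) =
   (if 0 < r then F r - F 0 else 0)%:E)%E.
Proof.
move=> dF cF; rewrite integral_pos_convolution; case: ifPn => r0.
  by rewrite (integral_derive (ltW r0) dF).
by rewrite set_itv_ge ?integral_set0// -leNgt bnd_simp leNgt.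
Qed.

Lemma is_derive_expM (c x : R) : is_derive x (1 : R) (fun s => expR (c * s)) (c * expR (c * x)).
Proof.
have H : is_derive x (1 : R) (fun s : R => c * s) c.
  apply: (is_derive_eq (is_deriveM (is_derive_cst c x 1) (is_derive_id x 1))).
  by rewrite !scaler0 addr0 /GRing.scale/= mulr1.
apply: (is_derive_eq (@is_derive1_comp R expR (fun s => c * s) x _ _ _ H)).
by rewrite mulrC.
Qed.

Lemma continuous_expM (c : R) : continuous (fun s => expR (c * s)).
Proof.
move=> x; apply: differentiable_continuous; apply/derivable1_diffP.
by case: (is_derive_expM c x).
Qed.

Lemma measurable_expM (c : R) : measurable_fun setT (fun s : R => expR (c * s)).
Proof. by apply: measurableT_comp => //; exact: mulrl_measurable. Qed.

Lemma is_derive_monomial (c x : R) n :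
  is_derive x (1 : R) (fun s => c * s ^+ n.+1 / n.+1`!%:R) (c * x ^+ n / n`!%:R).
Proof.
have -> : (fun s : R => c * s ^+ n.+1 / n.+1`!%:R) = (c / n.+1`!%:R) \*: (id ^+ n.+1 : R -> R).
  by apply/funext => s; rewrite mulrAC exprfctE.
apply: (is_derive_eq (is_deriveZ _ (is_deriveX n.+1 (is_derive_id x 1)))).
rewrite /GRing.scale/= mulr1 factS natrM.
have n0 : n.+1%:R != 0 :> R by rewrite pnatr_eq0.
have f0 : n`!%:R != 0 :> R by rewrite pnatr_eq0 -lt0n fact_gt0.
by move: (n.+1%:R) (n`!%:R) n0 f0 => a b n0 f0; field; rewrite n0 f0.
Qed.

(** Adding an exponential variable raises the Gamma shape by one: the exponentials combine to a
    factor free of [s], leaving a monomial to integrate. *)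
Lemma pois_convolution l n r : l != 0 ->
  (\int[mu]_s ((pois l n s)%:E * (exp_pos l (r - s))%:E) = (l^-1 * pois l n.+1 r)%:E)%E.
Proof.
move=> l0.
pose h x := expR (- (l * x)); pose F s := expR (- (l * r)) * l ^+ n * s ^+ n.+1 / n.+1`!%:R.
have E s : gamma_kernel l n s * h (r - s) =
    (expR (- (l * r)) * l ^+ n) * s ^+ n / n`!%:R.
  rewrite /h /gamma_kernel (_ : - (l * (r - s)) = - (l * r) + l * s); last by ring.
  rewrite expRD exprMn -[RHS]mul1r -(expRxMexpNx_1 (l * s)).
  ring.
have dF s : is_derive s (1 : R) F (gamma_kernel l n s * h (r - s)).
  by rewrite E; exact: is_derive_monomial.
have cF : continuous (fun s => gamma_kernel l n s * h (r - s)).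
  under eq_fun do rewrite E.
  move=> s; apply: cvgM; last exact: cvg_cst.
  by apply: cvgM; [exact: cvg_cst|exact: exprn_continuous].
rewrite [LHS](integral_pos_convolution_derive dF cF) /pois; congr EFin.
case: ifP => _; last by rewrite mulr0.
rewrite /F expr0n/= mulr0 mul0r subr0 /gamma_kernel exprMn.
by rewrite -[LHS](mulKf l0); congr (_ * _); rewrite [l ^+ n.+1]exprS; ring.
Qed.

Lemma integral_exp_pos l : 0 < l -> (\int[mu]_x (exp_pos l x)%:E = (l^-1)%:E)%E.
Proof.
move=> l0.
have -> : (\int[mu]_x (exp_pos l x)%:E = \int[mu]_(x in `]0%R, +oo[) (expR (- l * x))%:E)%E.
  rewrite [RHS]integral_mkcond; apply: eq_integral => x _.
  rewrite patchE /exp_pos; case: ifPn => [x0|x0].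
    by rewrite ifT ?mulNr// inE/= in_itv/= x0.
  by rewrite ifF//; apply/negbTE; rewrite notin_setE/= in_itv/= andbT; exact/negP.
rewrite integral_itv_obnd_cbnd; last first.
  by apply/measurable_EFinP/measurable_funTS; exact: (measurable_expM (- l)).
have E : (\int[mu]_(x in `[0%R, +oo[) (l * expR (- l * x))%:E = 1)%E.
  rewrite -(integral_exponential_pdf l0) integral_mkcond; apply: eq_integral => x _.
  by rewrite /exponential_pdf !patchE; case: ifP.
transitivity ((l^-1)%:E * \int[mu]_(x in `[0%R, +oo[) (l * expR (- l * x))%:E)%E.
  rewrite -ge0_integralZl//.
  - by apply: eq_integral => x _; rewrite -EFinM mulrA mulVf ?mul1r// gt_eqF.
  - apply/measurable_EFinP/measurable_funTS; apply: measurable_funM => //.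
    exact: measurable_expM.
  - by move=> x _; rewrite lee_fin mulr_ge0 ?expR_ge0// ltW.
  - by rewrite lee_fin invr_ge0 ltW.
by rewrite E mule1.
Qed.

Lemma integral_pois l n : 0 < l -> (\int[mu]_x (pois l n x)%:E = (l^-1)%:E)%E.
Proof.
move=> l0; have le0 := ltW l0; have ln0 : l != 0 by rewrite gt_eqF.
elim: n => [|n IH].
  by rewrite -(integral_exp_pos l0); apply: eq_integral => x _; rewrite pois0.
have mp k : measurable_fun setT (fun x : R => (pois l k x)%:E).
  by apply/measurable_EFinP; exact: measurable_pois.
have me : measurable_fun setT (fun x : R => (exp_pos l x)%:E).
  by apply/measurable_EFinP; exact: measurable_exp_pos.
have pn k x : (0 <= (pois l k x)%:E)%E by rewrite lee_fin pois_ge0.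
have en x : (0 <= (exp_pos l x)%:E)%E by rewrite lee_fin exp_pos_ge0.
have li : (0 <= (l^-1)%:E)%E by rewrite lee_fin invr_ge0.
have T := @tonelli_convolution R _ _ (fun=> 1%E) (mp n) me (measurable_cst _)
  (pn n) en (fun=> lee01).
have E1 : (\int[mu]_s ((pois l n s)%:E * \int[mu]_t ((exp_pos l t)%:E * 1)) = (l^-1)%:E * (l^-1)%:E)%E.
  transitivity (\int[mu]_s ((l^-1)%:E * (pois l n s)%:E))%E.
    apply: eq_integral => s _; rewrite muleC; congr (_ * _)%E.
    by rewrite -(integral_exp_pos l0); apply: eq_integral => t _; rewrite mule1.
  by rewrite ge0_integralZl; [rewrite IH| |exact: mp|by move=> x _|].
have E2 : (\int[mu]_r ((\int[mu]_s ((pois l n s)%:E * (exp_pos l (r - s))%:E)) * 1) =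
    (l^-1)%:E * \int[mu]_r (pois l n.+1 r)%:E)%E.
  rewrite -ge0_integralZl; [|by []|exact: mp|by move=> x _|by []].
  by apply: eq_integral => r _; rewrite mule1 pois_convolution.
have lK (A : \bar R) : (l%:E * ((l^-1)%:E * A) = A)%E by rewrite muleA -EFinM mulfV// mul1e.
by rewrite -[LHS]lK -E2 -T E1 lK.
Qed.

Lemma exp_pos_convolution (a c r : R) : a != c ->
  (\int[mu]_s ((exp_pos a s)%:E * (exp_pos c (r - s))%:E) =
   (if 0 < r then (expR (- (c * r)) - expR (- (a * r))) / (a - c) else 0)%:E)%E.
Proof.
move=> ac; have ac0 : a - c != 0 by rewrite subr_eq0.
pose f s := expR (- (a * s)); pose h s := expR (- (c * s)).
pose F s := expR (- (c * r)) * (- (a - c)^-1 * expR (- (a - c) * s)).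
have E s : f s * h (r - s) = expR (- (c * r)) * expR (- (a - c) * s).
  by rewrite /f /h -!expRD; congr expR; ring.
have dF s : is_derive s (1 : R) F (f s * h (r - s)).
  rewrite E /F.
  apply: (is_derive_eq (is_deriveZ (expR (- (c * r))) (is_deriveZ (- (a - c)^-1) (is_derive_expM (- (a - c)) s)))).
  by rewrite /GRing.scale/=; field.
have cF : continuous (fun s => f s * h (r - s)).
  under eq_fun do rewrite E.
  by move=> s; apply: cvgM; [exact: cvg_cst|exact: continuous_expM].
rewrite [LHS](integral_pos_convolution_derive dF cF); congr EFin; case: ifP => // _.
rewrite /F mulr0 expR0 (_ : - (a - c) * r = - (a * r) + c * r); last by ring.
rewrite expRD.
have := expRxMexpNx_1 (c * r); move: (expR (c * r)) (expR (- (c * r))) (expR (- (a * r))) => u v w uv.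
transitivity ((- (v * u * w) + v) / (a - c)); first by field.
by rewrite (mulrC v) uv; field.
Qed.

(** The convolution of [exp_pos a], [exp_pos c] and the indicator of the positive half-line. The
    first-order terms at 0 cancel, so it behaves like [r ^+ 2 / 2] there, as integrability against a
    Levy measure demands. *)
Definition convex_kernel (a c r : R) : R :=
  if 0 < r then ((1 - expR (- (c * r))) / c - (1 - expR (- (a * r))) / a) / (a - c) else 0.

Lemma exp_pos_convolution2 (a c y : R) : a != c -> a != 0 -> c != 0 ->
  (\int[mu]_r ((if (0 < r)%R then ((expR (- (c * r)) - expR (- (a * r))) / (a - c))%R else 0%R)%:E *
     (exp_pos 0 (y - r))%:E) = (convex_kernel a c y)%:E)%E.
Proof.
move=> ac a0 c0; have ac0 : a - c != 0 by rewrite subr_eq0.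
pose f r := (expR (- (c * r)) - expR (- (a * r))) / (a - c).
pose h (s : R) := expR (- (0 * s)).
pose F r := (- c^-1 * expR (- c * r) + a^-1 * expR (- a * r)) / (a - c).
have E s : f s * h (y - s) = f s by rewrite /h mul0r oppr0 expR0 mulr1.
have dF s : is_derive s (1 : R) F (f s * h (y - s)).
  rewrite E (_ : F = (a - c)^-1 \*: ((- c^-1 \*: (fun r : R => expR (- c * r))) + (a^-1 \*: (fun r : R => expR (- a * r))))); last first.
    by apply/funext => r; rewrite !fctE /F/= mulrC.
  apply: (is_derive_eq (is_deriveZ _ (is_deriveD (is_deriveZ _ (is_derive_expM (- c) s)) (is_deriveZ _ (is_derive_expM (- a) s))))).
  by rewrite /f /GRing.scale/= !mulNr; field; rewrite ac0 a0 c0.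
have cF : continuous (fun s => f s * h (y - s)).
  under eq_fun do rewrite E.
  have ce b : continuous (fun r : R => expR (- (b * r))).
    by rewrite (_ : (fun r => _) = fun r => expR (- b * r)); [exact: continuous_expM|apply/funext => r; rewrite mulNr].
  move=> s; apply: cvgM; last exact: cvg_cst.
  by apply: cvgB; exact: ce.
rewrite [LHS](integral_pos_convolution_derive dF cF); congr EFin; rewrite /convex_kernel; case: ifP => // _.
by rewrite /F !mulr0 expR0 !mulNr; field; rewrite ac0 a0 c0.
Qed.

End kernel_convolutions.

(** * The Post-Widder inversion formula *)

Section pois_cdf.
Context (R : realType).
Local Notation mu := (@lebesgue_measure R).
Implicit Types (l x y s : R) (n : nat).

(** [1 / l] times the Gamma distribution function of shape [n + 1], that is, times the probability
    that a Poisson variable of mean [l * y] exceeds [n]. *)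
Definition pois_cdf l n y : R :=
  if 0 < y then (1 - \sum_(i < n.+1) gamma_kernel l i y) / l else 0.

Lemma pois_cdfS l n y : l != 0 -> pois_cdf l n y = pois_cdf l n.+1 y + l^-1 * pois l n.+1 y.
Proof.
move=> l0; rewrite /pois_cdf /pois; case: ifP => _; last by rewrite mulr0 addr0.
by rewrite [in RHS]big_ord_recr/=; field.
Qed.

Lemma is_derive_gamma_kernel l n s :
  is_derive s (1 : R) (gamma_kernel l n.+1) (l * (gamma_kernel l n s - gamma_kernel l n.+1 s)).
Proof.
have -> : gamma_kernel l n.+1 =
   (fun s => expR (- l * s)) * (fun s => l ^+ n.+1 * s ^+ n.+1 / n.+1`!%:R).
  by apply/funext => t; rewrite /gamma_kernel exprMn -(mulNr l t) -mulrA.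
apply: (is_derive_eq (is_deriveM (is_derive_expM (- l) s) (is_derive_monomial (l ^+ n.+1) s n))).
by rewrite /GRing.scale/= /gamma_kernel !exprMn -(mulNr l s) [l ^+ n.+1]exprS !fctE; ring.
Qed.

(** The derivatives of the summands telescope to the last kernel. *)
Lemma is_derive_pois_cdf l n s : l != 0 ->
  is_derive s (1 : R) (fun s => - (\sum_(i < n.+1) gamma_kernel l i s) / l) (gamma_kernel l n s).
Proof.
move=> l0; elim: n => [|n IH].
  rewrite (_ : (fun s => _) = - l^-1 \*: (fun s : R => expR (- l * s))); last first.
    apply/funext => t; rewrite big_ord1 /gamma_kernel expr0 fact0 divr1 mulr1 -(mulNr l t).
    by transitivity (- l^-1 * expR (- l * t) : R); [ring|].
  apply: (is_derive_eq (is_deriveZ (- l^-1) (is_derive_expM (- l) s))).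
  by rewrite /gamma_kernel /GRing.scale/= expr0 fact0 -(mulNr l s); field.
rewrite (_ : (fun s => _) = (fun s => - (\sum_(i < n.+1) gamma_kernel l i s) / l) +
   (- l^-1 \*: gamma_kernel l n.+1)); last first.
  by apply/funext => t; rewrite !fctE/= big_ord_recr/= /GRing.scale/=; ring.
apply: (is_derive_eq (is_deriveD IH (is_deriveZ (- l^-1) (is_derive_gamma_kernel l n s)))).
by rewrite /GRing.scale/=; field.
Qed.

Lemma pois_cdf_convolution l n y : l != 0 ->
  (\int[mu]_s ((pois l n s)%:E * (exp_pos 0 (y - s))%:E) = (pois_cdf l n y)%:E)%E.
Proof.
move=> l0; pose h (s : R) := expR (- (0 * s)).
have E s : gamma_kernel l n s * h (y - s) = gamma_kernel l n s.
  by rewrite /h mul0r oppr0 expR0 mulr1.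
have dF s : is_derive s (1 : R) (fun s => - (\sum_(i < n.+1) gamma_kernel l i s) / l)
    (gamma_kernel l n s * h (y - s)).
  by rewrite E; exact: is_derive_pois_cdf.
have cF : continuous (fun s => gamma_kernel l n s * h (y - s)).
  pose G (t : R) := expR (- l * t) * (l ^+ n * t ^+ n / n`!%:R).
  have -> : (fun s => gamma_kernel l n s * h (y - s)) = G.
    by apply/funext => t; rewrite E /G /gamma_kernel exprMn -(mulNr l t) -mulrA.
  move=> s; apply: cvgM; first exact: continuous_expM.
  apply: cvgM; last exact: cvg_cst.
  by apply: cvgM; [exact: cvg_cst|exact: exprn_continuous].
rewrite [LHS](integral_pos_convolution_derive dF cF) /pois_cdf; congr EFin; case: ifP => // _.
have -> : \sum_(i < n.+1) gamma_kernel l i 0 = 1 :> R.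
  rewrite big_ord_recl/= /gamma_kernel mulr0 oppr0 expR0 expr0 fact0 divr1 mulr1.
  by rewrite big1 ?addr0// => i _; rewrite expr0n/= mulr0 mul0r.
by field.
Qed.

End pois_cdf.

(** * Concentration of the Gamma kernels and inversion *)

Section post_widder.
Context (R : realType).
Local Notation mu := (@lebesgue_measure R).
Implicit Types (x y th t s e : R) (F u v : R -> R) (n : nat).

(** [t * expR (1 - t)] peaks at 1. The sign condition says, for both sides at once, that [t] lies
    beyond [s] as seen from 1. *)
Lemma le_mul_expR_away s t : 0 < s -> 0 < t -> (t - s) * (s^-1 - 1) <= 0 ->
  t * expR (1 - t) <= s * expR (1 - s).
Proof.
move=> s0 t0 h.
have h1 : t <= s * expR (t / s - 1).
  rewrite -ler_pdivrMl// mulrC; have := expR_ge1Dx (t / s - 1).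
  by rewrite addrCA subrr addr0.
apply: (@le_trans _ _ (s * expR (t / s - 1) * expR (1 - t))).
  by rewrite ler_wpM2r// expR_ge0.
rewrite -mulrA -expRD ler_pM2l// ler_expR.
have : (t - s) * (s^-1 - 1) = t / s - t - (s / s - s) by ring.
by rewrite divff ?gt_eqF//; lra.
Qed.

Lemma mul_expR_lt1 s : s != 1 -> s * expR (1 - s) < 1.
Proof.
move=> s1; rewrite -[ltRHS](mulVf (_ : expR (s - 1) != 0)) ?gt_eqF ?expR_gt0//.
rewrite -expRN opprB mulrC ltr_pM2l ?expR_gt0//.
by have := @expR_gt1Dx R (s - 1); rewrite subr_eq0 s1 addrCA subrr addr0; apply.
Qed.

(** With [t = M * y / n] the kernel is [(t * expR (- t)) ^+ n] times [n ^+ n / n!], and the last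
    factor is at most [expR n], of whose series it is a term. *)
Lemma gamma_kernel_le M n y s : 0 < M -> (0 < n)%N -> 0 < y -> 0 < s ->
  (M * y / n%:R - s) * (s^-1 - 1) <= 0 ->
  gamma_kernel M n y <= (s * expR (1 - s)) ^+ n.
Proof.
move=> M0 n0 y0 s0 h.
have n0' : 0 < n%:R :> R by rewrite ltr0n.
have t0 : 0 < M * y / n%:R by rewrite divr_gt0// mulr_gt0.
apply: (@le_trans _ _ ((M * y / n%:R * expR (1 - M * y / n%:R)) ^+ n)); last first.
  apply: lerXn2r; last exact: le_mul_expR_away.
  - by rewrite nnegrE mulr_ge0 ?expR_ge0// ltW.
  - by rewrite nnegrE mulr_ge0 ?expR_ge0// ltW.
have fn : n%:R ^+ n / n`!%:R <= expR n%:R :> R.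
  case: n n0 n0' {h t0} => // n _ n0'.
  by have := @expR_ge1Dxn R n.+1%:R n (ltW n0'); apply: le_trans; rewrite lerDr.
have w0 : 0 < M * y by rewrite mulr_gt0.
rewrite /gamma_kernel; move: (M * y) w0 => w w0.
rewrite exprMn expr_div_n -expRM_natl mulrBr mulr1 expRD.
rewrite (_ : n%:R * (w / n%:R) = w); last by field; rewrite gt_eqF.
have nn0 : 0 < n%:R ^+ n :> R by rewrite exprn_gt0.
have f1 : n`!%:R^-1 <= expR n%:R / n%:R ^+ n :> R by rewrite ler_pdivlMr// mulrC.
apply: (@le_trans _ _ (expR (- w) * w ^+ n * (expR n%:R / n%:R ^+ n))).
  by rewrite ler_pM2l// mulr_gt0 ?expR_gt0// exprn_gt0.
by rewrite le_eqVlt; apply/orP; left; apply/eqP; ring.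
Qed.

(** [F] is only known to have a finite transform at [th], so a factor [expR (- (th * y))] has to be
    split off; the price is a kernel of rate [N - th]. *)
Lemma gamma_kernel_tilt N th n y : 0 < N - th -> 0 < N ->
  gamma_kernel N n y = expR (- (th * y)) * ((N / (N - th)) ^+ n * gamma_kernel (N - th) n y).
Proof.
move=> M0 N0; rewrite /gamma_kernel.
have -> : - (N * y) = - (th * y) + - ((N - th) * y) by ring.
rewrite expRD exprMn [((N - th) * y) ^+ n]exprMn expr_div_n.
have : (N - th) ^+ n != 0 by rewrite expf_neq0// gt_eqF.
move: ((N - th) ^+ n) => a a0; field; rewrite a0.
by rewrite pnatr_eq0 -lt0n fact_gt0.
Qed.

(** As [(L - th) * x / n] is within [eta / 2] of 1, a relative distance of [2 * eta] from [x] puts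
    [(L - th) * y / n] beyond [1 + eta] or [1 - eta]. There [gamma_kernel_le] applies, and [r']
    absorbs the tilting factor. *)
Lemma gamma_kernel_away L th x eta r r' n y (s1 := 1 + eta) (s2 := 1 - eta) :
  0 < L -> 0 < L - th -> 0 < x -> 0 < eta -> eta <= 1 / 2 ->
  `|1 - (L - th) * x / n%:R| <= eta / 2 ->
  s1 * expR (1 - s1) <= r -> s2 * expR (1 - s2) <= r -> L / (L - th) * r <= r' ->
  2 * eta * x <= `|y - x| -> (0 < n)%N -> 0 < y ->
  gamma_kernel L n y <= r' ^+ n * expR (- (th * y)).
Proof.
move=> L0 M0 x0 eta0 eta1 r2 rs1 rs2 rrL yd n0' y0.
have n0 : 0 < n%:R :> R by rewrite ltr0n.
have s10 : 0 < s1 by rewrite /s1; lra.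
have s20 : 0 < s2 by rewrite /s2; lra.
have r0 : 0 <= r by apply: le_trans rs1; rewrite mulr_ge0 ?expR_ge0// ltW.
have LM0 : 0 < L / (L - th) by rewrite divr_gt0.
have r'0 : 0 <= r' by apply: le_trans rrL; rewrite mulr_ge0// ltW.
rewrite (gamma_kernel_tilt n y M0 L0) mulrC ler_pM2r ?expR_gt0//.
apply: (@le_trans _ _ ((L / (L - th)) ^+ n * r ^+ n)); last first.
  by rewrite -exprMn lerXn2r// nnegrE// mulr_ge0// ltW.
rewrite ler_pM2l ?exprn_gt0//.
have tE : (L - th) * y / n%:R = (L - th) * x / n%:R * (y / x).
  by field; rewrite !gt_eqF.
move: ((L - th) * x / n%:R) tE r2 => c tE; rewrite ler_norml => /andP[c1 c2].
have ee := mulr_ge0 (ltW eta0) (ltW eta0).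
have [xy|yx] := leP x y.
  have yxd : x + 2 * eta * x <= y by move: yd; rewrite ger0_norm ?subr_ge0//; clear -xy; lra.
  apply: (@le_trans _ _ ((s1 * expR (1 - s1)) ^+ n)); last first.
    by apply: lerXn2r; rewrite ?nnegrE// mulr_ge0 ?expR_ge0// ltW.
  apply: gamma_kernel_le => //; rewrite tE.
  apply: mulr_ge0_le0; last by rewrite subr_le0 invf_le1// /s1 lerDl ltW.
  rewrite subr_ge0 /s1.
  have yx1 : 1 + 2 * eta <= y / x by rewrite ler_pdivlMr// mulrDl mul1r.
  (* The product exceeds [1 + eta] exactly by [eta * (1 / 2 - eta)], hence the bound
     [eta <= 1 / 2]. *)
  apply: (@le_trans _ _ ((1 - eta / 2) * (1 + 2 * eta))).
    by have := mulr_ge0 (ltW eta0) (ltac:(clear -eta1; lra) : 0 <= 1/2 - eta); clear; lra.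
  apply: ler_pM => //; [clear -eta1; lra|clear -eta0; lra|].
  by clear -c2; lra.
have yxd : y <= x - 2 * eta * x by move: yd; rewrite ltr0_norm ?subr_lt0//; clear -yx; lra.
apply: (@le_trans _ _ ((s2 * expR (1 - s2)) ^+ n)); last first.
  by apply: lerXn2r; rewrite ?nnegrE// mulr_ge0 ?expR_ge0// ltW.
apply: gamma_kernel_le => //; rewrite tE.
apply: mulr_le0_ge0; last by rewrite subr_ge0 invf_ge1// /s2 gerBl ltW.
rewrite subr_le0 /s2.
have yx1 : y / x <= 1 - 2 * eta by rewrite ler_pdivrMr// mulrBl mul1r.
apply: (@le_trans _ _ ((1 + eta / 2) * (1 - 2 * eta))).
  apply: ler_pM => //; [clear -c1 c2 eta1; lra|by rewrite divr_ge0// ltW|].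
  by clear -c1; lra.
by clear -ee eta0; lra.
Qed.

(** [n_ N] grows linearly in [N], and [expR u >= u ^+ 2 / 2] with [u = n_ N * a] beats the factor
    [N]. *)
Lemma grid_geometric r (n_ : nat -> nat) x : 0 < r -> r < 1 -> 0 < x -> grid_seq n_ x ->
  N%:R * r ^+ (n_ N) @[N --> \oo] --> (0 : R).
Proof.
move=> r0 r1 x0 hn; pose a := - ln r.
have a0 : 0 < a by rewrite oppr_gt0 ln_lt0// r0.
have inv0 : (N%:R : R)^-1 @[N --> \oo] --> (0 : R).
  by rewrite -(cvg_shiftS (fun N => N%:R^-1 : R)); exact: cvg_harmonic.
have xn0 : x != 0 by rewrite gt_eqF.
have B : (2 / a ^+ 2) * ((n_ N)%:R / N%:R)^-1 ^+ 2 * N%:R^-1 @[N --> \oo] --> (0 : R).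
  rewrite -(mulr0 (2 / a ^+ 2 * x^-1 ^+ 2)); apply: cvgM => //.
  apply: cvgM; first exact: cvg_cst.
  rewrite expr2; under eq_fun do rewrite expr2.
  by apply: cvgM; exact: cvgV.
apply: (@squeeze_cvgr _ _ _ _ (fun=> 0) (fun N => (2 / a ^+ 2) * ((n_ N)%:R / N%:R)^-1 ^+ 2 * N%:R^-1)) => //; last exact: cvg_cst.
have hn' : \forall N \near \oo, 0 < (n_ N)%:R / N%:R :> R.
  have := hn; rewrite /grid_seq => /cvgrPdist_lt/(_ _ x0); apply: filterS => N.
  by rewrite ltr_norml => /andP[_]; lra.
near=> N.
have N0 : 0 < N%:R :> R by rewrite ltr0n; near: N; exact: nbhs_infty_gt.
have nN : 0 < (n_ N)%:R / N%:R :> R by near: N.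
have n0 : 0 < (n_ N)%:R :> R by move: nN; rewrite pmulr_lgt0// invr_gt0.
rewrite mulr_ge0 ?exprn_ge0 ?(ltW r0)//=.
have -> : r = expR (- a) by rewrite opprK lnK.
rewrite -expRM_natl mulrN expRN.
have E := @expR_ge1Dxn R ((n_ N)%:R * a) 1 ltac:(by rewrite mulr_ge0// ltW).
have E2 : (((n_ N)%:R * a) ^+ 2 / 2)^-1 >= (expR ((n_ N)%:R * a))^-1.
  rewrite lef_pV2 ?posrE ?expR_gt0 ?divr_gt0 ?exprn_gt0 ?mulr_gt0//.
  by apply: le_trans E; rewrite lerDr.
apply: le_trans (ler_wpM2l (ltW N0) E2) _.
rewrite le_eqVlt; apply/orP; left; apply/eqP; field.
by rewrite !gt_eqF.
Unshelve. all: by end_near.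
Qed.

Lemma le_integral_EFin u v : measurable_fun setT u -> measurable_fun setT v ->
  (forall y, 0 <= u y) -> (forall y, u y <= v y) ->
  (\int[mu]_y (u y)%:E <= \int[mu]_y (v y)%:E)%E.
Proof.
move=> mu_ mv u0 uv; apply: ge0_le_integral => //.
- by move=> y _; rewrite lee_fin.
- exact/measurable_EFinP.
- exact/measurable_EFinP.
- by move=> y _; rewrite lee_fin.
Qed.

Lemma integral_lin2 u v (a c : R) : measurable_fun setT u -> measurable_fun setT v ->
  (forall y, 0 <= u y) -> (forall y, 0 <= v y) -> 0 <= a -> 0 <= c ->
  (\int[mu]_y (a * u y + c * v y)%:E =
   a%:E * \int[mu]_y (u y)%:E + c%:E * \int[mu]_y (v y)%:E)%E.
Proof.
move=> mu_ mv u0 v0 a0 c0.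
under eq_integral do rewrite EFinD !EFinM.
have mEu : measurable_fun setT (fun y : R => (u y)%:E) by exact/measurable_EFinP.
have mEv : measurable_fun setT (fun y : R => (v y)%:E) by exact/measurable_EFinP.
rewrite ge0_integralD//.
- rewrite !ge0_integralZl//.
  + by move=> y _; rewrite lee_fin.
  + by move=> y _; rewrite lee_fin.
- by move=> y _; rewrite mule_ge0 ?lee_fin.
- by apply: emeasurable_funM; [exact: measurable_cst|exact: mEu].
- by move=> y _; rewrite mule_ge0 ?lee_fin.
- by apply: emeasurable_funM; [exact: measurable_cst|exact: mEv].
Qed.

(** The kernel has mass [1 / N] and concentrates near [n_ N / N]. Close to [x] continuity decides;
    elsewhere geometric decay beats [N], the transform at [th] keeping the integral of [F]
    finite. *)
Lemma post_widder F th x (n_ : nat -> nat) : measurable_fun setT F -> (forall y, 0 <= F y) ->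
  0 < th -> (\int[mu]_y (exp_pos th y * F y)%:E < +oo)%E ->
  0 < x -> {for x, continuous F} -> grid_seq n_ x ->
  N%:R * fine (\int[mu]_y (pois N%:R (n_ N) y * F y)%:E) @[N --> \oo] --> F x.
Proof.
move=> mF F0 th0 fF x0 cF hn; apply/cvgrPdist_le => e e0.
have e3 : 0 < e / 2 by rewrite divr_gt0.
move/cvgrPdist_le/(_ _ e3): cF => /nbhs_ballP[d1 /= d10 hd1].
(* Capping the radius by [x] ensures [eta <= 1 / 2], where [d = 2 * eta * x]. *)
pose d := Num.min d1 x.
have d0 : 0 < d by rewrite /d lt_min d10.
have dx : d <= x by rewrite /d ge_min lexx orbT.
have hd y : `|y - x| < d -> `|F x - F y| <= e / 2.
  by move=> yx; apply: hd1; rewrite /ball/= distrC (lt_le_trans yx)// /d ge_min lexx.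
have hdu y : `|y - x| < d -> F y <= F x + e / 2 /\ F x <= F y + e / 2.
  move=> /hd; rewrite ler_norml; clear => /andP[h1 h2]; split; lra.
clear hd.
have Fxe : 0 <= F x + e / 2 by rewrite addr_ge0// ltW.
pose eta := d / (2 * x).
have eta0 : 0 < eta by rewrite divr_gt0// mulr_gt0.
have eta1 : eta <= 1 / 2 by rewrite /eta ler_pdivrMr ?mulr_gt0//; lra.
have etax : 2 * eta * x = d by rewrite /eta; field; rewrite gt_eqF.
pose s1 := 1 + eta; pose s2 := 1 - eta.
have s10 : 0 < s1 by rewrite /s1; lra.
have s20 : 0 < s2 by rewrite /s2; lra.
pose r := Num.max (s1 * expR (1 - s1)) (s2 * expR (1 - s2)).
have r0 : 0 < r by rewrite /r lt_max mulr_gt0 ?expR_gt0.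
have r1 : r < 1.
  rewrite /r gt_max !mul_expR_lt1//.
  - by rewrite /s2 -subr_eq0 addrAC subrr add0r oppr_eq0 gt_eqF.
  - by rewrite /s1 -subr_eq0 addrAC subrr add0r gt_eqF.
(* The room between [r] and [r'] takes in the factor [N / (N - th)], which tends to 1. *)
pose r' := (1 + r) / 2.
have r'0 : 0 < r' by rewrite /r'; lra.
have r'1 : r' < 1 by rewrite /r'; lra.
have rr' : r < r' by rewrite /r'; lra.
have geo := grid_geometric r'0 r'1 x0 hn.
pose A := fine (\int[mu]_y (exp_pos th y * F y)%:E).
have mexpF : measurable_fun setT (fun y => exp_pos th y * F y).
  by apply: measurable_funM => //; exact: measurable_exp_pos.
have expF0 y : 0 <= exp_pos th y * F y by rewrite mulr_ge0// exp_pos_ge0.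
have iexpF0 : (0 <= \int[mu]_y (exp_pos th y * F y)%:E)%E.
  by apply: integral_ge0 => y _; rewrite lee_fin.
have AE : A%:E = (\int[mu]_y (exp_pos th y * F y)%:E)%E.
  by rewrite fineK// ge0_fin_numE.
have A0 : 0 <= A by rewrite fine_ge0.
(* [A] serves the outer part of [F], [F x / th] that of the constant [F x]; the 1 keeps [B]
   positive. *)
pose B := A + F x / th + 1.
have FxB : 0 <= F x / th by rewrite divr_ge0// ltW.
have B0 : 0 < B by rewrite /B; lra.
have AB : A <= B by rewrite /B; lra.
have FB : F x / th <= B by rewrite /B; lra.
have eB : 0 < e / 2 / B by rewrite divr_gt0.
have inv0 : (N%:R : R)^-1 @[N --> \oo] --> (0 : R).
  by rewrite -(cvg_shiftS (fun N => N%:R^-1 : R)); exact: cvg_harmonic.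
have rat1 : (1 - th * N%:R^-1 : R) @[N --> \oo] --> (1 : R).
  rewrite -[X in _ --> X]subr0 -(mulr0 th); apply: cvgB; first exact: cvg_cst.
  by apply: cvgM => //; exact: cvg_cst.
have xn0 : x != 0 by rewrite gt_eqF.
have rat2 : (1 - th * N%:R^-1) * (x * ((n_ N)%:R / N%:R)^-1) @[N --> \oo] --> (1 : R).
  rewrite [X in _ --> X](_ : 1 = 1 * (x * x^-1)); last by rewrite mulfV// mulr1.
  apply: cvgM => //.
  by apply: cvgM; [exact: cvg_cst|exact: cvgV].
have rat3 : (1 - th * N%:R^-1)^-1 * r @[N --> \oo] --> r.
  rewrite [X in _ --> X](_ : r = 1^-1 * r); last by rewrite invr1 mul1r.
  apply: cvgM; last exact: cvg_cst.
  by apply: cvgV => //; rewrite oner_eq0.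
have eta2 : 0 < eta / 2 by rewrite divr_gt0.
move/cvgrPdist_le/(_ _ eta2): rat2 => rat2.
have rr0 : 0 < r' - r by rewrite subr_gt0.
move/cvgrPdist_le/(_ _ rr0): rat3 => rat3.
move/cvgrPdist_le/(_ _ eB): geo => geo.
have npos : \forall N \near \oo, 0 < (n_ N)%:R / N%:R :> R.
  have := hn; rewrite /grid_seq => /cvgrPdist_lt/(_ _ x0); apply: filterS => N.
  by rewrite ltr_norml => /andP[_]; lra.
near=> N.
have NT : th < N%:R by near: N; exact: nbhs_infty_gtr.
have N0 : 0 < N%:R :> R by exact: lt_trans NT.
have NN0 : N%:R != 0 :> R by rewrite gt_eqF.
have M0 : 0 < N%:R - th by rewrite subr_gt0.
have nN : 0 < (n_ N)%:R / N%:R :> R by near: N.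
have n0 : 0 < (n_ N)%:R :> R by move: nN; rewrite pmulr_lgt0// invr_gt0.
have n0' : (0 < n_ N)%N by move: n0; rewrite ltr0n.
have r2 : `|1 - (1 - th * N%:R^-1) * (x * ((n_ N)%:R / N%:R)^-1)| <= eta / 2 by near: N.
have r3 : `|r - (1 - th * N%:R^-1)^-1 * r| <= r' - r by near: N.
have r4 : `|0 - N%:R * r' ^+ n_ N| <= e / 2 / B by near: N.
move: (n_ N) n0 n0' r2 r4 => n n0 n0' r2 r4.
have r2E : (1 - th * N%:R^-1) * (x * (n%:R / N%:R)^-1) = (N%:R - th) * x / n%:R.
  by field; rewrite NN0 gt_eqF.
rewrite {}r2E in r2; have r3E : (1 - th * N%:R^-1)^-1 = N%:R / (N%:R - th).
  by field; rewrite NN0 gt_eqF.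
rewrite {}r3E in r3; move: (N%:R : R) N0 NN0 M0 r2 r3 r4 {NT nN} => L L0 Ln0 M0 r2 r3 r4.
set c := (L - th) * x / n%:R in r2.
have c0 : 0 < c by rewrite divr_gt0// mulr_gt0.
have LM0 : 0 < L / (L - th) by rewrite divr_gt0.
have rrL : L / (L - th) * r <= r'.
  by move: r3; rewrite ler_norml; clear => /andP[+ _]; lra.
have out y : 0 < y -> ~~ (`|y - x| < d) -> gamma_kernel L n y <= r' ^+ n * expR (- (th * y)).
  rewrite -leNgt -etax => y0 yd; apply: (gamma_kernel_away _ _ _ eta0 eta1 _ _ _ rrL yd) => //.
  - by rewrite /r le_max lexx.
  - by rewrite /r le_max lexx orbT.
have rn0 : 0 <= r' ^+ n by rewrite exprn_ge0// ltW.
have Fx0 := F0 x.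
have pn0 y : 0 <= pois L n y by rewrite pois_ge0// ltW.
have up y : pois L n y * F y <= (F x + e / 2) * pois L n y + r' ^+ n * (exp_pos th y * F y).
  rewrite /pois /exp_pos; case: ifPn => [y0|_]; last by rewrite mul0r !mulr0 addr0.
  have g0 : 0 <= gamma_kernel L n y by have := pn0 y; rewrite /pois y0.
  have [yd|yd] := boolP (`|y - x| < d).
    have [Fy _] := hdu _ yd.
    rewrite -[leLHS]addr0; apply: lerD; first by rewrite mulrC ler_wpM2r.
    by rewrite !mulr_ge0// expR_ge0.
  rewrite -[leLHS]add0r; apply: lerD; first by rewrite mulr_ge0.
  by rewrite mulrA ler_wpM2r// out.
(* The dummy factors and the term [0 * 0] give both sides the shape integrated by
   [integral_lin2]. *)
have lo y : F x * pois L n y + 0 * 0 <= 1 * (pois L n y * F y) +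
    1 * (e / 2 * pois L n y + r' ^+ n * F x * exp_pos th y).
  rewrite mul0r addr0 !mul1r /pois /exp_pos.
  case: ifPn => [y0|_]; last by rewrite mul0r !mulr0 !addr0.
  have g0 : 0 <= gamma_kernel L n y by have := pn0 y; rewrite /pois y0.
  have [yd|yd] := boolP (`|y - x| < d).
    have [_ Fy] := hdu _ yd.
    rewrite addrA -[leLHS]addr0; apply: lerD; last by rewrite !mulr_ge0// expR_ge0.
    by rewrite (mulrC _ (F y)) -mulrDl ler_wpM2r.
  have E : gamma_kernel L n y * F x <= r' ^+ n * F x * expR (- (th * y)).
    by rewrite [leRHS]mulrAC ler_wpM2r// out.
  have G1 : 0 <= gamma_kernel L n y * F y by rewrite mulr_ge0.
  have G2 : 0 <= e / 2 * gamma_kernel L n y by rewrite mulr_ge0// ltW.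
  by clear -E G1 G2; lra.
have mp : measurable_fun setT (pois L n) by exact: measurable_pois.
have me : measurable_fun setT (exp_pos th) by exact: measurable_exp_pos.
have mpF : measurable_fun setT (fun y => pois L n y * F y) by exact: measurable_funM.
have pF0 y : 0 <= pois L n y * F y by rewrite mulr_ge0.
have e20 := ltW e3.
have up' : (\int[mu]_y (pois L n y * F y)%:E <= ((F x + e / 2) / L + r' ^+ n * A)%:E)%E.
  rewrite EFinD !EFinM AE -(integral_pois n L0) -integral_lin2//.
  apply: le_integral_EFin => //.
  by apply: measurable_funD; apply: measurable_funM.
have Ifin : (\int[mu]_y (pois L n y * F y)%:E)%E \is a fin_num.
  rewrite ge0_fin_numE; first by rewrite (le_lt_trans up')// ltry.
  by apply: integral_ge0 => y _; rewrite lee_fin.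
set I := fine _.
have IE : (\int[mu]_y (pois L n y * F y)%:E = I%:E)%E by rewrite fineK.
have upI : I <= (F x + e / 2) / L + r' ^+ n * A by rewrite -lee_fin -IE.
have loI : F x / L <= I + (e / 2 / L + r' ^+ n * F x / th).
  rewrite -lee_fin.
  have -> : (F x / L)%:E = (\int[mu]_y (F x * pois L n y + 0 * 0)%:E)%E.
    by rewrite (@integral_lin2 _ (fun=> 0))// mul0e adde0 integral_pois.
  have -> : (I + (e / 2 / L + r' ^+ n * F x / th))%:E =
      (\int[mu]_y (1 * (pois L n y * F y) + 1 * (e / 2 * pois L n y + r' ^+ n * F x * exp_pos th y))%:E)%E.
    rewrite integral_lin2//; last 2 first.
    - by apply: measurable_funD; apply: measurable_funM.
    - move=> y; apply: addr_ge0; apply: mulr_ge0 => //; first exact: mulr_ge0.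
      exact: exp_pos_ge0.
    rewrite !mul1e IE integral_lin2//; last 2 first.
    - by move=> y; exact: exp_pos_ge0.
    - by rewrite mulr_ge0.
    by rewrite integral_pois// integral_exp_pos// EFinD EFinD !EFinM.
  apply: le_integral_EFin => //.
  - by apply: measurable_funD => //; apply: measurable_funM.
  - apply: measurable_funD; apply: measurable_funM => //.
    by apply: measurable_funD; apply: measurable_funM.
  - by move=> y; rewrite mulr0 addr0 mulr_ge0.
have K : L * r' ^+ n * B <= e / 2.
  by rewrite -ler_pdivlMr//; move: r4; rewrite sub0r normrN; apply: le_trans; exact: ler_norm.
have Lr0 : 0 <= L * r' ^+ n by rewrite mulr_ge0// ltW.
have KA : L * r' ^+ n * A <= e / 2 by apply: le_trans K; rewrite ler_wpM2l.
have KF : L * r' ^+ n * (F x / th) <= e / 2 by apply: le_trans K; rewrite ler_wpM2l.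
have U := ler_wpM2l (ltW L0) upI; have V := ler_wpM2l (ltW L0) loI.
have U1 : L * ((F x + e / 2) / L + r' ^+ n * A) = F x + e / 2 + L * r' ^+ n * A by field.
have V1 : L * (F x / L) = F x by field.
have V2 : L * (I + (e / 2 / L + r' ^+ n * F x / th)) = L * I + e / 2 + L * r' ^+ n * (F x / th).
  by field; rewrite gt_eqF.
rewrite U1 in U; rewrite V1 V2 in V.
move: (L * I) (L * _ * A) (L * _ * (F x / th)) KA KF U V => a b c' h1 h2 h3 h4.
clear -h1 h2 h3 h4; rewrite ler_norml; apply/andP; split; lra.
Unshelve. all: by end_near.
Qed.

End post_widder.

(** * The Laplace exponent *)

Section laplace_exponent_theory.
Context (R : realType).
Variables (gamma sigma : R) (Pi : {measure set (measurableTypeR R) -> \bar R}) (pi : R -> R).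
Hypotheses (hPi : levy_measure Pi) (hpi : positive_density Pi pi).
Local Notation mu := (@lebesgue_measure R).
Local Notation psi := (laplace_exponent gamma sigma Pi).
Local Notation D := (`]0%R, +oo[%classic : set (measurableTypeR R)).
Implicit Types (th x t : R).

Definition compensated th x : R :=
  1 - expR (- th * x) - th * x * (\1_(`]0, 1[ : set R) x).

Lemma measurable_compensated th : measurable_fun D (compensated th).
Proof.
apply: measurable_funTS; apply: measurable_funB.
  apply: measurable_funB; first exact: measurable_cst.
  exact: measurable_expM.
apply: measurable_funM; first exact: mulrl_measurable.
exact: measurable_indic.
Qed.

Lemma expRN_le u : 0 <= u -> expR (- u) - 1 + u <= u ^+ 2 :> R.
Proof.
move=> u0; have u1 : 0 < 1 + u by rewrite ltr_pwDl.
have : expR (- u) <= (1 + u)^-1.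
  by rewrite expRN lef_pV2 ?posrE ?expR_gt0//; exact: expR_ge1Dx.
have : (1 + u)^-1 - 1 + u <= u ^+ 2.
  rewrite -(ler_pM2l u1).
  rewrite (_ : (1 + u) * ((1 + u)^-1 - 1 + u) = u ^+ 2); last by field; rewrite gt_eqF.
  by rewrite ler_peMl ?sqr_ge0// lerDl.
by lra.
Qed.

(** Below 1 the compensator cancels the first-order term and leaves at most [(th * x) ^+ 2]; from 1
    on the integrand is bounded by 1. *)
Lemma compensated_le th x : 0 <= th -> 0 < x ->
  `|compensated th x| <= (th ^+ 2 + 1) * Num.min 1 (x ^+ 2).
Proof.
move=> th0 x0; have thx : 0 <= th * x by rewrite mulr_ge0// ltW.
rewrite /compensated indicE mulNr; have th2 := sqr_ge0 th.
have [x1|x1] := ltP x 1.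
  rewrite mem_set/= ?in_itv/= ?x0//= mulr1.
  have := expRN_le thx; have := expR_ge1Dx (- (th * x)).
  rewrite exprMn => h1 h2.
  have x2 : x ^+ 2 <= 1 by rewrite expr_le1// ltW.
  rewrite min_r//.
  have := sqr_ge0 x => sx; rewrite ler_norml; apply/andP; split; lra.
rewrite memNset/= ?in_itv/= ?x0/=; last by move=> /= ; rewrite ltNge x1.
rewrite mulr0 subr0 min_l ?mulr1; last by rewrite expr_ge1// ltW.
have e1 : expR (- (th * x)) <= 1 by rewrite expR_le1 oppr_le0.
have e0 := expR_gt0 (- (th * x)).
by rewrite ler_norml; apply/andP; split; lra.
Qed.

Lemma integrable_min_sqr : Pi.-integrable D (fun x => (Num.min 1 (x ^+ 2) : R)%:E).
Proof.
case: hPi => _ fin; apply/integrableP; split.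
  apply/measurable_EFinP; apply: measurable_funTS; apply: measurable_minr.
    exact: measurable_cst.
  exact: exprn_measurable.
apply: le_lt_trans fin; apply: ge0_le_integral => //.
- apply: measurableT_comp => //; apply/measurable_EFinP; apply: measurable_funTS.
  apply: measurable_minr; first exact: measurable_cst.
  exact: exprn_measurable.
- apply/measurable_EFinP; apply: measurable_funTS.
  apply: measurable_minr; first exact: measurable_cst.
  exact: exprn_measurable.
- by move=> x _ /=; rewrite lee_fin ger0_norm// le_min ler01 sqr_ge0.
Qed.

Lemma integrable_compensated th : 0 <= th -> Pi.-integrable D (EFin \o compensated th).
Proof.
move=> th0; have mD : measurable D by exact: measurable_itv.
apply: (le_integrable mD _ _ (integrableZl mD (th ^+ 2 + 1) integrable_min_sqr)).
  by apply/measurable_EFinP; exact: measurable_compensated.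
move=> x /=; rewrite in_itv/= andbT => x0.
rewrite lee_fin [leRHS]ger0_norm; first exact: compensated_le.
by rewrite mulr_ge0 ?addr_ge0 ?sqr_ge0// le_min ler01 sqr_ge0.
Qed.

Lemma laplace_exponentE th : psi th =
  gamma * th + 2^-1 * sigma ^+ 2 * th ^+ 2 - \int[Pi]_(x in D) compensated th x.
Proof. by []. Qed.

Lemma laplace_exponent0 : psi 0 = 0.
Proof.
rewrite laplace_exponentE mulr0 expr0n/= mulr0 addr0 sub0r.
rewrite /Rintegral integral0_eq ?oppr0// => x _.
by rewrite /compensated oppr0 !mul0r expR0 subrr subr0.
Qed.

Lemma laplace_exponent_convex t a c : 0 <= t -> t <= 1 -> 0 <= a -> 0 <= c ->
  psi (t * a + (1 - t) * c) <= t * psi a + (1 - t) * psi c.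
Proof.
move=> t0 t1 a0 c0; have t1' : 0 <= 1 - t by rewrite subr_ge0.
have tac : 0 <= t * a + (1 - t) * c by rewrite addr_ge0// mulr_ge0.
have mD : measurable D by exact: measurable_itv.
have I1 : Pi.-integrable D (EFin \o (fun x => t * compensated a x)).
  by apply: eq_integrable (integrableZl mD t (integrable_compensated a0)).
have I2 : Pi.-integrable D (EFin \o (fun x => (1 - t) * compensated c x)).
  by apply: eq_integrable (integrableZl mD (1 - t) (integrable_compensated c0)).
have H : \int[Pi]_(x in D) (t * compensated a x + (1 - t) * compensated c x)
    <= \int[Pi]_(x in D) compensated (t * a + (1 - t) * c) x.
  apply: le_Rintegral => //; last 2 first.
  - exact: integrable_compensated.
  - move=> x /= _; rewrite /compensated.
    have := @convex_expR R (Itv01 t0 t1) (- a * x) (- c * x).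
    rewrite !convRE/= => H.
    rewrite (_ : - (t * a + (1 - t) * c) * x = t * (- a * x) + (1 - t) * (- c * x)); last by ring.
    move: H; rewrite /conv/= => H.
    have {}H : expR (t * (- a * x) + (1 - t) * (- c * x)) <=
      t * expR (- a * x) + (1 - t) * expR (- c * x) by exact: H.
    by lra.
  - by apply: eq_integrable (integrableD mD I1 I2).
move: H; rewrite RintegralD// !RintegralZl//; [|exact: integrable_compensated|exact: integrable_compensated].
rewrite !laplace_exponentE => H.
have S : 0 <= 2^-1 * sigma ^+ 2 by rewrite mulr_ge0 ?sqr_ge0.
(* [t * (1 - t) * (a - c) ^+ 2] is the convexity gap of the square, for the Gaussian term. *)
have := mulr_ge0 S (mulr_ge0 (mulr_ge0 t0 t1') (sqr_ge0 (a - c))).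
lra.
Qed.

(** The combination [psi a - a / c * psi c] kills the drift and the compensators, which are linear
    in the exponent. The Gaussian term contributes [a * (a - c) * sigma ^+ 2 / 2], and the rest
    integrates a nonnegative kernel. *)
Lemma laplace_exponent_difference a c : 0 < c -> c < a ->
  (\int[mu]_x ((convex_kernel a c x)%:E * ((EFin \o pi) \_ `]0%R, +oo[) x) =
   ((psi a - a / c * psi c) / (a * (a - c)) - 2^-1 * sigma ^+ 2)%:E)%E.
Proof.
move=> c0 ca; have a0 := lt_trans c0 ca.
have ac0 : 0 < a - c by rewrite subr_gt0.
have mD : measurable D by exact: measurable_itv.
pose K x := (a * (a - c))^-1 * (a / c * compensated c x - compensated a x).
have KE x : 0 < x -> convex_kernel a c x = K x.
  move=> x0; rewrite /convex_kernel x0 /K /compensated !mulNr.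
  by move: (\1__ _) (expR _) (expR _) => i u v; field; rewrite !gt_eqF.
have mck : measurable_fun setT (convex_kernel a c).
  rewrite /convex_kernel; apply: measurable_fun_ifT; last exact: measurable_cst.
    by apply: measurable_fun_ltr; [exact: measurable_cst|exact: measurable_id].
  have me (k : R) : measurable_fun setT (fun r : R => (1 - expR (- (k * r))) / k).
    apply: measurable_funM; last exact: measurable_cst.
    apply: measurable_funB; first exact: measurable_cst.
    rewrite (_ : (fun r : R => _) = fun r => expR (- k * r)); first exact: measurable_expM.
    by apply/funext => r; rewrite mulNr.
  by apply: measurable_funM; [apply: measurable_funB|exact: measurable_cst].
have K0 x : 0 <= convex_kernel a c x.
  rewrite -lee_fin -exp_pos_convolution2 ?gt_eqF//.
  apply: integral_ge0 => r _; rewrite mule_ge0 ?lee_fin ?exp_pos_ge0//.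
  case: ifP => // r0; rewrite divr_ge0 ?(ltW ac0)// subr_ge0 ler_expR lerN2 ler_wpM2r//; exact: ltW.
rewrite -(integral_density hpi); last 2 first.
- exact/measurable_EFinP.
- by move=> x; rewrite lee_fin.
have I1 : Pi.-integrable D (EFin \o (fun x => a / c * compensated c x)).
  by apply: eq_integrable (integrableZl mD (a / c) (integrable_compensated (ltW c0))).
have I2 := integrable_compensated (ltW a0).
have I3 : Pi.-integrable D (EFin \o (fun x => a / c * compensated c x - compensated a x)).
  by apply: eq_integrable (integrableB mD I1 I2).
transitivity (\int[Pi]_(x in D) (K x)%:E)%E.
  by apply: eq_integral => x; rewrite inE/= in_itv/= andbT => x0; rewrite KE.
have I4 : Pi.-integrable D (EFin \o K).
  by apply: eq_integrable (integrableZl mD (a * (a - c))^-1 I3).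
rewrite -[LHS]fineK; last by apply: integrable_fin_num.
congr EFin; rewrite -[LHS]/(\int[Pi]_(x in D) K x) /K.
rewrite RintegralZl// RintegralB// RintegralZl//; last exact/integrable_compensated/ltW.
rewrite !laplace_exponentE; field.
by rewrite !gt_eqF.
Qed.

End laplace_exponent_theory.

(** * Log-convexity under integration *)

Section log_convexity.
Context (R : realType).
Local Notation mu := (@lebesgue_measure R).
Implicit Types (f G P : R -> R) (h : R -> R) (p : R -> \bar R) (s t x y k : R).

Lemma log_convex_posP f : log_convex_on `]0, +oo[ f <->
  (forall x, 0 < x -> 0 < f x) /\
  (forall t x y, 0 <= t -> t <= 1 -> 0 < x -> 0 < y ->
     ln (f (t * x + (1 - t) * y)) <= t * ln (f x) + (1 - t) * ln (f y)).
Proof.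
rewrite /log_convex_on convex_onE; split=> -[f0 lf]; split.
- by move=> x x0; apply: f0; rewrite /= in_itv/= x0.
- by move=> t x y t0 t1 x0 y0; apply: lf => //=; rewrite in_itv/= ?x0 ?y0.
- by move=> x /=; rewrite in_itv/= andbT; exact: f0.
- by move=> t x y t0 t1 /=; rewrite !in_itv/= !andbT; exact: lf.
Qed.

Lemma expR_convex t x y : 0 <= t -> t <= 1 ->
  expR (t * x + (1 - t) * y) <= t * expR x + (1 - t) * expR y.
Proof. by move=> t0 t1; exact: (@convex_expR R (Itv01 t0 t1) x y). Qed.

Lemma conv_gt0 t x y : 0 <= t -> t <= 1 -> 0 < x -> 0 < y -> 0 < t * x + (1 - t) * y.
Proof.
move=> t0 t1 x0 y0; have [->|tn] := eqVneq t 0; first by rewrite mul0r add0r subr0 mul1r.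
by rewrite ltr_wpDr ?mulr_ge0 ?subr_ge0 ?(ltW y0)// mulr_gt0// lt_def tn.
Qed.

(* Normalising by the values [G x], [G y] of the integral turns Hoelder's
   inequality into the convexity of [expR]. *)
Lemma log_convex_integral f h p G : log_convex_on `]0, +oo[ f ->
  (forall x, 0 < x -> p x = (f x)%:E) -> (forall x, (0 <= p x)%E) ->
  measurable_fun setT p -> measurable_fun setT h -> (forall t, 0 <= h t) ->
  (forall t, t <= 0 -> h t = 0) ->
  (forall x, 0 < x -> (\int[mu]_t ((h t)%:E * p (x + t)%R) = (G x)%:E)%E) ->
  (forall x, 0 < x -> 0 < G x) ->
  log_convex_on `]0, +oo[ G.
Proof.
move=> /log_convex_posP[f0 lf] pf p0 mp mh h0 hn GE G0.
apply/log_convex_posP; split=> // t x y t0 t1 x0 y0.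
have t1' : 0 <= 1 - t by rewrite subr_ge0.
have z0 : 0 < t * x + (1 - t) * y by exact: conv_gt0.
set z := t * x + (1 - t) * y in z0 *.
pose K := t * ln (G x) + (1 - t) * ln (G y).
suff : G z <= expR K by move=> H; rewrite -[leRHS]expRK ler_ln ?posrE ?expR_gt0 ?G0.
have Gx := G0 _ x0; have Gy := G0 _ y0.
have mpx (w : R) : measurable_fun setT (fun s : R => p (w + s)).
  by apply: measurableT_comp => //; apply: measurable_funD => //; exact: measurable_cst.
have mph (w : R) : measurable_fun setT (fun s : R => ((h s)%:E * p (w + s)%R)%E).
  by apply: emeasurable_funM => //; exact/measurable_EFinP.
have hp0 w s : (0 <= (h s)%:E * p (w + s)%R)%E by rewrite mule_ge0// lee_fin.
pose A := expR K * t / G x; pose B := expR K * (1 - t) / G y.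
have A0 : 0 <= A by rewrite divr_ge0 ?mulr_ge0 ?expR_ge0// ltW.
have B0 : 0 <= B by rewrite divr_ge0 ?mulr_ge0 ?expR_ge0// ltW.
rewrite -lee_fin -GE//.
have -> : (expR K)%:E = (\int[mu]_s (A%:E * ((h s)%:E * p (x + s)%R) + B%:E * ((h s)%:E * p (y + s)%R)))%E.
  rewrite ge0_integralD//.
  - rewrite !ge0_integralZl//.
    + rewrite !GE// -!EFinM -EFinD; congr EFin; rewrite /A /B.
      by rewrite !divfK ?gt_eqF//; ring.
    + exact: mph.
    + exact: mph.
  - by move=> s _; rewrite mule_ge0.
  - by apply: emeasurable_funM; [exact: measurable_cst|exact: mph].
  - by move=> s _; rewrite mule_ge0.
  - by apply: emeasurable_funM; [exact: measurable_cst|exact: mph].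
apply: ge0_le_integral => //.
- exact: mph.
- by apply: emeasurable_funD; apply: emeasurable_funM; [exact: measurable_cst|exact: mph|exact: measurable_cst|exact: mph].
move=> s _; have [s0|s0] := leP s 0; first by rewrite hn// !mul0e !mule0 adde0.
have zs : 0 < z + s by rewrite addr_gt0.
have xs : 0 < x + s by rewrite addr_gt0.
have ys : 0 < y + s by rewrite addr_gt0.
rewrite !pf// -!EFinM -EFinD lee_fin.
rewrite [leRHS](_ : _ = h s * (A * f (x + s) + B * f (y + s))); last by ring.
apply: ler_wpM2l => //.
have fxs := f0 _ xs; have fys := f0 _ ys; have fzs := f0 _ zs.
rewrite -[leLHS]lnK ?posrE//.
apply: (@le_trans _ _ (expR (K + (t * ln (f (x + s) / G x) + (1 - t) * ln (f (y + s) / G y))))).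
  rewrite ler_expR !ln_div ?posrE// /K.
  have := lf t (x + s) (y + s) t0 t1 xs ys.
  by rewrite (_ : t * (x + s) + (1 - t) * (y + s) = z + s); [lra|rewrite /z; ring].
rewrite expRD.
apply: (@le_trans _ _ (expR K * (t * (f (x + s) / G x) + (1 - t) * (f (y + s) / G y)))).
  rewrite ler_pM2l ?expR_gt0//; apply: le_trans (expR_convex _ _ t0 t1) _.
  by rewrite !lnK ?posrE ?divr_gt0.
by rewrite /A /B le_eqVlt; apply/orP; left; apply/eqP; ring.
Qed.

(** Log-convexity as a comparison of products, which can be integrated in [s] and [t] separately. *)
Definition four_point P := forall x s t, 0 < x -> 0 < s -> 0 < t ->
  P (x + s) * P (x + t) <= P x * P (x + s + t).

(** [x + s] and [x + t] are convex combinations of [x] and [x + s + t] with exchanged weights, so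
    the two inequalities add up. *)
Lemma log_convex_four_point f : log_convex_on `]0, +oo[ f -> four_point f.
Proof.
move=> /log_convex_posP[f0 lf] x s t x0 s0 t0.
have st : 0 < s + t by rewrite addr_gt0.
have fx := f0 _ x0; have fxs := f0 _ (addr_gt0 x0 s0); have fxt := f0 _ (addr_gt0 x0 t0).
have xst : 0 < x + s + t by rewrite !addr_gt0.
have fxst := f0 _ xst.
have a0 : 0 <= t / (s + t) by rewrite divr_ge0// ltW.
have a1 : t / (s + t) <= 1 by rewrite ler_pdivrMr// mul1r lerDr ltW.
have c0 : 0 <= 1 - t / (s + t) by rewrite subr_ge0.
have c1 : 1 - t / (s + t) <= 1 by rewrite lerBlDr lerDl.
have h1 := lf _ _ _ a0 a1 x0 xst; have h2 := lf _ _ _ c0 c1 x0 xst.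
have e1 : t / (s + t) * x + (1 - t / (s + t)) * (x + s + t) = x + s by field; rewrite gt_eqF.
have e2 : (1 - t / (s + t)) * x + (1 - (1 - t / (s + t))) * (x + s + t) = x + t.
  by field; rewrite gt_eqF.
rewrite {}e1 in h1; rewrite {}e2 in h2.
rewrite -ler_ln ?posrE ?mulr_gt0// !lnM ?posrE//; lra.
Qed.

(** Expanding leaves the additive inequality [A + B <= C + E]; it follows from [A * B <= C * E] and
    [(C - A) * (C - B) >= 0]. This accommodates the constant [q / c]. *)
Lemma four_point_add_cst P k : (forall x, 0 < x -> 0 < P x) ->
  (forall x y, 0 < x -> x <= y -> P y <= P x) -> 0 <= k ->
  four_point P -> four_point (fun x => P x + k).
Proof.
move=> P0 dP k0 fP x s t x0 s0 t0.
have H := fP _ _ _ x0 s0 t0.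
have C0 := P0 _ x0.
have h1 : P (x + s) <= P x by apply: dP => //; lra.
have h2 : P (x + t) <= P x by apply: dP => //; lra.
move: (P x) (P (x + s)) (P (x + t)) (P (x + s + t)) C0 H h1 h2 => C A B E C0 H h1 h2.
have AB : A + B <= C + E.
  rewrite -(ler_pM2l C0); have := mulr_ge0 (ltac:(lra) : 0 <= C - A) (ltac:(lra) : 0 <= C - B).
  lra.
have := ler_wpM2l k0 AB; lra.
Qed.

(** A bound on a square cannot be integrated; as a family of linear bounds indexed by [k] it can. *)
Lemma le_amgm (T1 T2 Ps k : R) : 0 < k -> 0 <= T1 -> 0 <= T2 -> 0 <= Ps ->
  T1 * T1 <= Ps * T2 -> 2 * T1 <= k * Ps + k^-1 * T2.
Proof.
move=> k0 T10 T20 P0 H.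
have k1 : 0 < k^-1 by rewrite invr_gt0.
have kk : k * k^-1 = 1 by rewrite mulfV// gt_eqF.
have r0 : 0 <= k * Ps + k^-1 * T2 by rewrite addr_ge0 ?mulr_ge0// ltW.
rewrite -(@ler_pXn2r _ 2)//; last by rewrite nnegrE mulr_ge0.
have := sqr_ge0 (k * Ps - k^-1 * T2).
have E : (k * Ps) * (k^-1 * T2) = Ps * T2 by rewrite mulrACA kk mul1r.
rewrite !expr2 => S; lra.
Qed.

(** The way back: [k = b / a] is optimal, and for [a = 0] a large [k] forces [b = 0]. *)
Lemma amgm_le (a b c : R) : 0 <= a -> 0 <= b -> 0 <= c ->
  (forall k, 0 < k -> 2 * b <= k * a + k^-1 * c) -> b ^+ 2 <= a * c.
Proof.
move=> a0 b0 c0 H; have [->|bn] := eqVneq b 0; first by rewrite expr0n/= mulr_ge0.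
have {bn}b0 : 0 < b by rewrite lt_def bn.
have [a00|an] := eqVneq a 0.
  have k0 : 0 < (c + 1) / b by rewrite divr_gt0// ltr_wpDl.
  have := H _ k0; rewrite a00 mulr0 add0r invf_div => h.
  have : b / (c + 1) * c <= b.
    by rewrite -mulrA ler_piMr ?(ltW b0)// mulrC ler_pdivrMr ?mul1r ?lerDl// ltr_wpDl.
  lra.
have {an}a0 : 0 < a by rewrite lt_def an.
have := H _ (divr_gt0 b0 a0); rewrite invf_div divfK ?gt_eqF// => h.
have {}h : b <= a / b * c by lra.
by move: h; rewrite mulrAC ler_pdivlMr.
Qed.

(** Smoothing [P] once and twice by [exp_pos l] writes the masses at [n.+1] and [n.+2] as integrals
    of [T1] and [T2] against the one weight [pois l n]. Pointwise [T1 ^+ 2 <= P * T2]; this is made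
    linear in each [k], integrated, and optimised over [k]. *)
Lemma pois_log_convex P l n : 0 < l -> measurable_fun setT P -> (forall x, 0 <= P x) ->
  four_point P ->
  (forall m, (n <= m)%N -> (\int[mu]_y (pois l m y * P y)%:E < +oo)%E) ->
  fine (\int[mu]_y (pois l n.+1 y * P y)%:E) ^+ 2 <=
  fine (\int[mu]_y (pois l n y * P y)%:E) * fine (\int[mu]_y (pois l n.+2 y * P y)%:E).
Proof.
move=> l0 mP P0 fP fin; have ln0 : l != 0 by rewrite gt_eqF.
pose e (t : R) := (exp_pos l t)%:E; pose pE (y : R) := (P y)%:E.
have me : measurable_fun setT e by apply/measurable_EFinP; exact: measurable_exp_pos.
have mpE : measurable_fun setT pE by exact/measurable_EFinP.
have e0 t : (0 <= e t)%E by rewrite lee_fin exp_pos_ge0.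
have pE0 y : (0 <= pE y)%E by rewrite lee_fin.
pose T1 (s : R) := (\int[mu]_t (e t * pE (s + t)%R))%E.
have mT1 : measurable_fun setT T1 by exact: measurable_shift_integral.
have T10 s : (0 <= T1 s)%E by apply: integral_ge0 => t _; exact: mule_ge0.
pose T2 (s : R) := (\int[mu]_t (e t * T1 (s + t)%R))%E.
have mT2 : measurable_fun setT T2 by exact: measurable_shift_integral.
have T20 s : (0 <= T2 s)%E by apply: integral_ge0 => t _; exact: mule_ge0.
pose k_ m (y : R) := (pois l m y)%:E.
have mk m : measurable_fun setT (k_ m) by apply/measurable_EFinP; exact: measurable_pois.
have k0 m y : (0 <= k_ m y)%E by rewrite lee_fin pois_ge0// ltW.
pose A m := (\int[mu]_y (pois l m y * P y)%:E)%E.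
have A0 m : (0 <= A m)%E by apply: integral_ge0 => y _; rewrite lee_fin mulr_ge0// pois_ge0// ltW.
have Afin m : (n <= m)%N -> A m \is a fin_num by move=> nm; rewrite ge0_fin_numE// fin.
have AE m : A m = (\int[mu]_y (k_ m y * pE y))%E by apply: eq_integral => y _; rewrite EFinM.
have lstep m (p : R -> \bar R) : measurable_fun setT p -> (forall y, (0 <= p y)%E) ->
    (\int[mu]_s (k_ m s * \int[mu]_t (e t * p (s + t)%R)) =
     (l^-1)%:E * \int[mu]_y (k_ m.+1 y * p y))%E.
  move=> mp p0; rewrite tonelli_convolution//.
  rewrite -ge0_integralZl//; last by rewrite lee_fin invr_ge0 ltW.
  - by apply: eq_integral => y _; rewrite pois_convolution// EFinM muleA.
  - by apply: emeasurable_funM => //; exact: mk.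
  - by move=> y _; rewrite mule_ge0.
have E1 : (\int[mu]_s (k_ n s * T1 s) = (l^-1)%:E * A n.+1)%E by rewrite lstep// AE.
have E2 : (\int[mu]_s (k_ n s * T2 s) = (l^-1)%:E * ((l^-1)%:E * A n.+2))%E.
  by rewrite lstep// lstep// AE.
(* Both sides are double integrals with the same weights, and [four_point] compares
   [P (s + r) * P (s + t)] with [P s * P (s + t + r)]. *)
have pw s : 0 < s -> (T1 s * T1 s <= (P s)%:E * T2 s)%E.
  move=> s0.
  have mpEs (w : R) : measurable_fun setT (fun t : R => pE (w + t)).
    by apply: measurableT_comp => //; apply: measurable_funD => //; exact: measurable_cst.
  have mT1s (w : R) : measurable_fun setT (fun t : R => T1 (w + t)).
    by apply: measurableT_comp => //; apply: measurable_funD => //; exact: measurable_cst.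
  have meps (w : R) : measurable_fun setT (fun t : R => (e t * pE (w + t)%R)%E) by apply: emeasurable_funM.
  have -> : (T1 s * T1 s = \int[mu]_t (e t * (pE (s + t)%R * T1 s)))%E.
    rewrite {1}/T1 -ge0_integralZr; [|by []|exact: meps|by move=> t _; rewrite mule_ge0|exact: T10].
    by apply: eq_integral => t _; rewrite muleA.
  rewrite /T2 -ge0_integralZl; [|by []|by apply: emeasurable_funM => //; exact: mT1s|by move=> t _; rewrite mule_ge0|by rewrite lee_fin].
  apply: ge0_le_integral => //.
  - by move=> t _; rewrite !mule_ge0.
  - by apply: emeasurable_funM; [exact: me|apply: emeasurable_funM; [exact: mpEs|exact: measurable_cst]].
  - by apply: emeasurable_funM; [exact: measurable_cst|apply: emeasurable_funM; [exact: me|exact: mT1s]].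
  move=> t _; rewrite [leRHS]muleCA; have [t0|t0] := leP t 0.
    by rewrite /e /exp_pos ltNge t0/= !mul0e.
  apply: lee_wpmul2l => //.
  rewrite /T1 -ge0_integralZl; [|by []|exact: meps|by move=> r _; rewrite mule_ge0|exact: pE0].
  rewrite -ge0_integralZl; [|by []|exact: meps|by move=> r _; rewrite mule_ge0|by rewrite lee_fin].
  apply: ge0_le_integral => //.
  - by move=> r _; rewrite !mule_ge0.
  - by apply: emeasurable_funM; [exact: measurable_cst|exact: meps].
  - by apply: emeasurable_funM; [exact: measurable_cst|exact: meps].
  move=> r _; rewrite muleCA [leRHS]muleCA; have [r0|r0] := leP r 0.
    by rewrite /e /exp_pos ltNge r0/= !mul0e.
  apply: lee_wpmul2l => //.
  by rewrite -!EFinM lee_fin fP.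
have am s k : 0 < s -> 0 < k -> (2%:E * T1 s <= k%:E * pE s + (k^-1)%:E * T2 s)%E.
  move=> s0 kp; have := pw s s0; have := T20 s.
  case: (T2 s) => [t2| |]//; last first.
    by move=> _ _; rewrite gt0_muley ?lte_fin ?invr_gt0// addeC /= leey.
  rewrite lee_fin => t20; have := T10 s; case: (T1 s) => [t1| |]//.
  rewrite lee_fin => t10; rewrite -!EFinM lee_fin => H.
  by rewrite /pE -?EFinM -?EFinD lee_fin; exact: le_amgm.
have main k : 0 < k -> (2%:E * ((l^-1)%:E * A n.+1) <=
    k%:E * A n + k^-1%:E * ((l^-1)%:E * ((l^-1)%:E * A n.+2)))%E.
  move=> kp; have kv : (0 <= (k^-1)%:E)%E by rewrite lee_fin invr_ge0 ltW.
  have kv' : (0 <= k%:E)%E by rewrite lee_fin ltW.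
  have mkp : measurable_fun setT (fun s => k_ n s * pE s)%E by exact: emeasurable_funM.
  have mk1 : measurable_fun setT (fun s => k_ n s * T1 s)%E by exact: emeasurable_funM.
  have mk2 : measurable_fun setT (fun s => k_ n s * T2 s)%E by exact: emeasurable_funM.
  rewrite -E1 -E2 (AE n) -!ge0_integralZl//; try (by move=> s _; rewrite mule_ge0).
  rewrite -ge0_integralD//; last 4 first.
  - by move=> s _; rewrite !mule_ge0.
  - by apply: emeasurable_funM; [exact: measurable_cst|].
  - by move=> s _; rewrite !mule_ge0.
  - by apply: emeasurable_funM => //; exact: measurable_cst.
  apply: ge0_le_integral => //.
  - by move=> s _; rewrite !mule_ge0.
  - by apply: emeasurable_funM => //; exact: measurable_cst.
  - by apply: emeasurable_funD; apply: emeasurable_funM => //; exact: measurable_cst.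
  move=> s _; have [s0|s0] := leP s 0.
    by rewrite /k_ /pois ltNge s0/= !mul0e !mule0 adde0.
  rewrite muleCA [in leRHS]muleCA [X in (_ <= _ + X)%E]muleCA -ge0_muleDr ?mule_ge0//.
  by apply: lee_wpmul2l => //; exact: am.
have H : (l^-1 * fine (A n.+1)) ^+ 2 <= fine (A n) * (l^-1 * (l^-1 * fine (A n.+2))).
  have li0 : 0 <= l^-1 by rewrite invr_ge0 ltW.
  apply: amgm_le; rewrite ?mulr_ge0 ?fine_ge0//; try exact: A0.
  move=> k kp; rewrite -lee_fin EFinD !EFinM !fineK; first exact: main.
  - by apply: Afin; lia.
  - exact: Afin.
  - by apply: Afin; lia.
have l2 : 0 < l^-1 ^+ 2 by rewrite exprn_gt0// invr_gt0.
by rewrite -(ler_pM2l l2); move: H; rewrite exprMn; lra.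
Qed.

End log_convexity.

(** * Tails of the Levy measure and the renewal equation *)

Section shift_transform.
Context (R : realType).
Local Notation mu := (@lebesgue_measure R).
Implicit Types (p : R -> \bar R) (k x y : R).

(** The resolvent at [k] of the translation semigroup; [k = 0] gives the tail integral. *)
Definition shift_transform k p x : \bar R :=
  (\int[mu]_t ((exp_pos k t)%:E * p (x + t)%R))%E.

Lemma measurable_EFin_exp_pos k : measurable_fun setT (fun t : R => (exp_pos k t)%:E).
Proof. by apply/measurable_EFinP; exact: measurable_exp_pos. Qed.

Lemma EFin_exp_pos_ge0 k x : (0 <= (exp_pos k x)%:E)%E.
Proof. by rewrite lee_fin exp_pos_ge0. Qed.

Lemma measurable_translate p x : measurable_fun setT p ->
  measurable_fun setT (fun t : R => p (x + t)).
Proof.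
by move=> mp; apply: measurableT_comp => //; exact: measurable_funD.
Qed.

Lemma measurable_shift_transform k p : measurable_fun setT p ->
  (forall x, (0 <= p x)%E) -> measurable_fun setT (shift_transform k p).
Proof.
move=> mp p0; apply: measurable_shift_integral => //; first exact: measurable_EFin_exp_pos.
by move=> x; exact: EFin_exp_pos_ge0.
Qed.

Lemma shift_transform_ge0 k p x : (forall x, (0 <= p x)%E) -> (0 <= shift_transform k p x)%E.
Proof. by move=> p0; apply: integral_ge0 => t _; rewrite mule_ge0 ?EFin_exp_pos_ge0. Qed.

Lemma measurable_shift_integrand k p x : measurable_fun setT p ->
  measurable_fun setT (fun t : R => ((exp_pos k t)%:E * p (x + t)%R)%E).
Proof.
by move=> mp; apply: emeasurable_funM; [exact: measurable_EFin_exp_pos|exact: measurable_translate].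
Qed.

(** Resolvents commute, by Tonelli. Thus the smoothed tail is also the tail of the smoothed
    density. *)
Lemma shift_transformC a c p x : measurable_fun setT p -> (forall x, (0 <= p x)%E) ->
  shift_transform a (shift_transform c p) x = shift_transform c (shift_transform a p) x.
Proof.
move=> mp p0.
pose F b d (z : R * R) := ((exp_pos b z.1)%:E * ((exp_pos d z.2)%:E * p (x + z.1 + z.2)%R))%E.
have E b d : shift_transform b (shift_transform d p) x = (\int[mu]_s \int[mu]_t F b d (s, t))%E.
  apply: eq_integral => s _; rewrite /shift_transform -ge0_integralZl//.
  - exact: measurable_shift_integrand.
  - by move=> t _; rewrite mule_ge0 ?EFin_exp_pos_ge0.
  - exact: EFin_exp_pos_ge0.
have mF b d : measurable_fun setT (F b d).
  apply: emeasurable_funM.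
    by apply: (measurableT_comp (measurable_EFin_exp_pos b)).
  apply: emeasurable_funM; first by apply: (measurableT_comp (measurable_EFin_exp_pos d)).
  by apply: measurableT_comp => //; apply: measurable_funD => //; exact: measurable_funD.
have F0 b d z : (0 <= F b d z)%E by rewrite !mule_ge0 ?EFin_exp_pos_ge0.
rewrite (E a c) (E c a).
transitivity (\int[mu]_t \int[mu]_s F a c (s, t))%E.
  exact: (@fubini_tonelli _ _ _ _ _ mu mu (F a c) (mF a c) (F0 a c)).
apply: eq_integral => t _; apply: eq_integral => s _.
by rewrite /F/= muleCA (addrAC x).
Qed.

Lemma le_shift_transform k p x y : measurable_fun setT p -> (forall x, (0 <= p x)%E) ->
  (forall x y, 0 < x -> x <= y -> (p y <= p x)%E) -> 0 < x -> x <= y ->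
  (shift_transform k p y <= shift_transform k p x)%E.
Proof.
move=> mp p0 dp x0 xy; apply: ge0_le_integral => //.
- by move=> t _; rewrite mule_ge0 ?EFin_exp_pos_ge0.
- exact: measurable_shift_integrand.
- exact: measurable_shift_integrand.
move=> t _; have [t0|t0] := leP t 0.
  by rewrite /exp_pos ltNge t0/= !mul0e.
apply: lee_wpmul2l; first exact: EFin_exp_pos_ge0.
by apply: dp; rewrite ?addr_gt0// lerD2r.
Qed.

Lemma shift_transform_le k p x : measurable_fun setT p -> (forall x, (0 <= p x)%E) ->
  (forall x y, 0 < x -> x <= y -> (p y <= p x)%E) -> 0 < x -> 0 < k ->
  (shift_transform k p x <= (k^-1)%:E * p x)%E.
Proof.
move=> mp p0 dp x0 k0.
rewrite -(integral_exp_pos k0) -ge0_integralZr//; last 2 first.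
- exact: measurable_EFin_exp_pos.
- by move=> t _; exact: EFin_exp_pos_ge0.
apply: ge0_le_integral => //.
- by move=> t _; rewrite mule_ge0 ?EFin_exp_pos_ge0.
- exact: measurable_shift_integrand.
- by apply: emeasurable_funM; [exact: measurable_EFin_exp_pos|exact: measurable_cst].
move=> t _; have [t0|t0] := leP t 0.
  by rewrite /exp_pos ltNge t0/= !mul0e.
apply: lee_wpmul2l; first exact: EFin_exp_pos_ge0.
by apply: dp => //; rewrite lerDl ltW.
Qed.

Lemma shift_transform_gt0 k p x : measurable_fun setT p -> (forall x, (0 <= p x)%E) ->
  (forall x, 0 < x -> (0 < p x)%E) -> 0 < x -> (0 < shift_transform k p x)%E.
Proof.
move=> mp p0 pp x0; apply: integral_gt0.
- exact: measurable_shift_integrand.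
- by move=> t; rewrite mule_ge0 ?EFin_exp_pos_ge0.
- by move=> t t0; rewrite mule_gt0 ?pp ?addr_gt0// lte_fin /exp_pos t0 expR_gt0.
Qed.

(** Both smoothings are moved from [p] to the weight, which becomes the kernel of
    [laplace_exponent_difference]. *)
Lemma laplace_shift_transform2 a c p : measurable_fun setT p -> (forall x, (0 <= p x)%E) ->
  0 < c -> c < a ->
  (\int[mu]_x ((exp_pos a x)%:E * shift_transform c (shift_transform 0 p) x) =
   \int[mu]_x ((convex_kernel a c x)%:E * p x))%E.
Proof.
move=> mp p0 c0 ca; have a0 := lt_trans c0 ca.
have ac : a != c by rewrite gt_eqF.
have mt := measurable_shift_transform 0 mp p0.
have t0 x := shift_transform_ge0 0 x p0.
rewrite tonelli_convolution//; try exact: measurable_EFin_exp_pos; try exact: EFin_exp_pos_ge0.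
pose C (r : R) := if 0 < r then (expR (- (c * r)) - expR (- (a * r))) / (a - c) else 0.
have C0 r : 0 <= C r.
  rewrite /C; case: ifP => // r0; apply: divr_ge0; last by rewrite subr_ge0 ltW.
  by rewrite subr_ge0 ler_expR lerN2 ler_wpM2r ?ltW.
have mC : measurable_fun setT C.
  apply: measurable_fun_ifT; last exact: measurable_cst.
    exact: measurable_fun_ltr.
  apply: measurable_funM => //.
  have me (b : R) : measurable_fun setT (fun r : R => expR (- (b * r))).
    rewrite (_ : (fun r : R => _) = fun r => expR (- b * r)); first exact: measurable_expM.
    by apply/funext => r; rewrite mulNr.
  by apply: measurable_funB; exact: me.
transitivity (\int[mu]_r ((C r)%:E * shift_transform 0 p r))%E.
  by apply: eq_integral => r _; rewrite exp_pos_convolution.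
have mCE : measurable_fun setT (fun r : R => (C r)%:E) by apply/measurable_EFinP; exact: mC.
rewrite (tonelli_convolution mCE (measurable_EFin_exp_pos 0) mp _ (EFin_exp_pos_ge0 0) p0).
  by apply: eq_integral => r _; rewrite exp_pos_convolution2// gt_eqF.
by move=> r; rewrite lee_fin.
Qed.

(** Integration by parts: against a tail the weight turns into [pois_cdf], whose consecutive values
    differ by a Poisson weight. Differences of masses of a tail are therefore masses of its
    density. *)
Lemma pois_shift_transform0 l n p : measurable_fun setT p -> (forall x, (0 <= p x)%E) ->
  0 < l ->
  (\int[mu]_y ((pois l n y)%:E * shift_transform 0 p y) =
   \int[mu]_y ((pois l n.+1 y)%:E * shift_transform 0 p y) +
   (l^-1)%:E * \int[mu]_y ((pois l n.+1 y)%:E * p y))%E.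
Proof.
move=> mp p0 l0; have ln0 : l != 0 by rewrite gt_eqF.
have mk m : measurable_fun setT (fun y : R => (pois l m y)%:E).
  by apply/measurable_EFinP; exact: measurable_pois.
have k0 m y : (0 <= (pois l m y)%:E)%E by rewrite lee_fin pois_ge0// ltW.
have E m : (\int[mu]_y ((pois l m y)%:E * shift_transform 0 p y) =
    \int[mu]_y ((pois_cdf l m y)%:E * p y))%E.
  rewrite /shift_transform tonelli_convolution//.
  - by apply: eq_integral => r _; rewrite pois_cdf_convolution.
  - exact: measurable_EFin_exp_pos.
  - by move=> r; exact: EFin_exp_pos_ge0.
have c0 m y : (0 <= (pois_cdf l m y)%:E)%E.
  rewrite -pois_cdf_convolution//; apply: integral_ge0 => s _.
  by rewrite mule_ge0 ?EFin_exp_pos_ge0.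
have mc m : measurable_fun setT (fun y : R => (pois_cdf l m y)%:E).
  apply/measurable_EFinP; apply: measurable_fun_ifT; last exact: measurable_cst.
    by apply: measurable_fun_ltr; [exact: measurable_cst|exact: measurable_id].
  apply: measurable_funM; last exact: measurable_cst.
  apply: measurable_funB; first exact: measurable_cst.
  by apply: measurable_sum => i; exact: measurable_gamma_kernel.
rewrite !E -ge0_integralZl; [|by []|by apply: emeasurable_funM; [exact: mk|]|by move=> y _; rewrite mule_ge0|by rewrite lee_fin invr_ge0 ltW].
rewrite -ge0_integralD//.
- apply: eq_integral => y _; rewrite (pois_cdfS n y ln0) EFinD EFinM.
  by rewrite ge0_muleDl ?muleA// mule_ge0// lee_fin invr_ge0 ltW.
- by move=> y _; rewrite mule_ge0.
- by apply: emeasurable_funM; [exact: mc|].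
- by move=> y _; rewrite !mule_ge0// lee_fin invr_ge0 ltW.
- by apply: emeasurable_funM; [exact: measurable_cst|apply: emeasurable_funM; [exact: mk|]].
Qed.

End shift_transform.

(** * The tail of the Levy measure *)

Section tail_of_levy_measure.
Context (R : realType) (Pi : {measure set (measurableTypeR R) -> \bar R}) (pi : R -> R).
Hypotheses (hPi : levy_measure Pi) (hpi : positive_density Pi pi).
Local Notation mu := (@lebesgue_measure R).
Local Notation p := ((EFin \o pi) \_ `]0%R, +oo[).

Lemma densityE x : 0 < x -> p x = (pi x)%:E.
Proof. by move=> x0; rewrite patchE mem_set//= in_itv/= x0. Qed.

Lemma shift_transform0E x : 0 < x ->
  (shift_transform 0 p x = \int[mu]_(s in `]x, +oo[) (pi s)%:E)%E.
Proof.
move=> x0; have mp := measurable_density hpi; have p0 := density_ge0 hpi.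
rewrite [RHS]integral_mkcond -(@integral_translate _ _ x); last 2 first.
- apply/(measurable_restrictT _ _).1 => //; case: hpi => mpi _ _.
  apply/measurable_EFinP; apply: measurable_funS mpi => //.
  by move=> s /=; rewrite !in_itv/= !andbT; exact: lt_trans.
- move=> s; rewrite patchE; case: ifPn => //; rewrite inE/= in_itv/= andbT => xs.
  by case: hpi => _ pi0 _; rewrite lee_fin ltW// pi0// (lt_trans x0).
apply: eq_integral => t _; rewrite /exp_pos [RHS]patchE mem_setE in_itv/= andbT ltrDl.
case: ifPn => t0; last by rewrite mul0e.
by rewrite mul0r oppr0 expR0 mul1e densityE// addr_gt0.
Qed.

(** Markov's inequality: beyond [x] the integrand of the Levy condition is at least [m > 0]. *)
Lemma levy_tail_fin x : 0 < x -> (Pi `]x, +oo[%classic < +oo)%E.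
Proof.
move=> x0; pose m := Num.min 1 (x ^+ 2).
have m0 : 0 < m by rewrite /m lt_min ltr01 exprn_gt0.
have mD : measurable (`]x, +oo[%classic : set (measurableTypeR R)) by exact: measurable_itv.
have : (m%:E * Pi `]x, +oo[%classic < +oo)%E.
  case: hPi => _; apply: le_lt_trans; rewrite -integral_cst//.
  apply: (@le_trans _ _ (\int[Pi]_(y in `]x, +oo[) (Num.min 1 (y ^+ 2))%:E)%E).
    apply: ge0_le_integral => //.
    - by move=> y _; rewrite lee_fin ltW.
    - apply/measurable_EFinP; apply: measurable_funTS; apply: measurable_minr.
        exact: measurable_cst.
      exact: exprn_measurable.
    - move=> y /=; rewrite in_itv/= andbT => xy; rewrite lee_fin /m.
      rewrite le_min !ge_min lexx/= lerXn2r ?orbT// ?nnegrE ?ltW//.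
      exact: lt_trans xy.
  apply: ge0_subset_integral => //.
  - apply/measurable_EFinP; apply: measurable_funTS; apply: measurable_minr.
      exact: measurable_cst.
    exact: exprn_measurable.
  - by move=> y _; rewrite lee_fin le_min ler01 sqr_ge0.
  - by move=> y /=; rewrite !in_itv/= !andbT; exact: lt_trans.
rewrite !ltey; apply: contraNN => /eqP ->.
by rewrite gt0_muley.
Qed.

Lemma tailE x : 0 < x -> shift_transform 0 p x = (tail pi x)%:E.
Proof.
move=> x0; rewrite shift_transform0E// /tail /Rintegral fineK//.
case: (hpi) => _ pi0 PiE; rewrite -PiE//.
- rewrite ge0_fin_numE//; exact: levy_tail_fin.
- by move=> y /=; rewrite !in_itv/= !andbT; exact: lt_trans.
Qed.

Lemma tail_gt0 x : 0 < x -> 0 < tail pi x.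
Proof.
move=> x0; rewrite -lte_fin -tailE//.
apply: shift_transform_gt0 => //; [exact: measurable_density hpi|exact: density_ge0 hpi|].
by move=> y y0; rewrite densityE// lte_fin; case: hpi => _ pi0 _; exact: pi0.
Qed.

(** Translated back, the two tails integrate the same [p] over nested half-lines. *)
Lemma le_shift_transform0 x y : x <= y ->
  (shift_transform 0 p y <= shift_transform 0 p x)%E.
Proof.
move=> xy; have mp := measurable_density hpi; have p0 := density_ge0 hpi.
have me (w : R) : measurable_fun setT (fun s : R => ((exp_pos 0 (s - w))%:E * p s)%E).
  apply: emeasurable_funM => //; apply/measurable_EFinP.
  apply: measurableT_comp; first exact: measurable_exp_pos.
  exact: measurable_funB.
have E w : (shift_transform 0 p w = \int[mu]_s ((exp_pos 0 (s - w))%:E * p s))%E.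
  rewrite -[RHS](@integral_translate _ _ w).
  - by apply: eq_integral => t _; rewrite addrAC subrr add0r.
  - exact: me.
  - by move=> s; rewrite mule_ge0 ?EFin_exp_pos_ge0.
rewrite (E x) (E y); apply: ge0_le_integral => //.
- by move=> s _; rewrite mule_ge0 ?EFin_exp_pos_ge0.
- exact: me.
- exact: me.
- move=> s _; apply: lee_wpmul2r => //; rewrite lee_fin /exp_pos !mul0r oppr0 expR0.
  case: ifPn => [ys|_]; last by case: ifP.
  by rewrite ifT// (lt_le_trans ys)// lerD2l lerN2.
Qed.

End tail_of_levy_measure.

(** * Poisson masses and the renewal equation *)

Section pois_moments.
Context (R : realType).
Local Notation mu := (@lebesgue_measure R).
Implicit Types (f g W V : R -> R) (l z c b : R) (n : nat).

Definition pmass l f n : R := fine (\int[mu]_y (pois l n y * f y)%:E)%E.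

Lemma pmass_ge0 l f n : 0 <= l -> (forall y, 0 <= f y) -> 0 <= pmass l f n.
Proof.
by move=> l0 f0; apply: fine_ge0; apply: integral_ge0 => y _; rewrite lee_fin mulr_ge0 ?pois_ge0.
Qed.

Lemma pois_series l z f : 0 <= l -> 0 <= z -> measurable_fun setT f -> (forall y, 0 <= f y) ->
  (\int[mu]_y (exp_pos (l * (1 - z)) y * f y)%:E =
   \sum_(n <oo) ((z ^+ n)%:E * \int[mu]_y (pois l n y * f y)%:E))%E.
Proof.
move=> l0 z0 mf f0.
have mE : measurable_fun setT (EFin \o f) by exact/measurable_EFinP.
have fE x : (0 <= (EFin \o f) x)%E by rewrite lee_fin.
have H := @laplace_pois R l z (EFin \o f) l0 z0 mE fE.
transitivity (\int[mu]_x ((exp_pos (l * (1 - z)) x)%:E * (EFin \o f) x))%E.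
  by apply: eq_integral => y _; rewrite EFinM.
by rewrite H; apply: eq_eseriesr => n _; congr (_ * _)%E.
Qed.

(** Up to the factor [z ^+ n], a mass is one term of a nonnegative series with finite sum. *)
Lemma pmass_fin l z f n : 0 <= l -> 0 < z -> measurable_fun setT f -> (forall y, 0 <= f y) ->
  (\int[mu]_y (exp_pos (l * (1 - z)) y * f y)%:E < +oo)%E ->
  (\int[mu]_y (pois l n y * f y)%:E < +oo)%E.
Proof.
move=> l0 z0 mf f0; rewrite (pois_series l0 (ltW z0) mf f0) => fin.
have i0 m : (0 <= \int[mu]_y (pois l m y * f y)%:E)%E.
  by apply: integral_ge0 => y _; rewrite lee_fin mulr_ge0 ?pois_ge0.
have t0 m : (0 <= (z ^+ m)%:E * \int[mu]_y (pois l m y * f y)%:E)%E.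
  by rewrite mule_ge0// lee_fin exprn_ge0// ltW.
have : ((z ^+ n)%:E * \int[mu]_y (pois l n y * f y)%:E < +oo)%E.
  apply: le_lt_trans fin; rewrite (@nneseriesD1 _ _ n)//= leeDl//.
  by apply: nneseries_ge0 => m _ _.
rewrite !ltey; apply: contraNN => /eqP ->.
by rewrite gt0_muley// lte_fin exprn_gt0.
Qed.

Lemma psum_pmass l z f : 0 <= l -> 0 <= z -> measurable_fun setT f -> (forall y, 0 <= f y) ->
  (forall n, \int[mu]_y (pois l n y * f y)%:E < +oo)%E ->
  psum (pmass l f) z = (\int[mu]_y (exp_pos (l * (1 - z)) y * f y)%:E)%E.
Proof.
move=> l0 z0 mf f0 fin; rewrite pois_series//; apply: eq_eseriesr => n _.
rewrite mulrC EFinM fineK// ge0_fin_numE//.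
by apply: integral_ge0 => y _; rewrite lee_fin mulr_ge0 ?pois_ge0.
Qed.

Lemma psumD (a b : nat -> R) z : (forall n, 0 <= a n) -> (forall n, 0 <= b n) -> 0 <= z ->
  psum (fun n => a n + b n) z = (psum a z + psum b z)%E.
Proof.
move=> a0 b0 z0; rewrite /psum -nneseriesD//; last 2 first.
- by move=> n _; rewrite psum_term_ge0.
- by move=> n _; rewrite psum_term_ge0.
by apply: eq_eseriesr => n _; rewrite mulrDl EFinD.
Qed.

Lemma psumZ (a : nat -> R) k z : (forall n, 0 <= a n) -> 0 <= z ->
  psum (fun n => k * a n) z = (k%:E * psum a z)%E.
Proof.
move=> a0 z0; rewrite /psum -nneseriesZl//; last by move=> n _; rewrite psum_term_ge0.
by apply: eq_eseriesr => n _; rewrite -EFinM mulrA.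
Qed.

Lemma psum_cst_inv l z : 0 < l -> 0 <= z -> z < 1 -> psum (fun=> l^-1) z = ((l * (1 - z))^-1)%:E.
Proof.
move=> l0 z0 z1; have th0 : 0 < l * (1 - z) by rewrite mulr_gt0// subr_gt0.
have := @pois_series l z (fun=> 1) (ltW l0) z0 (measurable_cst _) (fun=> ler01).
under eq_integral do rewrite mulr1.
rewrite integral_exp_pos// => ->; apply: eq_eseriesr => n _.
by under eq_integral do rewrite mulr1; rewrite integral_pois// mulrC EFinM.
Qed.

(** The Gaussian part [b] acts as an atom at the origin, which feeds index 0 only. *)
Definition first_mass (b : R) (m : nat -> R) n : R := (if n == 0%N then b else 0) + m n.

(** The coefficients of [th - c = (l - c) - l * z] times the generating function of [w]. *)
Definition tilted_difference l c (w : nat -> R) n : R :=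
  (l - c) * w n - (if n is n'.+1 then l * w n' else 0).

(* The factor [K] cancels: the masses of [W] and [V] (the latter with [b] added)
   convolve to a sequence with generating function [1 / (th (th - c))] at
   [th = l (1 - z)], and the tilted difference removes the factor [th - c]. *)
Lemma renewal_identity l c b W V (K : R -> R) : 0 < c -> c < l -> 0 <= b ->
  measurable_fun setT W -> (forall y, 0 <= W y) ->
  measurable_fun setT V -> (forall y, 0 <= V y) ->
  (forall th, c < th -> K th != 0) ->
  (forall th, c < th -> (\int[mu]_y (exp_pos th y * W y)%:E = ((K th)^-1)%:E)%E) ->
  (forall th, c < th ->
     (\int[mu]_y (exp_pos th y * V y)%:E = (K th / (th * (th - c)) - b)%:E)%E) ->
  forall n, \sum_(k < n.+1) tilted_difference l c (pmass l W) k *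
    first_mass b (pmass l V) (n - k)%N = l^-1.
Proof.
move=> c0 cl b0 mW W0 mV V0 K0 LW LV.
have l0 : 0 < l := lt_trans c0 cl.
have l0' := ltW l0.
(* [z < z0] is exactly [c < l * (1 - z)]. *)
pose z0 := 1 - c / l.
have z00 : 0 < z0 by rewrite /z0 subr_gt0 ltr_pdivrMr// mul1r.
have z01 : z0 < 1 by rewrite /z0 gtrBl divr_gt0.
have thz z : 0 < z < z0 -> c < l * (1 - z) /\ z < 1.
  move=> /andP[zp zz]; split; last exact: lt_trans z01.
  have : l * z < l * z0 by rewrite ltr_pM2l.
  by rewrite /z0 !mulrBr mulr1 mulrCA mulfV ?gt_eqF// mulr1; lra.
have zh : 0 < z0 / 2 < z0 by lra.
have finW n : (\int[mu]_y (pois l n y * W y)%:E < +oo)%E.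
  case/andP: (zh) => zh0 _; apply: (pmass_fin n l0' zh0 mW W0).
  by rewrite LW ?ltry//; case: (thz _ zh).
have finV n : (\int[mu]_y (pois l n y * V y)%:E < +oo)%E.
  case/andP: (zh) => zh0 _; apply: (pmass_fin n l0' zh0 mV V0).
  by rewrite LV ?ltry//; case: (thz _ zh).
set w := pmass l W; set a := first_mass b (pmass l V).
have w0 n : 0 <= w n by exact: pmass_ge0.
have v0 n : 0 <= pmass l V n by exact: pmass_ge0.
have a0 n : 0 <= a n by rewrite /a /first_mass addr_ge0//; case: ifP.
pose e n := \sum_(k < n.+1) w k * a (n - k)%N.
have e0 n : 0 <= e n by apply: sumr_ge0 => k _; exact: mulr_ge0.
have psw z : 0 < z < z0 -> psum w z = ((K (l * (1 - z)))^-1)%:E.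
  move=> zz; have [cth _] := thz _ zz; case/andP: zz => zp _.
  by rewrite psum_pmass ?LW// ltW.
have psa z : 0 < z < z0 -> psum a z = (K (l * (1 - z)) / (l * (1 - z) * (l * (1 - z) - c)))%:E.
  move=> zz; have [cth _] := thz _ zz; case/andP: zz => zp _.
  have zp' := ltW zp.
  have := psum_pmass l0' zp' mV V0 finV; rewrite LV// (psum_recl v0 zp') => E.
  rewrite (psum_recl a0 zp').
  rewrite (_ : psum (fun n => a n.+1) z = psum (fun n => pmass l V n.+1) z); last first.
    by apply: eq_eseriesr => n _; rewrite /a /first_mass/= add0r.
  by rewrite {1}/a /first_mass/= EFinD -addeA E -EFinD; congr EFin; ring.
have pse z : 0 < z < z0 -> psum e z = ((l * (1 - z) * (l * (1 - z) - c))^-1)%:E.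
  move=> zz; have [cth _] := thz _ zz; case/andP: (zz) => zp _.
  rewrite /e -psum_cauchy ?(ltW zp)//; last by rewrite psa// ltry.
  by rewrite psw// psa// -EFinM; congr EFin; rewrite mulKf// K0.
pose e1 n := if n is n'.+1 then l * e n' else 0.
have e10 n : 0 <= e1 n by case: n => [//|n]; rewrite /e1 mulr_ge0.
have lc0 : 0 <= l - c by rewrite subr_ge0 ltW.
(* The negative term of the tilted difference is put on the other side, since [psum_unique] compares
   nonnegative coefficients. *)
have key : forall n, (l - c) * e n = e1 n + l^-1.
  apply: (@psum_unique _ _ _ z0) => //.
  - by move=> n; rewrite mulr_ge0.
  - by move=> n; rewrite addr_ge0// invr_ge0.
  move=> z zz; have [cth z1] := thz _ zz; case/andP: (zz) => zp _; have zp' := ltW zp.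
  rewrite psumZ// pse// -EFinM ltry; split=> //.
  rewrite psumD//; last by move=> n; rewrite invr_ge0.
  rewrite psum_cst_inv// (psum_recl e10 zp') {1}/e1 add0e psumZ// pse// -!EFinM -EFinD.
  have th0 : l * (1 - z) != 0 by rewrite gt_eqF// (lt_trans c0).
  have thc : l * (1 - z) - c != 0 by rewrite subr_eq0 gt_eqF.
  have z1' : 1 - z != 0 by rewrite subr_eq0 eq_sym lt_eqF.
  have l0n : l != 0 by rewrite gt_eqF.
  by congr EFin; move: thc z1' l0n; clear => thc z1' l0n; field; rewrite thc z1' l0n.
move=> n.
have -> : \sum_(k < n.+1) tilted_difference l c w k * a (n - k)%N = (l - c) * e n - e1 n.
  under eq_bigr => k _ do rewrite /tilted_difference mulrBl.
  rewrite sumrB; congr (_ - _).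
    by rewrite /e mulr_sumr; apply: eq_bigr => k _; rewrite mulrA.
  case: n => [|n]; first by rewrite big_ord1 mul0r.
  rewrite big_ord_recl/= mul0r add0r /e mulr_sumr; apply: eq_bigr => k _.
  by rewrite /bump/= mulrA.
by rewrite key addrAC subrr add0r.
Qed.

End pois_moments.

Section fine_on_positives.
Context (R : realType).
Local Notation mu := (@lebesgue_measure R).
Implicit Types (p : R -> \bar R).

Lemma integral_fine_pois l n p : (forall x, 0 < x -> p x \is a fin_num) ->
  (\int[mu]_y (pois l n y * fine (p y))%:E = \int[mu]_y ((pois l n y)%:E * p y))%E.
Proof.
move=> pf; apply: eq_integral => y _; rewrite EFinM /pois.
by case: ifP => y0; [rewrite fineK// pf|rewrite !mul0e].
Qed.

End fine_on_positives.

(** * The function [V] of the factorisation and its masses *)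

Section potential.
Context (R : realType).
Variables (gamma sigma : R) (Pi : {measure set (measurableTypeR R) -> \bar R}) (pi : R -> R).
Hypotheses (hPi : levy_measure Pi) (hpi : positive_density Pi pi).
Local Notation mu := (@lebesgue_measure R).
Local Notation psi := (laplace_exponent gamma sigma Pi).
Local Notation p := ((EFin \o pi) \_ `]0%R, +oo[).
Variables (c q : R).
Hypotheses (c0 : 0 < c) (q0 : 0 <= q) (psic : psi c = q).
Local Notation b := (2^-1 * sigma ^+ 2).
Local Notation tl := (shift_transform 0 p).
Local Notation V := (shift_transform c tl).
Local Notation v := (shift_transform c p).

Definition potential x : R := fine (V x) + q / c.

Let mp : measurable_fun setT p. Proof. exact: measurable_density hpi. Qed.
Let p0 x : (0 <= p x)%E. Proof. exact: density_ge0 hpi x. Qed.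
Let mtl : measurable_fun setT tl. Proof. exact: measurable_shift_transform. Qed.
Let tl0 x : (0 <= tl x)%E. Proof. exact: shift_transform_ge0. Qed.
Let mV : measurable_fun setT V. Proof. exact: measurable_shift_transform. Qed.
Let V0 x : (0 <= V x)%E. Proof. exact: shift_transform_ge0. Qed.
Let mv : measurable_fun setT v. Proof. exact: measurable_shift_transform. Qed.
Let v0 x : (0 <= v x)%E. Proof. exact: shift_transform_ge0. Qed.

Let le_tl x y : 0 < x -> x <= y -> (tl y <= tl x)%E.
Proof. by move=> _; exact: (le_shift_transform0 hpi). Qed.

Lemma shift_tail_fin x : 0 < x -> V x \is a fin_num.
Proof.
move=> x0; rewrite ge0_fin_numE//; apply: le_lt_trans (shift_transform_le mtl tl0 le_tl x0 c0) _.
by rewrite (tailE hPi hpi x0) -EFinM ltry.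
Qed.

Lemma shift_density_fin x : 0 < x -> v x \is a fin_num.
Proof.
move=> x0; rewrite ge0_fin_numE//; apply: (@le_lt_trans _ _ (tl x)).
  apply: ge0_le_integral => //.
  - by move=> t _; rewrite mule_ge0// EFin_exp_pos_ge0.
  - exact: measurable_shift_integrand.
  - exact: measurable_shift_integrand.
  move=> t _; apply: lee_wpmul2r => //; rewrite lee_fin /exp_pos; case: ifP => // t0.
  by rewrite ler_expR lerN2 mul0r mulr_ge0// ltW.
by rewrite (tailE hPi hpi x0) ltry.
Qed.

Lemma shift_tail_gt0 x : 0 < x -> 0 < fine (V x).
Proof.
move=> x0; rewrite fine_gt0//; apply/andP; split; last by rewrite -ge0_fin_numE// shift_tail_fin.
apply: (shift_transform_gt0 c mtl tl0 _ x0) => y y0.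
by rewrite (tailE hPi hpi y0) lte_fin (tail_gt0 hPi hpi).
Qed.

Lemma shift_density_gt0 x : 0 < x -> 0 < fine (v x).
Proof.
move=> x0; rewrite fine_gt0//; apply/andP; split; last by rewrite -ge0_fin_numE// shift_density_fin.
apply: (shift_transform_gt0 c mp p0 _ x0) => y y0.
by rewrite (densityE _ y0) lte_fin; case: hpi => _ + _; exact.
Qed.

Lemma measurable_potential : measurable_fun setT potential.
Proof.
apply: measurable_funD; last exact: measurable_cst.
exact: measurableT_comp.
Qed.

Let qc0 : 0 <= q / c. Proof. by rewrite divr_ge0// ltW. Qed.

Lemma potential_ge0 x : 0 <= potential x.
Proof. by rewrite addr_ge0// fine_ge0. Qed.

Lemma potential_gt0 x : 0 < x -> 0 < potential x.
Proof. by move=> x0; rewrite ltr_wpDr// shift_tail_gt0. Qed.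

Lemma shift_tail_nonincreasing x y : 0 < x -> x <= y -> fine (V y) <= fine (V x).
Proof.
move=> x0 xy; have y0 : 0 < y := lt_le_trans x0 xy.
by apply: (fine_le (shift_tail_fin y0) (shift_tail_fin x0)); exact: (le_shift_transform c mtl tl0 le_tl x0 xy).
Qed.

(** The kernel identity yields [psi a - a / c * q]; the transform [q / (c * a)] of the added
    constant corrects it to [psi a - q]. *)
Lemma laplace_potential a : c < a ->
  (\int[mu]_x (exp_pos a x * potential x)%:E = ((psi a - q) / (a * (a - c)) - b)%:E)%E.
Proof.
move=> ca; have a0 : 0 < a := lt_trans c0 ca.
have mf : measurable_fun setT (fun y => exp_pos a y * fine (V y)).
  by apply: measurable_funM; [exact: measurable_exp_pos|exact: measurableT_comp].
have H := @integral_lin2 R (fun y => exp_pos a y * fine (V y)) (exp_pos a) 1 (q / c) mf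
  (measurable_exp_pos a) _ (exp_pos_ge0 a) ler01 qc0.
transitivity (\int[mu]_y (1 * (exp_pos a y * fine (V y)) + q / c * exp_pos a y)%:E)%E.
  by apply: eq_integral => x _; congr EFin; rewrite /potential; ring.
rewrite H; last by move=> y; rewrite mulr_ge0 ?exp_pos_ge0// fine_ge0.
rewrite mul1e integral_exp_pos// -EFinM.
have -> : (\int[mu]_y (exp_pos a y * fine (V y))%:E = \int[mu]_y ((exp_pos a y)%:E * V y))%E.
  apply: eq_integral => y _; rewrite EFinM /exp_pos.
  by case: ifP => y0; [rewrite fineK// shift_tail_fin|rewrite !mul0e].
have L := @laplace_shift_transform2 R a c p mp p0 c0 ca.
rewrite L (laplace_exponent_difference gamma sigma hPi hpi c0 ca) psic -EFinD; congr EFin.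
have ac0 : a - c != 0 by rewrite subr_eq0 gt_eqF.
by field; rewrite ac0 !gt_eqF.
Qed.

Lemma shift_tail_log_convex : log_convex_on `]0, +oo[ (tail pi) ->
  log_convex_on `]0, +oo[ (fun x => fine (V x)).
Proof.
move=> lc.
apply: (@log_convex_integral R (tail pi) (exp_pos c) tl (fun x => fine (V x)) lc _ tl0 mtl
  (measurable_exp_pos c) (exp_pos_ge0 c)).
- by move=> x x0; exact: (tailE hPi hpi x0).
- by move=> t t0; rewrite /exp_pos ltNge t0.
- by move=> x x0; rewrite (fineK (shift_tail_fin x0)).
- exact: shift_tail_gt0.
Qed.

Section moments.
Variables (l : R).
Hypothesis cl : c < l.
Let l0 : 0 < l. Proof. exact: lt_trans cl. Qed.
Let l0' : 0 <= l. Proof. exact: ltW. Qed.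

Lemma pmass_potential_fin n : (\int[mu]_y (pois l n y * potential y)%:E < +oo)%E.
Proof.
(* This [z] evaluates the transform at [(l + c) / 2], which exceeds [c]. *)
pose z := (1 - c / l) / 2.
have cl1 : c / l < 1 by rewrite ltr_pdivrMr// mul1r.
have z0 : 0 < z by rewrite /z divr_gt0// subr_gt0.
apply: (pmass_fin n l0' z0 measurable_potential potential_ge0).
rewrite laplace_potential ?ltry//.
have -> : l * (1 - z) = (l + c) / 2 by rewrite /z; field; rewrite gt_eqF.
by rewrite ltr_pdivlMr// mulr_natr mulr2n ltrD2r.
Qed.

Lemma pmass_shift_tail_fin n : (\int[mu]_y (pois l n y * fine (V y))%:E < +oo)%E.
Proof.
apply: le_lt_trans (pmass_potential_fin n).
apply: le_integral_EFin.
- by apply: measurable_funM; [exact: measurable_pois|exact: measurableT_comp].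
- by apply: measurable_funM; [exact: measurable_pois|exact: measurable_potential].
- by move=> y; rewrite mulr_ge0 ?pois_ge0// fine_ge0.
by move=> y; rewrite ler_wpM2l ?pois_ge0// lerDl.
Qed.

Lemma pmass_potentialE n : pmass l potential n = pmass l (fun y => fine (V y)) n + q / c * l^-1.
Proof.
have mf : measurable_fun setT (fun y => pois l n y * fine (V y)).
  by apply: measurable_funM; [exact: measurable_pois|exact: measurableT_comp].
have H := @integral_lin2 R (fun y => pois l n y * fine (V y)) (pois l n) 1 (q / c) mf
  (measurable_pois l n) _ (fun y => pois_ge0 n y l0') ler01 qc0.
rewrite /pmass; transitivity (fine (\int[mu]_y (1 * (pois l n y * fine (V y)) + q / c * pois l n y)%:E)%E).
  by congr fine; apply: eq_integral => x _; congr EFin; rewrite /potential; ring.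
rewrite H; last by move=> y; rewrite mulr_ge0 ?pois_ge0// fine_ge0.
rewrite mul1e integral_pois// -EFinM fineD//.
rewrite ge0_fin_numE ?pmass_shift_tail_fin//.
by apply: integral_ge0 => y _; rewrite lee_fin mulr_ge0 ?pois_ge0// fine_ge0.
Qed.

(** Commuting the two smoothings shows [V] as the tail of [v], so integration by parts applies. *)
Lemma pmass_shift_tailS n : pmass l (fun y => fine (V y)) n =
  pmass l (fun y => fine (V y)) n.+1 + l^-1 * pmass l (fun y => fine (v y)) n.+1 /\
  (\int[mu]_y (pois l n.+1 y * fine (v y))%:E < +oo)%E.
Proof.
have fV x : shift_transform 0 v x = V x by exact: shift_transformC.
have E m : (\int[mu]_y ((pois l m y)%:E * shift_transform 0 v y) =
    \int[mu]_y (pois l m y * fine (V y))%:E)%E.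
  by rewrite (integral_fine_pois l m shift_tail_fin); apply: eq_integral => y _; rewrite fV.
have H : (\int[mu]_y (pois l n y * fine (V y))%:E = \int[mu]_y (pois l n.+1 y * fine (V y))%:E +
    (l^-1)%:E * \int[mu]_y (pois l n.+1 y * fine (v y))%:E)%E.
  rewrite (integral_fine_pois l n.+1 shift_density_fin).
  transitivity (\int[mu]_y ((pois l n y)%:E * shift_transform 0 v y))%E; first exact/esym/E.
  by rewrite -(E n.+1); exact: pois_shift_transform0.
have i0 m (f : R -> R) : (forall y, 0 <= f y) -> (0 <= \int[mu]_y (pois l m y * f y)%:E)%E.
  by move=> f0; apply: integral_ge0 => y _; rewrite lee_fin mulr_ge0 ?pois_ge0.
have f0 y : 0 <= fine (V y) by exact: fine_ge0.
have g0 y : 0 <= fine (v y) by exact: fine_ge0.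
have fin : (\int[mu]_y (pois l n.+1 y * fine (v y))%:E < +oo)%E.
  have := pmass_shift_tail_fin n; rewrite H !ltey; apply: contraNN => /eqP ->.
  rewrite gt0_muley ?lte_fin ?invr_gt0// addey// -ltNye.
  by apply: lt_le_trans (i0 _ _ f0).
split=> //; rewrite /pmass H fineD.
- by rewrite fineM// ge0_fin_numE// i0.
- by rewrite ge0_fin_numE; [exact: pmass_shift_tail_fin|exact: i0].
- by rewrite fin_numM// ge0_fin_numE// i0.
Qed.

Definition potential_mass n := first_mass b (pmass l potential) n.

(** The constant [q / c] has the same mass at every index and drops out, so the differences are
    governed by the smoothed density [v]. *)
Lemma potential_massB n : potential_mass n - potential_mass n.+1 =
  (if n == 0%N then b else 0) + l^-1 * pmass l (fun y => fine (v y)) n.+1.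
Proof.
rewrite /potential_mass /first_mass/= !pmass_potentialE (pmass_shift_tailS n).1.
have aux (x y z k : R) : x + (y + z + k) - (0 + (y + k)) = x + z by ring.
exact: aux.
Qed.

Lemma pmass_gt0 (f : R -> R) n : measurable_fun setT f -> (forall y, 0 <= f y) -> (forall y, 0 < y -> 0 < f y) ->
  (\int[mu]_y (pois l n y * f y)%:E < +oo)%E -> 0 < pmass l f n.
Proof.
move=> mf f0 fp fin; rewrite fine_gt0//; apply/andP; split=> //; apply: integral_gt0.
- by apply/measurable_EFinP; apply: measurable_funM => //; exact: measurable_pois.
- by move=> y; rewrite lee_fin mulr_ge0// pois_ge0.
- by move=> y y0; rewrite lte_fin mulr_gt0// ?fp// pois_gt0.
Qed.

Let b0 : 0 <= b. Proof. by rewrite mulr_ge0// sqr_ge0. Qed.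

Lemma potential_mass_gt0 n : 0 < potential_mass n.
Proof.
rewrite /potential_mass /first_mass ltr_wpDl//; first by case: ifP.
apply: pmass_gt0; [exact: measurable_potential|exact: potential_ge0|exact: potential_gt0|].
exact: pmass_potential_fin.
Qed.

Lemma potential_massB_gt0 n : 0 < potential_mass n - potential_mass n.+1.
Proof.
rewrite potential_massB ltr_wpDl//; first by case: ifP.
rewrite mulr_gt0 ?invr_gt0//; apply: pmass_gt0.
- exact: measurableT_comp.
- by move=> y; exact: fine_ge0.
- exact: shift_density_gt0.
- exact: (pmass_shift_tailS n).2.
Qed.

Lemma potential_mass_nonincreasing : nonincreasing_from_start potential_mass.
Proof. by move=> n; rewrite -subr_ge0 ltW// potential_massB_gt0. Qed.

(** The atom [b] occurs only in [a 0], which appears only on the larger side of the inequality. *)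
Lemma potential_mass_log_convex : log_convex_on `]0, +oo[ (tail pi) ->
  log_convex_seq potential_mass.
Proof.
move=> lc n.
have lV := shift_tail_log_convex lc.
have fp : four_point potential.
  exact: (@four_point_add_cst R _ (q / c) shift_tail_gt0 shift_tail_nonincreasing qc0
    (log_convex_four_point lV)).
have H := @pois_log_convex R potential l n l0 measurable_potential potential_ge0 fp
  (fun m _ => pmass_potential_fin m).
rewrite /potential_mass /first_mass/= !add0r (le_trans H)//.
rewrite ler_wpM2r ?pmass_ge0//; first exact: potential_ge0.
by rewrite lerDr; case: ifP.
Qed.

(** As for the masses themselves, with [v] for [V]: a mixture of translates of [pi] inherits its
    log-convexity, and [b] raises only the first difference. *)
Lemma potential_massB_log_convex : log_convex_on `]0, +oo[ pi ->
  log_convex_seq (fun n => potential_mass n - potential_mass n.+1).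
Proof.
move=> lc n.
have lv : log_convex_on `]0, +oo[ (fun x => fine (v x)).
  apply: (@log_convex_integral R pi (exp_pos c) p (fun x => fine (v x)) lc _ p0 mp
    (measurable_exp_pos c) (exp_pos_ge0 c)).
  - by move=> x x0; exact: densityE.
  - by move=> t t0; rewrite /exp_pos ltNge t0.
  - by move=> x x0; rewrite (fineK (shift_density_fin x0)).
  - exact: shift_density_gt0.
have mvf : measurable_fun setT (fun x => fine (v x)) by exact: measurableT_comp.
have fv0 y : 0 <= fine (v y) by exact: fine_ge0.
have H : pmass l (fun y => fine (v y)) n.+2 ^+ 2 <=
    pmass l (fun y => fine (v y)) n.+1 * pmass l (fun y => fine (v y)) n.+3.
  have fin m : (n.+1 <= m)%N ->
      (\int[mu]_y (pois l m y * fine (v y))%:E < +oo)%E.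
    by case: m => // m _; exact: (pmass_shift_tailS m).2.
  exact: (@pois_log_convex R _ l n.+1 l0 mvf fv0 (log_convex_four_point lv) fin).
rewrite !potential_massB/= !add0r.
have m0 k : 0 <= pmass l (fun y => fine (v y)) k by exact: pmass_ge0.
have il : 0 <= l^-1 by rewrite invr_ge0.
apply: (@le_trans _ _ ((l^-1 * pmass l (fun y => fine (v y)) n.+1) * (l^-1 * pmass l (fun y => fine (v y)) n.+3))).
  rewrite exprMn [leRHS]mulrACA -[X in _ <= X * _]expr2.
  by apply: ler_wpM2l H; exact: sqr_ge0.
by rewrite ler_wpM2r ?mulr_ge0// lerDr; case: ifP.
Qed.

End moments.

End potential.

(** * The inverse of the Laplace exponent *)

Section inverse_of_convex.
Context (R : realType).
Variable f : R -> R.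
Hypotheses (f0 : f 0 = 0)
  (cf : forall t a c, 0 <= t -> t <= 1 -> 0 <= a -> 0 <= c ->
    f (t * a + (1 - t) * c) <= t * f a + (1 - t) * f c)
  (pos : exists2 th, 0 < th & 0 < f th).
Local Notation r := (Phi0 f).

Lemma convex_chord x y z : 0 <= x -> x <= y -> y <= z ->
  (z - x) * f y <= (z - y) * f x + (y - x) * f z.
Proof.
move=> x0 xy; rewrite le_eqVlt => /predU1P[<-|yz]; first by rewrite subrr mul0r add0r.
have zx : 0 < z - x by lra.
have t0 : 0 <= (z - y) / (z - x) by rewrite divr_ge0//; lra.
have t1 : (z - y) / (z - x) <= 1 by rewrite ler_pdivrMr//; lra.
have z0 : 0 <= z by lra.
have := cf t0 t1 x0 z0.
have -> : (z - y) / (z - x) * x + (1 - (z - y) / (z - x)) * z = y.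
  by field; rewrite gt_eqF.
rewrite -(ler_pM2l zx); congr (_ <= _).
by field; rewrite gt_eqF.
Qed.

Lemma convex_three_slope : three_slope f.
Proof.
by move=> x y z x0 xy yz; apply: convex_chord; exact: ltW.
Qed.

Lemma convex_continuous x : 0 < x -> {for x, continuous f}.
Proof. exact/three_slope_continuous/convex_three_slope. Qed.

Lemma convex_IVT a c v : 0 < a -> a <= c -> f a <= v -> v <= f c ->
  exists2 x, a <= x <= c & f x = v.
Proof.
move=> a0 ac fav vfc.
have [||x] := @IVT R f a c v ac.
- apply: continuous_in_subspaceT => x; rewrite inE/= in_itv/= => /andP[ax _].
  by apply: convex_continuous; exact: lt_le_trans ax.
- by rewrite ge_min fav le_max vfc orbT.
by rewrite in_itv/= => xac fxv; exists x.
Qed.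

(** [f x / x] is nondecreasing, being the slope of a chord from the origin. *)
Lemma convex_linear_growth a c : 0 < a -> a <= c -> c * f a <= a * f c.
Proof.
move=> a0 ac; have := convex_chord (lexx 0) (ltW a0) ac.
by rewrite f0 mulr0 add0r !subr0.
Qed.

Lemma convex_root_bounded : exists2 M, 0 < M & forall x, M <= x -> 0 < f x.
Proof.
have [M M0 fM] := pos; exists M => // x Mx; rewrite -(pmulr_rgt0 _ M0).
by apply: lt_le_trans (convex_linear_growth M0 Mx); rewrite mulr_gt0//; lra.
Qed.

Let roots := [set th : R | 0 <= th /\ f th = 0].

Let roots_sup : has_sup roots.
Proof.
split; first by exists 0; split.
have [M M0 fM] := convex_root_bounded; exists M => x [x0 fx].
by rewrite leNgt; apply/negP => /ltW/fM; rewrite fx ltxx.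
Qed.

Lemma Phi0_ge0 : 0 <= r.
Proof. by apply: sup_upper_bound. Qed.

Lemma Phi0_root : f r = 0.
Proof.
have := Phi0_ge0; rewrite le_eqVlt => /predU1P[<-//|r0].
apply/eqP/negP => /negP fr.
have cr := convex_continuous r0.
have e0 : 0 < `|f r| by rewrite normr_gt0.
move/cvgrPdist_lt: cr => /(_ _ e0)[d /= d0 H].
have [x [x0 fx] dx] := sup_adherent d0 roots_sup.
have xr : x <= r by exact: sup_upper_bound.
suff : `|f r - f x| < `|f r| by rewrite fx subr0 ltxx.
have dx' : r - d < x := dx.
by apply: H; rewrite /ball_/= ger0_norm; lra.
Qed.

Lemma convex_pos_right x : r < x -> 0 < f x.
Proof.
move=> rx; rewrite ltNge; apply/negP => fx0.
have [M M0 fM] := convex_root_bounded.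
have xp : 0 < x := le_lt_trans Phi0_ge0 rx.
have xM : x <= Num.max x M by rewrite le_max lexx.
have fMx : 0 <= f (Num.max x M) by apply/ltW/fM; rewrite le_max lexx orbT.
have [y /andP[xy _] fy] := convex_IVT xp xM fx0 fMx.
have : y <= r by apply: sup_upper_bound => //; split=> //; lra.
by lra.
Qed.

Lemma convex_increasing x y : r <= x -> x < y -> f x < f y.
Proof.
move=> rx xy; have fy : 0 < f y by apply: convex_pos_right; lra.
have := convex_chord Phi0_ge0 rx (ltW xy); rewrite Phi0_root mulr0 add0r => H.
have yr : 0 < y - r by lra.
rewrite -(ltr_pM2l yr); apply: le_lt_trans H _.
by rewrite ltr_pM2r//; lra.
Qed.

(** The two conditions on [q] are what makes [Phi f q] positive: either the root is positive, or [q]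
    is and the preimage lies right of 0. *)
Lemma Phi_spec q : (r = 0 -> 0 < q) -> (0 < r -> 0 <= q) ->
  [/\ 0 < Phi f q, f (Phi f q) = q & forall th, Phi f q < th -> q < f th].
Proof.
move=> q0 q1.
have [c rc [fc c0]] : exists2 c, r <= c & f c = q /\ 0 < c.
  have q0' : 0 <= q.
    have := Phi0_ge0; rewrite le_eqVlt => /predU1P[/esym/q0/ltW//|]; exact: q1.
  move: (q0'); rewrite le_eqVlt => /predU1P[q00|qp].
    exists r => //; split; first by rewrite Phi0_root.
    rewrite lt_neqAle Phi0_ge0 andbT eq_sym; apply/eqP => /q0.
    by rewrite -q00 ltxx.
  have [a a0 fa] := pos.
  (* Linear growth gives [f M >= q] once [M] exceeds [a] and [a * q / f a]; [r + 1] places [M] to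
     the right of the root. *)
  pose M := Num.max a (Num.max (r + 1) (a * q / f a)).
  have aM : a <= M by rewrite /M le_max lexx.
  have rM : r + 1 <= M by rewrite /M !le_max lexx orbT.
  have qM : q <= f M.
    have h : a * q / f a <= M by rewrite /M !le_max lexx !orbT.
    have := convex_linear_growth a0 aM; move: h; rewrite ler_pdivrMr// => h1 h2.
    by rewrite -(ler_pM2l a0); exact: le_trans h1 h2.
  have fM : 0 < f M by lra.
  (* The intermediate value theorem needs a positive left end, continuity being established only
     there, and [r] may be 0. The chord from [r] to [M] gives [f x <= q / 2] at
     [x = r + (M - r) * e]. *)
  pose e := q / (2 * f M).
  have e0 : 0 < e by rewrite /e divr_gt0// mulr_gt0.
  have e1 : e <= 1 / 2 by rewrite /e ler_pdivrMr ?mulr_gt0//; lra.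
  have Mr : 0 < M - r by lra.
  pose x := r + (M - r) * e.
  have rx : r < x by rewrite /x ltrDl mulr_gt0.
  have xM : x <= M.
    rewrite /x -lerBrDl -[leRHS]mulr1; apply: ler_wpM2l; lra.
  have fxq : f x <= q.
    have := convex_chord Phi0_ge0 (ltW rx) xM; rewrite Phi0_root mulr0 add0r.
    have -> : (x - r) * f M = (M - r) * (q / 2) by rewrite /x /e; field; rewrite gt_eqF.
    by rewrite ler_pM2l// => h; lra.
  have xp : 0 < x := le_lt_trans Phi0_ge0 rx.
  have [y /andP[xy _] fy] := convex_IVT xp xM fxq qM.
  by exists y; [lra|split=> //; lra].
have Pc : Phi f q = c.
  rewrite /Phi -fc pinvKV//; last by rewrite inE/= in_itv/= andbT.
  move=> x y; rewrite !inE/= !in_itv/= !andbT => rx ry fxy.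
  case: (ltgtP x y) => // h.
    by have := convex_increasing rx h; rewrite fxy ltxx.
  by have := convex_increasing ry h; rewrite fxy ltxx.
by rewrite Pc; split=> // th cth; rewrite -fc; exact: convex_increasing.
Qed.

End inverse_of_convex.

(** * Paths of a Levy process that is almost surely nonpositive at time 1 *)

Section levy_positivity.
Context (R : realType) (d : measure_display) (T : measurableType d) (P : probability T R).
Variables (X : R -> {RV P >-> R}).
Hypothesis hX : levy_process X.

Let posR : measurable [set x : R | 0 < x].
Proof. by rewrite (_ : [set x | _] = `]0, +oo[%classic)//; apply/seteqP; split=> x/=; rewrite in_itv/= andbT. Qed.

Let measurable_increment (Z : R -> {RV P >-> R}) s t (B : set R) : measurable B ->
  measurable (increment Z s t @^-1` B).
Proof.
move=> mB; rewrite -[X in measurable X]setTI; apply: (measurable_funB _ _ measurableT mB);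
  exact: measurable_funP.
Qed.

(** If all [n.+1] increments over a regular subdivision were positive, so would be the increment
    over [[0, 1]]. By independence and stationarity that event has the [n.+1]-th power of the
    probability of a single one. *)
Lemma increment_pos_null n i : P (X 1 @^-1` [set x | 0 < x]) = 0%E ->
  P (increment X (i%:R / n.+1%:R) (i.+1%:R / n.+1%:R) @^-1` [set x | 0 < x]) = 0%E.
Proof.
move=> P0; have [_ ind stat _] := hX.
pose t (k : nat) : R := k%:R / n.+1%:R.
have n0 : 0 < n.+1%:R^-1 :> R by rewrite invr_gt0.
have t0 k : 0 <= t k by rewrite divr_ge0.
have dt k : t k.+1 = t k + n.+1%:R^-1 by rewrite /t -natr1 mulrDl mul1r.
have st k : P (increment X (t k) (t k.+1) @^-1` [set x | 0 < x]) =
    P (X n.+1%:R^-1 @^-1` [set x | 0 < x]).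
  by rewrite dt; apply: stat => //; exact: ltW.
rewrite (st i).
have := ind n.+1 t (fun=> [set x | 0 < x]) (t0 0%N).
move=> /(_ _ (fun=> posR))H.
have tS k : t k <= t k.+1 by rewrite dt lerDl ltW.
have {}H := H tS.
have le0 : (P (\bigcap_(k in `I_n.+1) (increment X (t k) (t k.+1) @^-1` [set x | (0 < x)%R])) <= 0)%E.
  rewrite -P0 -(stat 0 1 _ (lexx 0) ler01 posR); apply: le_measure.
  - rewrite inE; apply: bigcap_measurable; first by exists 0%N.
    by move=> k _; exact: measurable_increment.
  - by rewrite inE; exact: measurable_increment.
  move=> w Hw; rewrite /preimage /increment/= add0r.
  suff G : forall k, (k < n.+1)%N -> 0 < X (t k.+1) w - X (t 0%N) w.
    have := G n (ltnSn n); rewrite /t mulfV// mul0r//.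
  elim=> [|k IH] kn; first exact: (Hw 0%N).
  have := IH (ltnW kn); have := Hw k.+1 kn; rewrite /increment/preimage/=.
  by lra.
move: le0; rewrite H.
under eq_bigr do rewrite st.
set y := P _ => le0.
have yf : y \is a fin_num by apply: fin_num_measure; rewrite -[X in measurable X]setTI; exact: measurable_funP.
have y0 : (0 <= y)%E by exact: measure_ge0.
rewrite -(fineK yf) in le0 y0 *; move: le0 y0.
rewrite prodEFin prodr_const card_ord !lee_fin => le0 y0.
have : fine y ^+ n.+1 == 0 by rewrite eq_le le0 exprn_ge0.
by rewrite expf_eq0/= => /eqP ->.
Qed.

(** Countably many null events give monotonicity along all regular grids at once; right-continuity
    extends it to real times. *)
Lemma nonincreasing_paths : P (X 1 @^-1` [set x | 0 < x]) = 0%E ->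
  {ae P, forall w, nonincreasing_path (fun t => X t w)}.
Proof.
move=> P0; have [_ _ _ cad] := hX.
have A : {ae P, forall w, forall n i : nat,
    X (i.+1%:R / n.+1%:R) w <= X (i%:R / n.+1%:R) w}.
  apply/ae_foralln => n; apply/ae_foralln => i.
  exists (increment X (i%:R / n.+1%:R) (i.+1%:R / n.+1%:R) @^-1` [set x | 0 < x]).
  split; [exact: measurable_increment|exact: increment_pos_null|].
  by move=> w /= /negP; rewrite -ltNge /increment/= subr_gt0.
move: A cad; apply: filterS2 => w A [rc _] s t s0.
rewrite le_eqVlt => /predU1P[->//|st].
have t0 : 0 <= t by lra.
have mono n i j : (i <= j)%N -> X (j%:R / n.+1%:R) w <= X (i%:R / n.+1%:R) w.
  elim: j => [|j IH]; first by rewrite leqn0 => /eqP ->.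
  by rewrite leq_eqVlt => /predU1P[->//|/IH]; exact: le_trans.
(* The successor puts the grid point strictly to the right of [x], where right-continuity
   applies. *)
pose v (x : R) n : R := (grid x n.+1).+1%:R / n.+1%:R.
have vx x : 0 <= x -> X (v x n) w @[n --> \oo] --> X x w.
  move=> x0; apply: (cvg_at_rightP (fun u => X u w) x (X x w)).1; first exact: rc.
  split=> [n|].
    rewrite /v ltr_pdivlMr// mulrC /grid.
    by have /andP[_] := truncn_itv (mulr_ge0 (ler0n R n.+1) x0).
  have := grid_seqS (grid_cvg x0); rewrite /grid_seq => H.
  by move: H; rewrite -(cvg_shiftS (fun N => (grid x N).+1%:R / N%:R : R)).
apply: ler_cvg_to (vx _ t0) (vx _ s0) _; near=> n.
by apply: mono; rewrite ltnS le_grid// ltW.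
Unshelve. all: by end_near.
Qed.

(** Chernoff's bound at level [e] is [expR (- (th * e))] for every [th > 0], hence the probability
    is 0; then [e] runs through [n.+1%:R^-1]. *)
Lemma chernoff_null (Y : {RV P >-> R}) :
  (forall th, 0 <= th -> ('M_P Y th <= 1)%E) -> P (Y @^-1` [set x | 0 < x]) = 0%E.
Proof.
move=> M1.
have mY (B : set R) : measurable B -> measurable (Y @^-1` B).
  by move=> mB; rewrite -[X in measurable X]setTI; exact: measurable_funP.
have mE (e : R) : measurable [set x : R | e <= x].
  by rewrite (_ : [set x | _] = `[e, +oo[%classic)//; apply/seteqP; split=> x/=; rewrite in_itv/= andbT.
have Pe e : 0 < e -> P (Y @^-1` [set x | e <= x]) = 0%E.
  move=> e0; apply/eqP; rewrite eq_le measure_ge0 andbT; apply/lee_addgt0Pr => h h0; rewrite add0e.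
  (* The value of [th] at which the bound equals [h]. *)
  pose k := - ln h / e.
  pose th := Num.max 1 k.
  have th0 : 0 < th by rewrite lt_max ltr01.
  have := chernoff Y e th0; rewrite (_ : [set x | _] = Y @^-1` [set x | e <= x])//.
  move/le_trans; apply.
  apply: (@le_trans _ _ (1 * (expR (- (th * e)))%:E)%E).
    by apply: lee_wpmul2r; [rewrite lee_fin expR_ge0|exact/M1/ltW].
  rewrite mul1e lee_fin -[leRHS]lnK ?posrE// ler_expR lerNl.
  by rewrite -ler_pdivrMr// /th le_max lexx orbT.
have -> : Y @^-1` [set x | 0 < x] = \bigcup_n (Y @^-1` [set x | n.+1%:R^-1 <= x]).
  apply/seteqP; split=> [w/= Yw|w [n _]/=]; last by apply: lt_le_trans; rewrite invr_gt0.
  exists (Num.truncn (Y w)^-1) => //=; rewrite invf_ple ?posrE//; apply: ltW.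
  by have /andP[] := truncn_itv (ltW (etrans (invr_gt0 (Y w)) Yw)).
apply/eqP; rewrite eq_le measure_ge0 andbT.
apply: le_trans (measure_sigma_subadditive _ _ _ (@subset_refl _ _)) _.
- by move=> n; exact: mY.
- by apply: bigcup_measurable => n _; exact: mY.
by rewrite eseries0// => n _ _; apply: Pe; rewrite invr_gt0.
Qed.

End levy_positivity.

Section levy_exponent.
Context (R : realType) (d : measure_display) (T : measurableType d) (P : probability T R).
Variables (X : R -> {RV P >-> R}) (gamma sigma : R)
  (Pi : {measure set (measurableTypeR R) -> \bar R}).
Local Notation psi := (laplace_exponent gamma sigma Pi).

(** This is where the exclusion of decreasing paths enters: if [psi <= 0] on the positive axis, all
    moment generating values are at most 1, so the process is nonpositive at time 1 and its paths
    decrease. *)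
Lemma laplace_exponent_pos : spectrally_negative_levy X -> has_triplet X gamma sigma Pi ->
  exists2 th, 0 < th & 0 < psi th.
Proof.
move=> [hX _ nX] [s0 hPi hM]; apply: contrapT => nth; apply: nX.
apply: nonincreasing_paths => //; apply: chernoff_null => th th0.
rewrite hM// lee_fin -expR0 ler_expR leNgt; apply/negP => pth; apply: nth; exists th => //.
rewrite lt_neqAle th0 andbT eq_sym; apply/eqP => th00.
by move: pth; rewrite th00 laplace_exponent0 ltxx.
Qed.

End levy_exponent.

(** * Passage to the limit *)

Section geometric_limit.
Context (R : realType).
Implicit Types (c x : R).

(** With [u = c / N], the power is squeezed by [expR (- (u / (1 - u))) <= 1 - u <= expR (- u)]. *)
Lemma grid_rho c (n_ : nat -> nat) x : 0 < c -> grid_seq n_ x ->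
  (1 - c / N%:R) ^+ n_ N @[N --> \oo] --> expR (- c * x).
Proof.
move=> c0 nx.
have lo : expR (- c * ((n_ N)%:R / N%:R / (1 - c / N%:R))) @[N --> \oo] --> expR (- c * x).
  apply: continuous_cvg; first exact: continuous_expR.
  have h : c / N%:R @[N --> \oo] --> (0 : R).
    rewrite -[X in _ --> X](mulr0 c); apply: cvgM; first exact: cvg_cst.
    rewrite -(cvg_shiftS (fun N => N%:R^-1 : R)).
    exact: cvg_harmonic.
  have h1 : (1 - c / N%:R)^-1 @[N --> \oo] --> (1 : R).
    rewrite -[X in _ --> X]invr1; apply: cvgV; first exact: oner_neq0.
    by rewrite -[X in _ --> X]subr0; apply: cvgB => //; exact: cvg_cst.
  apply: cvgM; first exact: cvg_cst.
  by rewrite -[X in _ --> X]mulr1; apply: cvgM.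
have hi : expR (- c * ((n_ N)%:R / N%:R)) @[N --> \oo] --> expR (- c * x).
  apply: continuous_cvg; first exact: continuous_expR.
  by apply: cvgM => //; exact: cvg_cst.
apply: squeeze_cvgr lo hi; near=> N.
have Nc : c < N%:R by near: N; exact: nbhs_infty_gtr.
have N0 : 0 < N%:R :> R := lt_trans c0 Nc.
have cN0 : 0 < c / N%:R by rewrite divr_gt0.
have cN : c / N%:R < 1 by rewrite ltr_pdivrMr// mul1r.
have r0 : 0 < 1 - c / N%:R by lra.
apply/andP; split.
  rewrite (_ : - c * _ = (- (c / N%:R / (1 - c / N%:R))) * (n_ N)%:R); last first.
    by field; rewrite !gt_eqF// subr_gt0.
  rewrite expRM_natr; apply: lerXn2r; rewrite ?nnegrE ?expR_ge0 ?(ltW r0)//.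
  rewrite -[leLHS]invrK -[leRHS]invrK -expRN opprK lef_pV2 ?posrE ?invr_gt0 ?expR_gt0//.
  apply: le_trans (expR_ge1Dx _); rewrite le_eqVlt; apply/orP; left; apply/eqP.
  by field; rewrite !gt_eqF// subr_gt0.
rewrite (_ : - c * _ = (- (c / N%:R)) * (n_ N)%:R); last first.
  by field; rewrite gt_eqF.
rewrite expRM_natr; apply: lerXn2r; rewrite ?nnegrE ?expR_ge0 ?(ltW r0)//.
exact: expR_ge1Dx.
Unshelve. all: by end_near.
Qed.

End geometric_limit.

(** * From renewal sequences to [g], its derivative and [s] *)

Section renewal_limits.
Context (R : realType).
Local Notation mu := (@lebesgue_measure R).
Variables (c b : R) (W V K : R -> R).
Hypotheses (c0 : 0 < c) (b0 : 0 <= b).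
Hypotheses (mW : measurable_fun setT W) (W0 : forall y, 0 <= W y)
  (cW : forall x, 0 < x -> {for x, continuous W}).
Hypotheses (mV : measurable_fun setT V) (V0 : forall y, 0 <= V y).
Hypotheses (K0 : forall th, c < th -> K th != 0)
  (LW : forall th, c < th -> (\int[mu]_y (exp_pos th y * W y)%:E = ((K th)^-1)%:E)%E)
  (LV : forall th, c < th ->
     (\int[mu]_y (exp_pos th y * V y)%:E = (K th / (th * (th - c)) - b)%:E)%E).

Let a N := first_mass b (pmass N%:R V).
Let u N := tilted_difference N%:R c (pmass N%:R W).
Let rho N : R := 1 - c / N%:R.
Let G N n : R := N%:R * (rho N ^+ n * pmass N%:R W n).
(** The index is shifted because the increment of [G] at [n] involves [u N n.+1]; [u N 0] is left as
    a boundary value. *)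
Let U N n : R := N%:R * u N n.+1.
Local Notation g := (fun x => expR (- c * x) * W x).

Let conv N : c < N%:R -> forall n, \sum_(k < n.+1) u N k * a N (n - k)%N = N%:R^-1.
Proof. by move=> cN; exact: (renewal_identity c0 cN b0 mW W0 mV V0 K0 LW LV). Qed.

Hypotheses (a0 : forall N, c < N%:R -> forall n, 0 < a N n)
  (aN : forall N, c < N%:R -> nonincreasing_from_start (a N))
  (aL : forall N, c < N%:R -> log_convex_seq (a N)).

Let Nc : \forall N \near \oo, c < N%:R. Proof. exact: nbhs_infty_gtr. Qed.

Let rho_itv N : c < N%:R -> 0 < rho N < 1.
Proof.
move=> cN; have N0 : 0 < N%:R :> R := lt_trans c0 cN.
have h : c / N%:R < 1 by rewrite ltr_pdivrMr// mul1r.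
have h0 : 0 < c / N%:R by rewrite divr_gt0.
by rewrite /rho; apply/andP; split; lra.
Qed.

Let G_step N n : c < N%:R -> G N n.+1 - G N n = rho N ^+ n * u N n.+1.
Proof.
move=> cN; have N0 : N%:R != 0 :> R by rewrite gt_eqF// (lt_trans c0 cN).
rewrite /G /u /tilted_difference exprS.
have -> : N%:R - c = N%:R * rho N by rewrite /rho; field.
by ring.
Qed.

Lemma grid_limit_tilted : grid_limit G g.
Proof.
move=> x n_ x0 nx.
have -> : (fun N => G N (n_ N)) =
    (fun N => (1 - c / N%:R) ^+ n_ N * (N%:R * pmass N%:R W (n_ N))).
  by apply/funext => N; rewrite /G /rho mulrCA.
apply: cvgM; first exact: grid_rho.
have c1 : c < c + 1 by lra.
have th0 : 0 < c + 1 by rewrite addr_gt0.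
apply: (post_widder mW W0 th0 _ x0 (cW x0) nx).
by rewrite LW ?ltry.
Qed.

Let uE N : c < N%:R -> (forall n, 0 <= u N n) /\ nonincreasing_from_start (u N).
Proof.
move=> cN; apply: (renewal_ge0 (a0 cN) (aN cN) (aL cN) _ (conv cN)).
by rewrite invr_ge0.
Qed.

Let D_nonincr N : c < N%:R -> nonincreasing_from_start (fun n => G N n.+1 - G N n).
Proof.
move=> cN n; have [u0 un] := uE cN; have /andP[r0 r1] := rho_itv cN.
rewrite !G_step//; apply: ler_pM => //; first by rewrite exprn_ge0// ltW.
by rewrite exprS ler_piMl ?exprn_ge0// ltW.
Qed.

Let D_ge0 N n : c < N%:R -> 0 <= G N n.+1 - G N n.
Proof.
move=> cN; have [u0 _] := uE cN; have /andP[r0 r1] := rho_itv cN.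
by rewrite G_step// mulr_ge0 ?exprn_ge0// ltW.
Qed.

Let oppG : grid_limit (fun N n => - G N n) (fun x => - g x).
Proof. by move=> x n_ x0 nx; apply: cvgN; exact: grid_limit_tilted. Qed.

Lemma tilted_concave : three_slope (fun x => - g x).
Proof.
apply: (@grid_limit_three_slope R (fun N n => - G N n)) oppG.
apply: filterS Nc => N cN n; have := D_nonincr cN n.
by rewrite !opprK addrC => h; rewrite [leRHS]addrC.
Qed.

Lemma tilted_nondecreasing x y : 0 < x -> x <= y -> g x <= g y.
Proof.
move=> x0 xy; rewrite -lerN2.
apply: (@grid_limit_nonincreasing R (fun N n => - G N n) (fun x => - g x)) x0 xy => //.
apply: filterS Nc => N cN n; rewrite lerN2 -subr_ge0; exact: D_ge0.
Qed.

Section convex_renewal.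
Hypotheses (d0 : forall N, c < N%:R -> forall n, 0 < a N n - a N n.+1)
  (dL : forall N, c < N%:R -> log_convex_seq (fun n => a N n - a N n.+1)).

Let u_convex N : c < N%:R -> nonincreasing_from_start (fun n => u N n - u N n.+1).
Proof.
move=> cN; have [u0 _] := uE cN.
exact: (renewal_convex (a0 cN) (aL cN) (d0 cN) (dL cN) (u0 0%N) (renewal_of_convolution (conv cN))).
Qed.

Let D_convex N : c < N%:R ->
  nonincreasing_from_start (fun n => (G N n.+1 - G N n) - (G N n.+2 - G N n.+1)).
Proof.
move=> cN n; have [u0 un] := uE cN; have /andP[r0 r1] := rho_itv cN.
rewrite !G_step//.
(* Discrete product rule, arranged so that both factors are nonnegative and nonincreasing in [m]. *)
have E m : rho N ^+ m * u N m.+1 - rho N ^+ m.+1 * u N m.+2 =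
    rho N ^+ m * ((u N m.+1 - u N m.+2) + (1 - rho N) * u N m.+2).
  by rewrite exprS; ring.
rewrite !E; apply: ler_pM.
- by rewrite exprn_ge0// ltW.
- by rewrite addr_ge0 ?subr_ge0// mulr_ge0// subr_ge0 ltW.
- by rewrite exprS ler_piMl ?exprn_ge0// ltW.
- by rewrite lerD// ?u_convex// ler_wpM2l// subr_ge0 ltW.
Qed.

Lemma tilted_derivable x : 0 < x -> derivable g x 1.
Proof.
apply: (@grid_limit_derivable R G) => //.
- apply: filterS Nc => N cN; split.
  + rewrite /G expr0 mul1r mulr_ge0//; apply: pmass_ge0 => //.
  + by move=> n; exact: D_ge0.
  + exact: D_nonincr.
  + exact: D_convex.
- exact: grid_limit_tilted.
- exact: tilted_concave.
- exact: tilted_nondecreasing.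
Qed.

Let limD : grid_limit (fun N n => N%:R * (G N n.+1 - G N n)) (derive1 g).
Proof.
apply: grid_limit_derive1; [|exact: grid_limit_tilted|exact: tilted_derivable].
by apply: filterS Nc => N cN; exact: D_nonincr.
Qed.

Lemma derive1_tilted_nonincreasing x y : 0 < x -> x <= y -> derive1 g y <= derive1 g x.
Proof.
apply: (grid_limit_nonincreasing _ limD).
by apply: filterS Nc => N cN n; rewrite ler_wpM2l// D_nonincr.
Qed.

Lemma derive1_tilted_three_slope : three_slope (derive1 g).
Proof.
apply: (grid_limit_three_slope _ limD).
apply: filterS Nc => N cN n; rewrite -[leLHS]mulrBr -[leRHS]mulrBr; apply: ler_wpM2l => //; exact: D_convex.
Qed.

Definition slope_excess (x : R) : R := expR (c * x) * derive1 g x.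

Lemma grid_limit_slope_excess : grid_limit U slope_excess.
Proof.
move=> x n_ x0 nx; have L := limD x0 nx.
have Rl : ((1 - c / N%:R) ^+ n_ N)^-1 @[N --> \oo] --> expR (c * x).
  rewrite -[c * x]opprK expRN; apply: cvgV; first by rewrite gt_eqF ?expR_gt0.
  by rewrite -mulNr; exact: grid_rho.
have H : ((1 - c / N%:R) ^+ n_ N)^-1 * (N%:R * (G N (n_ N).+1 - G N (n_ N))) @[N --> \oo]
    --> slope_excess x by exact: cvgM.
apply: cvg_trans H; apply: near_eq_cvg; near=> N.
have cN : c < N%:R by near: N.
have /andP[r0 r1] := rho_itv cN.
by rewrite -/(rho N) G_step// /U mulrCA mulKf// gt_eqF// exprn_gt0.
Unshelve. all: by end_near.
Qed.

Lemma slope_excess_ge0 x : 0 < x -> 0 <= slope_excess x.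
Proof.
apply: (grid_limit_ge0 _ grid_limit_slope_excess).
by apply: filterS Nc => N cN n; rewrite mulr_ge0//; case: (uE cN).
Qed.

Lemma slope_excess_nonincreasing x y : 0 < x -> x <= y -> slope_excess y <= slope_excess x.
Proof.
apply: (grid_limit_nonincreasing _ grid_limit_slope_excess).
by apply: filterS Nc => N cN n; rewrite ler_wpM2l//; case: (uE cN) => _; exact.
Qed.

Lemma slope_excess_three_slope : three_slope slope_excess.
Proof.
apply: (grid_limit_three_slope _ grid_limit_slope_excess).
apply: filterS Nc => N cN n; rewrite -[leLHS]mulrBr -[leRHS]mulrBr; apply: ler_wpM2l => //; exact: u_convex.
Qed.

Lemma is_derive_scale (x : R) : 0 < x -> is_derive x (1 : R) W (c * W x + slope_excess x).
Proof.
move=> x0; have dg : is_derive x (1 : R) g (derive1 g x).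
  by rewrite derive1E; apply/derivableP/tilted_derivable.
have dW : is_derive x (1 : R) ((fun s => expR (c * s)) * g)
    (expR (c * x) *: derive1 g x + g x *: (c * expR (c * x))).
  exact: is_deriveM (is_derive_expM c x) dg.
have E : (fun s => expR (c * s)) * g = W.
  apply/funext => s; transitivity (expR (c * s) * (expR (- c * s) * W s)) => //.
  rewrite mulrA -expRD mulNr subrr expR0 mul1r//.
rewrite E in dW; apply: (is_derive_eq dW).
rewrite /slope_excess /GRing.scale/= addrC; congr (_ + _).
rewrite mulrAC mulrCA -expRD mulNr addNr expR0 mulr1.
by [].
Qed.

(** * The Gaussian case: derivability of [s] *)

Section gaussian_component.
Hypotheses (bp : 0 < b) (cV : forall x, 0 < x -> {for x, continuous V}).

(** The convolution at index 0 reads [u N 0 * a N 0 = 1 / N], and [a N 0] contains the atom [b]. *)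
Let u_first N : c < N%:R -> N%:R * u N 0%N <= b^-1.
Proof.
move=> cN; have N0 : 0 < N%:R :> R := lt_trans c0 cN.
have ba : b <= a N 0%N by rewrite /a /first_mass/= lerDl pmass_ge0.
have a00 : 0 < a N 0%N := lt_le_trans bp ba.
have := conv cN 0%N; rewrite big_ord1 subnn => /(congr1 (fun t => t / a N 0%N)).
rewrite mulfK ?gt_eqF// => ->; rewrite mulrA mulfV ?gt_eqF// mul1r.
by rewrite lef_pV2.
Qed.

Let V_limit x (n_ : nat -> nat) : 0 < x -> grid_seq n_ x ->
  N%:R * pmass N%:R V (n_ N) @[N --> \oo] --> V x.
Proof.
move=> x0 nx; have c1 : c < c + 1 by rewrite ltrDl.
have th0 : 0 < c + 1 by rewrite addr_gt0.
apply: (post_widder mV V0 th0 _ x0 (cV x0) nx).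
by rewrite LV ?ltry.
Qed.

(** The limit of [renewal_second_difference_le] with [p] near [N * (x - h)] and [m] near [N * h],
    using [a N 0 >= b] on the left and [N * u N 0 <= 1 / b] on the right. *)
Lemma slope_excess_second_difference x h : 0 < h -> h < x ->
  b * (slope_excess (x + h) - 2 * slope_excess x + slope_excess (x - h)) <=
    2 * h * (b^-1 * V (x - h) - slope_excess (h + h) * V (x + h)).
Proof.
move=> h0 hx; have xh0 : 0 < x - h by rewrite subr_gt0.
have xp0 : 0 < x + h by rewrite addr_gt0// (lt_trans h0).
have x0 : 0 < x := lt_trans h0 hx.
pose p N := grid (x - h) N; pose m N := grid h N.
have hp : grid_seq p (x - h) by apply/grid_cvg/ltW.
have hm : grid_seq m h by apply/grid_cvg/ltW.
have hpm : grid_seq (fun N => (p N + m N)%N) x.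
  by have := grid_seqD hp hm; rewrite subrK.
have hpmm : grid_seq (fun N => (p N + m N + m N)%N) (x + h) by exact: grid_seqD.
have U0 := grid_limit_slope_excess xh0 hp.
have U1 := grid_limit_slope_excess x0 hpm.
have U2 := grid_limit_slope_excess xp0 hpmm.
have Um := grid_limit_slope_excess (addr_gt0 h0 h0) (grid_seqD hm hm).
have V1 := V_limit xh0 (grid_seqS hp).
have V2 := V_limit xp0 (grid_seqS hpmm).
have Ll : b * (U N (p N + m N + m N)%N - 2 * U N (p N + m N)%N + U N (p N)) @[N --> \oo] -->
    b * (slope_excess (x + h) - 2 * slope_excess x + slope_excess (x - h)).
  apply: cvgM; first exact: cvg_cst.
  apply: cvgD; last exact: U0.
  by apply: cvgB; [exact: U2|apply: cvgM; [exact: cvg_cst|exact: U1]].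
have Lr : 2 * ((m N)%:R / N%:R) * (b^-1 * (N%:R * pmass N%:R V (p N).+1) -
      U N (m N + m N)%N * (N%:R * pmass N%:R V (p N + m N + m N).+1)) @[N --> \oo] -->
    2 * h * (b^-1 * V (x - h) - slope_excess (h + h) * V (x + h)).
  apply: cvgM; first by apply: cvgM => //; exact: cvg_cst.
  apply: cvgB; last exact: cvgM.
  by apply: cvgM => //; exact: cvg_cst.
apply: (ler_cvg_to Ll Lr); near=> N.
have cN : c < N%:R by near: N.
have N0 : 0 < N%:R :> R := lt_trans c0 cN.
have [u0 un] := uE cN.
have ba : b <= a N 0%N by rewrite /a /first_mass/= lerDl pmass_ge0.
(* The successor of [p N] matches the shift in [U] and avoids index 0, where [a] contains [b]. *)
have H := renewal_second_difference_le (fun n => ltW (a0 cN n)) (aN cN) u0 un (u_convex cN) (conv cN)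
  (p N).+1 (m N).
have Cx := convex_seq_second_difference (u_convex cN) (p N).+1 (m N).
rewrite !addSn in H Cx.
set D := u N _ - _ + _ in H Cx.
have -> : U N (p N + m N + m N)%N - 2 * U N (p N + m N)%N + U N (p N) = N%:R * D.
  by rewrite /U /D; ring.
have H1 : b * (N%:R * D) <= N%:R * (a N 0%N * D).
  by rewrite mulrCA ler_wpM2l// ler_wpM2r.
apply: (le_trans H1); apply: (le_trans (ler_wpM2l (ltW N0) H)).
have aE n : a N n.+1 = pmass N%:R V n.+1 by rewrite /a /first_mass/= add0r.
rewrite !aE; set A := pmass _ _ _; set B := pmass _ _ _.
have A0 : 0 <= A by exact: pmass_ge0.
have B0 : 0 <= B by exact: pmass_ge0.
have uf := u_first cN.
have us : u N (m N + m N).+1 <= u N (m N + m N)%N by exact: un.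
have -> : N%:R * ((2 * m N)%:R * (u N 0%N * A - u N (m N + m N)%N * B)) =
    2 * ((m N)%:R / N%:R) * (N%:R * u N 0%N * (N%:R * A) - N%:R * u N (m N + m N)%N * (N%:R * B)).
  by rewrite natrM; field; rewrite gt_eqF.
apply: ler_wpM2l; first by rewrite mulr_ge0// divr_ge0.
apply: lerB; first by apply: ler_wpM2r => //; rewrite mulr_ge0.
by apply: ler_wpM2r; [rewrite mulr_ge0|rewrite /U ler_wpM2l].
Unshelve. all: by end_near.
Qed.

Let L th : R := fine (\int[mu]_y (exp_pos th y * V y)%:E)%E.

Let L_fin th : c < th -> (\int[mu]_y (exp_pos th y * V y)%:E = (L th)%:E)%E.
Proof. by move=> cth; rewrite /L LV. Qed.

Let L_ge0 th : 0 <= L th.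
Proof.
by apply: fine_ge0; apply: integral_ge0 => y _; rewrite lee_fin mulr_ge0 ?exp_pos_ge0.
Qed.

Let L_nonincr s t : c < s -> s <= t -> L t <= L s.
Proof.
move=> cs st; rewrite -lee_fin -(L_fin cs) -(L_fin (lt_le_trans cs st)).
apply: le_integral_EFin.
- by apply: measurable_funM => //; exact: measurable_exp_pos.
- by apply: measurable_funM => //; exact: measurable_exp_pos.
- by move=> y; rewrite mulr_ge0 ?exp_pos_ge0.
move=> y; apply: ler_wpM2r => //; rewrite /exp_pos; case: ifP => // y0.
by rewrite ler_expR lerN2 ler_wpM2r// ltW.
Qed.

(** For [j < M] the weight [z ^+ j] is at least [z ^+ M], so the transform dominates the partial
    sum. *)
Let partial_mass N z M : c < N%:R -> 0 < z -> z < 1 -> c < N%:R * (1 - z) ->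
  z ^+ M * \sum_(j < M) pmass N%:R V j <= L (N%:R * (1 - z)).
Proof.
move=> cN z0 z1 cz; have N0 : 0 <= N%:R :> R by [].
have fin n : (\int[mu]_y (pois N%:R n y * V y)%:E < +oo)%E.
  by apply: (pmass_fin n N0 z0 mV V0); rewrite L_fin// ltry.
have pm0 n : 0 <= pmass N%:R V n by exact: pmass_ge0.
have E := psum_pmass N0 (ltW z0) mV V0 fin.
rewrite -lee_fin -L_fin// -E /psum.
apply: (@le_trans _ _ (\sum_(j < M) (pmass N%:R V j * z ^+ j)%:E)%E).
  rewrite sumEFin lee_fin mulr_sumr; apply: ler_sum => j _; rewrite mulrC ler_wpM2l//.
  by apply: ler_wiXn2l (ltnW (ltn_ord j)); exact: ltW.
rewrite -(big_mkord xpredT (fun j => (pmass N%:R V j * z ^+ j)%:E)).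
by apply: nneseries_lim_ge => n _; rewrite lee_fin mulr_ge0// exprn_ge0// ltW.
Qed.

(** In the renewal equation at [n.+1] the last term gives [U N n * a N 0], and bounding the other
    [u N k] by [u N 0] leaves a partial sum of masses of [V]. For large [th] and [x] small compared
    with [1 / th] this forces [s] close to [1 / b]. *)
Lemma slope_excess_lower th x : c < th -> 0 < x ->
  expR (- th * x) * (1 - slope_excess x * (b + L th)) <= b^-1 * L th.
Proof.
move=> cth x0; have th0 : 0 < th := lt_trans c0 cth.
pose n := grid x; have nx : grid_seq n x by apply/grid_cvg/ltW.
have Ul := grid_limit_slope_excess x0 nx.
have nxSS := grid_seqS (grid_seqS nx).
have Rl := grid_rho th0 nxSS.
have Ll : (1 - th / N%:R) ^+ (n N).+2 * (1 - U N (n N) * (b + L th)) @[N --> \oo] -->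
    expR (- th * x) * (1 - slope_excess x * (b + L th)).
  apply: cvgM => //; apply: cvgB; first exact: cvg_cst.
  by apply: cvgM => //; exact: cvg_cst.
apply: (ler_cvg_to Ll (cvg_cst (b^-1 * L th))); near=> N.
have cN : c < N%:R by near: N.
have thN : th < N%:R by near: N; exact: nbhs_infty_gtr.
have N0 : 0 < N%:R :> R := lt_trans c0 cN.
have [u0 un] := uE cN.
have tN0 : 0 < th / N%:R by rewrite divr_gt0.
have tN1 : th / N%:R < 1 by rewrite ltr_pdivrMr// mul1r.
set z := 1 - th / N%:R.
have z0 : 0 < z by rewrite subr_gt0.
have z1 : z < 1 by rewrite gtrBl.
have zE : N%:R * (1 - z) = th by rewrite /z; field; rewrite gt_eqF.
have PM := @partial_mass N z (n N).+2 cN z0 z1; rewrite zE in PM; have {}PM := PM cth.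
set S := \sum_(j < _) _ in PM.
have a0E : a N 0%N <= b + L th.
  rewrite /a /first_mass/= lerD2l.
  have -> : pmass N%:R V 0 = L N%:R.
    by congr fine; apply: eq_integral => y _; rewrite pois0.
  by apply: L_nonincr => //; exact: ltW.
have key : 1 <= U N (n N) * a N 0%N + N%:R * u N 0%N * S.
  have := conv cN (n N).+1; rewrite big_ord_recr/= subnn => /(congr1 (fun t => N%:R * t)).
  rewrite mulfV ?gt_eqF// => E1; rewrite -[leLHS]E1 mulrDr addrC /U mulrA lerD2l -mulrA ler_wpM2l//.
  apply: (@le_trans _ _ (\sum_(k < (n N).+1) u N 0%N * pmass N%:R V ((n N).+1 - k)%N)).
    apply: ler_sum => k _.
    have -> : a N ((n N).+1 - k)%N = pmass N%:R V ((n N).+1 - k)%N.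
      by rewrite /a /first_mass subn_eq0 leqNgt ltn_ord/= add0r.
    by apply: ler_wpM2r; [exact: pmass_ge0|exact: nonincreasing_from_startP].
  rewrite -mulr_sumr ler_wpM2l// /S [leRHS]big_ord_recl/=.
  rewrite (reindex_inj rev_ord_inj)/= ler_wpDl ?pmass_ge0//; apply: ler_sum => k _.
  by rewrite /bump/= (subKn (ltn_ord k)).
have U0 : 0 <= U N (n N) by rewrite mulr_ge0.
have S0 : 0 <= S by apply: sumr_ge0 => j _; exact: pmass_ge0.
have zM : 0 <= z ^+ (n N).+2 by rewrite exprn_ge0// ltW.
apply: (@le_trans _ _ (z ^+ (n N).+2 * (b^-1 * S))); last first.
  by rewrite mulrCA ler_wpM2l// invr_ge0 ltW.
apply: ler_wpM2l => //; rewrite lerBlDr; apply: (le_trans key); rewrite addrC lerD//.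
  by apply: ler_wpM2r => //; exact: u_first.
by apply: ler_wpM2l.
Unshelve. all: by end_near.
Qed.

Lemma slope_excess_upper x : 0 < x -> slope_excess x <= b^-1.
Proof.
move=> x0; have nx : grid_seq (grid x) x by apply/grid_cvg/ltW.
apply: (ler_cvg_to (grid_limit_slope_excess x0 nx) (cvg_cst b^-1)); near=> N.
have cN : c < N%:R by near: N.
apply: le_trans (u_first cN); rewrite /U ler_wpM2l//.
by have [_ un] := uE cN; exact: nonincreasing_from_startP.
Unshelve. all: by end_near.
Qed.

(** Dominated convergence along integer arguments; the transform at [k >= c + 1] is finite and
    dominates. *)
Let L_cvg0 e : 0 < e -> exists2 th, c < th & L th <= e.
Proof.
move=> e0; pose k := (Num.truncn c).+2.
have ck : c + 1 <= k%:R.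
  by rewrite /k -natr1 lerD2r; apply/ltW; have /andP[] := truncn_itv (ltW c0).
pose f n (y : R) : \bar R := (exp_pos (n + k)%:R y * V y)%:E.
have kc : c < k%:R by apply: lt_le_trans ck; rewrite ltrDl.
have mf n : measurable_fun setT (f n).
  by apply/measurable_EFinP; apply: measurable_funM => //; exact: measurable_exp_pos.
have ig : mu.-integrable setT (fun y => (exp_pos k%:R y * V y)%:E).
  apply/integrableP; split.
    by apply/measurable_EFinP; apply: measurable_funM => //; exact: measurable_exp_pos.
  under eq_integral do rewrite gee0_abs ?lee_fin ?mulr_ge0 ?exp_pos_ge0//.
  by rewrite L_fin// ltry.
have lim0 y : f n y @[n --> \oo] --> 0%E.
  have H0 : exp_pos (n + k)%:R y * V y @[n --> \oo] --> (0 * V y : R).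
    apply: cvgM; [|exact: cvg_cst].
    rewrite /exp_pos; have [y0|y0] := ltP 0 y; last exact: cvg_cst.
    have H : expR (- y) ^+ (n + k) @[n --> \oo] --> (0 : R).
      rewrite (cvg_shiftn k (fun n => expR (- y) ^+ n : R)).
      by apply: cvg_expr; rewrite ger0_norm ?expR_ge0// expR_lt1 oppr_lt0.
    apply: cvg_trans H; apply: near_eq_cvg; near=> n.
    by rewrite -expRM_natr mulNr mulrC.
  by rewrite mul0r in H0; apply: cvg_EFin; [near=> n|exact: H0].
have fg n y : (`|f n y| <= (exp_pos k%:R y * V y)%:E)%E.
  rewrite gee0_abs ?lee_fin ?mulr_ge0 ?exp_pos_ge0// ler_wpM2r// /exp_pos; case: ifP => // y0.
  by rewrite ler_expR lerN2 ler_wpM2r ?(ltW y0)// ler_nat leq_addl.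
have A1 : {ae mu, forall y, [set: R] y -> f n y @[n --> \oo] --> (cst 0%E : R -> \bar R) y}.
  by apply: aeW => y _; exact: lim0.
have A2 : {ae mu, forall y n, [set: R] y -> (`|f n y| <= (exp_pos k%:R y * V y)%:E)%E}.
  by apply: aeW => y n _; exact: fg.
have [_ _] := @dominated_convergence _ _ R mu setT measurableT f (cst 0%E) _ mf
  (measurable_cst _) A1 ig A2.
rewrite integral0 => /fine_cvgP[_] /cvgrPdist_le /(_ _ e0)[M _ H].
exists (M + k)%:R; first by apply: (lt_le_trans kc); rewrite ler_nat leq_addl.
have := H M (leqnn M); rewrite sub0r normrN; apply: le_trans.
exact: ler_norm.
Unshelve. all: by end_near.
Qed.

(** In [slope_excess_second_difference] the bracket after [2 * h] becomes small: [s (h + h)] is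
    close to [1 / b] and [V] is continuous at [x]. The second difference is thus smaller than any
    multiple of [h]. *)
Lemma slope_excess_derivable x : 0 < x -> derivable slope_excess x 1.
Proof.
move=> x0; apply: three_slope_derivable => //; first exact: slope_excess_three_slope.
move=> e e0; have Vx0 : 0 <= V x by [].
(* Of [V x + 3], two units pay for the variation of [V] between [x - h] and [x + h], and [V x + 1]
   bounds the value of [V] multiplying the defect of [s]. *)
pose e1 := Num.min 1 (b ^+ 2 * e / (2 * (V x + 3))).
have V3 : 0 < V x + 3 by lra.
have e10 : 0 < e1.
  by rewrite lt_min ltr01/= divr_gt0 ?mulr_gt0// exprn_gt0.
have e11 : e1 <= 1 by rewrite /e1 ge_min lexx.
have e1e : 2 * (e1 * (V x + 3)) <= b ^+ 2 * e.
  have : e1 <= b ^+ 2 * e / (2 * (V x + 3)) by rewrite /e1 ge_min lexx orbT.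
  by rewrite ler_pdivlMr ?mulr_gt0// mulrCA.
have be1 : 0 < b * e1 / 3 by rewrite divr_gt0// mulr_gt0.
have [th cth Lth] := L_cvg0 be1.
have th0 : 0 < th := lt_trans c0 cth.
have := cV x0; move/cvgrPdist_lt => /(_ _ e10)[dl /= dl0 Hd].
(* The bound by [4^-1 / th] makes [expR (- th * (h + h))] at least one half. *)
pose h := Num.min (dl / 2) (Num.min (x / 2) (4^-1 / th)).
have h0 : 0 < h by rewrite !lt_min !divr_gt0.
have hd : h <= dl / 2 by rewrite /h ge_min lexx.
have hx : h <= x / 2 by rewrite /h !ge_min lexx orbT.
have hth : h <= 4^-1 / th by rewrite /h !ge_min lexx !orbT.
have hx' : h < x by lra.
exists h; split=> //.
have V1 : `|V x - V (x - h)| < e1.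
  by apply: Hd; rewrite /ball_/= opprB addrC subrK ger0_norm; lra.
have V2 : `|V x - V (x + h)| < e1.
  by apply: Hd; rewrite /ball_/= opprD addrA subrr sub0r normrN ger0_norm; lra.
have hh0 : 0 < h + h by rewrite addr_gt0.
have low := slope_excess_lower cth hh0.
have up := slope_excess_upper hh0.
have ex : 2^-1 <= expR (- th * (h + h)).
  apply: le_trans (expR_ge1Dx _).
  have : h * th <= 4^-1 by rewrite -ler_pdivlMr.
  have -> : - th * (h + h) = - (2 * (h * th)) by ring.
  by lra.
have Lb : b^-1 * L th <= e1 / 3.
  rewrite mulrC ler_pdivrMr//; apply: le_trans Lth _.
  by rewrite [e1 / 3 * b]mulrC mulrA.
(* Dividing the lower bound by a factor of at least one half costs [2 * (e1 / 3)]; the remaining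
   third pays for [s * L th]. *)
have defect : 1 - b * slope_excess (h + h) <= e1.
  have s0 := slope_excess_ge0 hh0.
  have sL : slope_excess (h + h) * L th <= b^-1 * L th by rewrite ler_wpM2r.
  move: low sL Lb ex; set s := slope_excess _; set E := expR _; set l := b^-1 * L th.
  set q := s * L th => low sL Lb ex.
  have low' : E * (1 - b * s - q) <= l by rewrite (_ : 1 - b * s - q = 1 - s * (b + L th))// /q; ring.
  have [neg|pos] := leP (1 - b * s - q) 0; first by lra.
  have : 2^-1 * (1 - b * s - q) <= E * (1 - b * s - q) by rewrite ler_wpM2r// ltW.
  by lra.
have := slope_excess_second_difference h0 hx'.
set D := _ + slope_excess (x - h) => HD.
rewrite -(ler_pM2l bp); apply: (le_trans HD).
have VV : b^-1 * V (x - h) - slope_excess (h + h) * V (x + h) <= b^-1 * (e1 * (V x + 3)).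
  have -> : b^-1 * V (x - h) - slope_excess (h + h) * V (x + h) =
      b^-1 * (V (x - h) - V (x + h) + (1 - b * slope_excess (h + h)) * V (x + h)).
    by field; rewrite gt_eqF.
  rewrite ler_wpM2l ?invr_ge0 ?(ltW bp)//.
  have : (1 - b * slope_excess (h + h)) * V (x + h) <= e1 * V (x + h) by rewrite ler_wpM2r.
  move: V1 V2; rewrite !ltr_norml => /andP[V1 _] /andP[V2' V2].
  have : e1 * V (x + h) <= e1 * (V x + 1) by rewrite ler_wpM2l ?ltW//; lra.
  have -> : e1 * (V x + 3) = 2 * e1 + e1 * (V x + 1) by ring.
  by lra.
have h20 : 0 <= 2 * h by rewrite mulr_ge0// ltW.
apply: (le_trans (ler_wpM2l h20 VV)).
have -> : 2 * h * (b^-1 * (e1 * (V x + 3))) = b^-1 * h * (2 * (e1 * (V x + 3))) by ring.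
have -> : b * (e * h) = b^-1 * h * (b ^+ 2 * e) by field; rewrite gt_eqF.
by rewrite ler_wpM2l// mulr_ge0// ?invr_ge0 ltW.
Qed.

End gaussian_component.

End convex_renewal.

End renewal_limits.

(** * The derivative of the scale function *)

Section scale_derivative.
Context (R : realType).
Implicit Types (x y z t p k M a : R).
Variables (c : R) (W s : R -> R).
Hypotheses (c0 : 0 < c) (W0 : forall x, 0 <= W x)
  (Wmono : forall x y, 0 <= x -> x <= y -> W x <= W y)
  (Wright : W y @[y --> 0^'+] --> W 0) (Wpos : exists2 x, 0 < x & 0 < W x)
  (dW : forall x : R, 0 < x -> is_derive x (1 : R) W (c * W x + s x))
  (s0 : forall x, 0 < x -> 0 <= s x)
  (sN : forall x y, 0 < x -> x <= y -> s y <= s x) (sC : three_slope s).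
Local Notation m := (derive1 W).

Lemma scale_derivativeE x : 0 < x -> m x = c * W x + s x.
Proof. by move=> x0; have := dW x0; rewrite derive1E => d; exact: derive_val. Qed.

Let dm x : 0 < x -> is_derive x (1 : R) W (m x).
Proof. by move=> x0; rewrite scale_derivativeE//; exact: dW. Qed.

Let Wcont x : 0 < x -> {for x, continuous W}.
Proof.
move=> x0; apply: differentiable_continuous; apply/derivable1_diffP.
by case: (dW x0).
Qed.

Let mcont x : 0 < x -> {for x, continuous m}.
Proof.
move=> x0; have H : {for x, continuous (fun y => c * W y + s y)}.
  apply: continuousD; last exact: three_slope_continuous.
  by apply: continuousM; [exact: cst_continuous|exact: Wcont].
rewrite /prop_for /continuous_at (scale_derivativeE x0).
apply: cvg_trans H; apply: near_eq_cvg; near=> y.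
rewrite scale_derivativeE//; near: y; exact: lt_nbhsr.
Unshelve. all: by end_near.
Qed.

Let MVTW x y : 0 < x -> x < y -> exists2 p, x < p < y & W y - W x = m p * (y - x).
Proof.
move=> x0 xy; have [||p pin E] := @MVT R W m x y xy.
- by move=> z; rewrite in_itv/= => /andP[xz _]; apply: dm; exact: lt_trans xz.
- apply: continuous_in_subspaceT => z; rewrite inE/= in_itv/= => /andP[xz _].
  by apply: Wcont; exact: lt_le_trans xz.
- by exists p => //; move: pin; rewrite in_itv.
Qed.

Let m_within z y : 0 < z -> {within `[z, y], continuous m}.
Proof.
move=> z0; apply: continuous_in_subspaceT => x; rewrite inE/= in_itv/= => /andP[zx _].
by apply: mcont; exact: lt_le_trans zx.
Qed.

(* At an interior maximum [p] of [m] on [z, y], the left slope of the convex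
   function [s = m - c W] makes [phi t = W t - W p - m p (t - p)] satisfy
   [phi' >= c phi] on [p, y], so [phi y >= 0]; convexity of [s] through
   [z < p < y] then gives [m z >= m p]. *)
Let no_interior_max z p y : 0 < z -> z < p -> p < y ->
  (forall t, z <= t <= y -> m t <= m p) -> m p <= m z.
Proof.
move=> z0 zp py mx; have p0 : 0 < p := lt_trans z0 zp; have y0 := lt_trans p0 py.
have [q1 /andP[zq qp] E1] := MVTW z0 zp.
have mq1 : m q1 <= m p by apply: mx; rewrite (ltW zq) (ltW (lt_trans qp py)).
have Wz : W p - W z <= m p * (p - z) by rewrite E1 ler_wpM2r// subr_ge0 ltW.
have mz : m z <= m p by apply: mx; rewrite lexx (ltW (lt_trans zp py)).
have sE t : 0 < t -> s t = m t - c * W t.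
  by move=> t0; rewrite scale_derivativeE// addrAC subrr add0r.
have cWz : c * (W p - W z) <= c * (m p * (p - z)) by rewrite ler_wpM2l// ltW.
have slope : - (c * m p * (p - z)) <= s p - s z.
  rewrite (sE p p0) (sE z z0); move: cWz; rewrite mulrBr mulrA.
  by move: mz; lra.
have right t : p < t -> s p - c * m p * (t - p) <= s t.
  move=> pt; have pz : 0 < p - z by rewrite subr_gt0.
  rewrite -(ler_pM2l pz); have := sC z0 zp pt.
  have tp : 0 <= t - p by rewrite subr_ge0 ltW.
  have := ler_wpM2l tp slope.
  have -> : (t - p) * - (c * m p * (p - z)) = - ((p - z) * (c * m p * (t - p))) by ring.
  have -> : (p - z) * (s p - c * m p * (t - p)) =
    (t - z) * s p - (t - p) * s p - (p - z) * (c * m p * (t - p)) by ring.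
  by rewrite mulrBr; lra.
pose phi t := W t - W p - m p * (t - p).
have phiy : 0 <= phi y.
  pose Gf (t : R) : R := expR (- c * t) * phi t.
  have dphi t : 0 < t -> is_derive t (1 : R) phi (m t - m p).
    move=> t0; have d1 := dm t0.
    have d2 : is_derive t (1 : R) (fun t => m p * (t - p)) (m p).
      have d3 : is_derive t (1 : R) (fun t => t - p) 1.
        by apply: (is_derive_eq (is_deriveB (is_derive_id t 1) (is_derive_cst p t 1))); rewrite subr0.
      apply: (is_derive_eq (is_deriveM (is_derive_cst (m p) t 1) d3)).
      by rewrite /GRing.scale/= mulr1 mulr0 addr0.
    have d4 := is_deriveB d1 (is_derive_cst (W p) t 1).
    apply: (is_derive_eq (is_deriveB d4 d2)).
    by rewrite subr0.
  have dG t : 0 < t -> is_derive t (1 : R) Gf (expR (- c * t) * ((m t - m p) - c * phi t)).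
    move=> t0; apply: (is_derive_eq (is_deriveM (is_derive_expM (- c) t) (dphi t t0))).
    by rewrite /GRing.scale/=; ring.
  have [||r rin E] := @MVT R Gf (fun t => expR (- c * t) * ((m t - m p) - c * phi t)) p y py.
  - by move=> x; rewrite in_itv/= => /andP[px _]; apply: dG; exact: lt_trans px.
  - apply: continuous_in_subspaceT => t; rewrite inE/= in_itv/= => /andP[pt _].
    apply: differentiable_continuous; apply/derivable1_diffP.
    by case: (dG t (lt_le_trans p0 pt)).
  move: rin E; rewrite in_itv/= => /andP[pr _] E.
  have r0 := lt_trans p0 pr.
  have Gp : Gf p = 0 by rewrite /Gf /phi !subrr mulr0 subrr mulr0.
  have pos : 0 <= m r - m p - c * phi r.
    have := right r pr; rewrite (sE r r0) (sE p p0) /phi; lra.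
  have : 0 <= Gf y.
    have -> : Gf y = Gf y - Gf p by rewrite Gp subr0.
    by rewrite E mulr_ge0 ?subr_ge0 ?(ltW py)// mulr_ge0// expR_ge0.
  by rewrite /Gf pmulr_rge0// expR_gt0.
have my : m y <= m p by apply: mx; rewrite lexx (ltW (lt_trans zp py)).
have yp : 0 < y - p by rewrite subr_gt0.
have sy : s y <= s p - c * m p * (y - p).
  have := mulr_ge0 (ltW c0) phiy; rewrite /phi (sE y y0) (sE p p0) !mulrBr.
  by move: my; lra.
have sz : s p + c * m p * (p - z) <= s z.
  rewrite -(ler_pM2l yp); have := sC z0 zp py.
  have zp' : 0 <= p - z by rewrite subr_ge0 ltW.
  have := ler_wpM2l zp' sy.
  have -> : (y - p) * (s p + c * m p * (p - z)) =
    (y - z) * s p - (p - z) * (s p - c * m p * (y - p)) by ring.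
  by lra.
move: sz cWz; rewrite (sE p p0) (sE z z0) mulrBr [c * (m p * _)]mulrA.
by lra.
Qed.

(** A failure would place a maximum of [m] over [[z, y]] in the interior, with a value strictly
    above [m z]. *)
Lemma scale_derivative_unimodal z x y : 0 < z -> z < x -> x < y -> m z < m x -> m x < m y.
Proof.
move=> z0 zx xy mzx; rewrite ltNge; apply/negP => myx.
have zy : z <= y by apply/ltW/(lt_trans zx).
have [p pin pmax] := EVT_max zy (m_within (y := y) z0).
have [p' [zp py pm]] : exists p', [/\ z < p', p' < y & forall t, z <= t <= y -> m t <= m p'].
  move: pin; rewrite in_itv/= => /andP[zp py].
  have pm t : z <= t <= y -> m t <= m p by move=> h; apply: pmax; rewrite in_itv.
  move: zp; rewrite le_eqVlt => /predU1P[zp|zp].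
    have := pm x; rewrite -zp (ltW zx) (ltW xy) => /(_ isT) h.
    by have := lt_le_trans mzx h; rewrite ltxx.
  move: py; rewrite le_eqVlt => /predU1P[py|py]; last by exists p.
  (* If the maximum sits at [y], then [m y <= m x] makes [x] an interior maximum. *)
  by exists x; split=> // t /pm; rewrite py => h; exact: le_trans h myx.
have := no_interior_max z0 zp py pm; apply/negP; rewrite -ltNge.
by apply: lt_le_trans mzx _; apply: pm; rewrite !ltW.
Qed.

(** [m >= c * W] makes [W] grow at least linearly past a point where it is positive, and then [m] is
    unbounded with it. *)
Lemma scale_derivative_unbounded M : exists2 B, 0 < B & forall y, B <= y -> M < m y.
Proof.
have [x x0 Wx] := Wpos.
pose k := c * (c * W x); have k0 : 0 < k by rewrite !mulr_gt0.
exists (x + 1 + `|M| / k); first by rewrite ltr_wpDr ?addr_gt0// divr_ge0// ltW.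
move=> y By; have xy : x < y.
  by apply: lt_le_trans By; rewrite -addrA ltrDl ltr_wpDr// divr_ge0// ltW.
have y0 := lt_trans x0 xy.
have [p /andP[xp py] E] := MVTW x0 xy.
have p0 := lt_trans x0 xp.
have mp : c * W x <= m p.
  rewrite scale_derivativeE// -[leLHS]addr0 lerD ?s0// ler_wpM2l ?(ltW c0)//.
  by apply: Wmono; exact: ltW.
rewrite scale_derivativeE//; apply: (@lt_le_trans _ _ (c * (W y))); last by rewrite lerDl s0.
apply: (@lt_le_trans _ _ (c * ((c * W x) * (y - x)))); last first.
  rewrite ler_wpM2l ?(ltW c0)//.
  apply: (@le_trans _ _ (m p * (y - x))); first by rewrite ler_wpM2r// subr_ge0 ltW.
  by rewrite -E gerBl.
rewrite mulrA -/k mulrC -ltr_pdivrMr//.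
apply: le_lt_trans (_ : `|M| / k < _); first by rewrite ler_wpM2r ?invr_ge0 ?ler_norm// ltW.
rewrite ltrBrDl; apply: lt_le_trans By; rewrite ltrD2r ltrDl//.
Qed.

(** [s] is monotone, so it has a limit at 0, possibly infinite, while [c * W] has a finite one. *)
Lemma scale_derivative_cvg : cvg ((m y)%:E @[y --> 0^'+]).
Proof.
have h1 : (c * W y)%:E @[y --> 0^'+] --> (c * W 0)%:E.
  apply: cvg_EFin; first by near=> y.
  by apply: cvgM; [exact: cvg_cst|exact: Wright].
pose S : \bar R := ereal_sup ((fun y => (s y)%:E) @` `]0%R, 1%R[%classic).
have h2 : (s y)%:E @[y --> 0^'+] --> S.
  apply: (@nonincreasing_at_right_cvge R (fun y => (s y)%:E) 0 (BLeft 1)); first by rewrite bnd_simp.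
  move=> x y; rewrite !in_itv/= => /andP[x0 _] /andP[y0 _] xy.
  by rewrite lee_fin sN.
apply/cvg_ex; exists ((c * W 0)%:E + S)%E.
have h3 : ((c * W y)%:E + (s y)%:E)%E @[y --> 0^'+] --> ((c * W 0)%:E + S)%E.
  by apply: cvgeD; [exact: fin_num_adde_defr|exact: h1|exact: h2].
apply: cvg_trans h3; apply: near_eq_cvg; near=> y.
by rewrite scale_derivativeE// EFinD.
Unshelve. all: by end_near.
Qed.

Let near0_lt k : ((right_deriv0 W < k%:E)%E) -> forall x, 0 < x -> exists2 z, 0 < z < x & m z < k.
Proof.
move=> mk x x0; have H := scale_derivative_cvg.
have := H _ (open_nbhs_nbhs (conj (@open_ereal_lt_ereal R k%:E) mk)).
move=> [d /= d0 D]; pose z := Num.min (d / 2) (x / 2).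
have z0 : 0 < z by rewrite lt_min !divr_gt0.
have zd : z <= d / 2 by rewrite ge_min lexx.
have zx : z <= x / 2 by rewrite ge_min lexx orbT.
exists z; first by rewrite z0/=; lra.
rewrite -lte_fin; apply: D => //=.
by rewrite sub0r normrN gtr0_norm//; lra.
Qed.

Let near0_gt k : ((k%:E < right_deriv0 W)%E) ->
  exists2 d, 0 < d & forall z, 0 < z -> z < d -> k < m z.
Proof.
move=> mk; have H := scale_derivative_cvg.
have := H _ (open_nbhs_nbhs (conj (@open_ereal_gt_ereal R k%:E) mk)).
move=> [d /= d0 D]; exists d => // z z0 zd.
rewrite -lte_fin; apply: D => //=.
by rewrite sub0r normrN gtr0_norm.
Qed.

Let ext_derivE x : 0 < x -> ext_deriv W x = (m x)%:E.
Proof. by move=> x0; rewrite /ext_deriv gt_eqF. Qed.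

Let ext_deriv0 : ext_deriv W 0 = right_deriv0 W.
Proof. by rewrite /ext_deriv eqxx. Qed.

Let minimizer a := 0 <= a /\ forall y, 0 <= y -> (ext_deriv W a <= ext_deriv W y)%E.

(** If 0 is not a minimiser, some [m y] is below the limit at 0. Near 0 and near infinity [m]
    exceeds [m y], so a minimum over the compact interval in between is global. *)
Let minimizer_ex : exists a, minimizer a.
Proof.
have [h|] := pselect (forall y, 0 < y -> (right_deriv0 W <= (m y)%:E)%E).
  exists 0; split=> // y; rewrite le_eqVlt => /predU1P[<-//|y0].
  by rewrite ext_deriv0 ext_derivE// h.
move=> /existsNP[y /not_implyP[y0 /negP]]; rewrite -ltNge => my.
have [d d0 Hd] := near0_gt my.
have [B B0 HB] := scale_derivative_unbounded (m y).
pose lo := Num.min (d / 2) y; pose hi := Num.max B y.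
have lo0 : 0 < lo by rewrite lt_min y0 divr_gt0.
have lod : lo <= d / 2 by rewrite ge_min lexx.
have loy : lo <= y by rewrite ge_min lexx orbT.
have yhi : y <= hi by rewrite le_max lexx orbT.
have Bhi : B <= hi by rewrite le_max lexx.
have [a ain amin] := EVT_min (le_trans loy yhi) (m_within (y := hi) lo0).
move: ain; rewrite in_itv/= => /andP[loa ahi].
have a0 : 0 < a := lt_le_trans lo0 loa.
have may : m a <= m y by apply: amin; rewrite in_itv/= loy.
exists a; split=> [|t]; first exact: ltW.
rewrite le_eqVlt => /predU1P[<-|t0].
  rewrite ext_deriv0 ext_derivE//; apply/ltW; apply: le_lt_trans my.
  by rewrite lee_fin.
rewrite !ext_derivE// lee_fin.
have [tlo|lot] := ltP t lo.
  by apply: (le_trans may); apply/ltW/Hd => //; move: tlo lod; lra.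
have [thi|hit] := leP t hi; first by apply: amin; rewrite in_itv/= lot.
by apply: (le_trans may); apply/ltW/HB/(le_trans Bhi)/ltW.
Qed.

Lemma astar_lty : (astar W < +oo)%E.
Proof.
have [B B0 HB] := scale_derivative_unbounded (m 1).
apply: (@le_lt_trans _ _ B%:E); last exact: ltry.
apply: ub_ereal_sup => _ [a [a0 amin] <-]; rewrite lee_fin leNgt; apply/negP => Ba.
have := amin 1 ler01; rewrite !ext_derivE//; last exact: lt_trans Ba.
by rewrite lee_fin leNgt HB// ltW.
Qed.

(** A point with the minimal value would itself be a minimiser, hence at most [astar W]. *)
Let beyond_astar x : (astar W < x%:E)%E -> exists a, [/\ 0 <= a, a < x & (ext_deriv W a < (m x)%:E)%E].
Proof.
move=> ax; have [a [a0 amin]] := minimizer_ex.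
have aa : (a%:E <= astar W)%E by apply: ereal_sup_ubound; exists a.
have lax : a < x by rewrite -lte_fin; exact: le_lt_trans aa ax.
have x0 := le_lt_trans a0 lax.
exists a; split=> //; rewrite lt_neqAle -(ext_derivE x0) (amin _ (ltW x0)) andbT.
apply/eqP => E; move: ax; apply/negP; rewrite -leNgt; apply: ereal_sup_ubound.
by exists x => //; split; [exact: ltW|move=> y y0; rewrite -E; exact: amin].
Qed.

Lemma astar_gt0 x : (astar W < x%:E)%E -> 0 < x.
Proof. by move=> /beyond_astar[a [a0 ax _]]; exact: le_lt_trans ax. Qed.

Lemma scale_derivative_increasing x y : (astar W < x%:E)%E -> x < y -> m x < m y.
Proof.
move=> ax xy; have x0 := astar_gt0 ax.
have [a [a0 lax ma]] := beyond_astar ax.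
have [z /andP[z0 zx] mz] : exists2 z, 0 < z < x & m z < m x.
  (* For [a = 0] the extended value is a limit, so a nearby positive [z] takes its place. *)
  move: a0; rewrite le_eqVlt => /predU1P[a0|a0].
    by apply: near0_lt => //; rewrite -ext_deriv0 a0.
  by exists a; [rewrite a0|rewrite ext_derivE ?lte_fin in ma].
exact: scale_derivative_unimodal mz.
Qed.

Lemma scale_strictly_convex : strictly_convex_on [set x : R | (astar W < x%:E)%E] W.
Proof.
have key t x y : 0 < t -> t < 1 -> (astar W < x%:E)%E -> x < y ->
    W (t * x + (1 - t) * y) < t * W x + (1 - t) * W y.
  move=> t0 t1 ax xy; have x0 := astar_gt0 ax.
  have yx : 0 < y - x by rewrite subr_gt0.
  have t1' : 0 < 1 - t by rewrite subr_gt0.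
  set p := t * x + (1 - t) * y.
  have px : p - x = (1 - t) * (y - x) by rewrite /p; ring.
  have yp : y - p = t * (y - x) by rewrite /p; ring.
  have xp : x < p by rewrite -subr_gt0 px mulr_gt0.
  have py : p < y by rewrite -subr_gt0 yp mulr_gt0.
  have [q1 /andP[xq1 q1p] E1] := MVTW x0 xp.
  have [q2 /andP[pq2 q2y] E2] := MVTW (lt_trans x0 xp) py.
  have aq1 : (astar W < q1%:E)%E by apply: lt_trans ax _; rewrite lte_fin.
  have mq : m q1 < m q2 by apply: scale_derivative_increasing => //; exact: lt_trans pq2.
  rewrite -subr_gt0.
  have -> : t * W x + (1 - t) * W y - W p = (1 - t) * (W y - W p) - t * (W p - W x) by ring.
  rewrite E1 E2 px yp.
  have -> : (1 - t) * (m q2 * (t * (y - x))) - t * (m q1 * ((1 - t) * (y - x))) =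
    t * (1 - t) * (y - x) * (m q2 - m q1) by ring.
  by rewrite !mulr_gt0// subr_gt0.
move=> t x y t0 t1 /= ax ay; rewrite neq_lt => /orP[xy|yx]; first exact: key.
have E : 1 - (1 - t) = t by ring.
have := @key (1 - t) y x; rewrite E subr_gt0 gtrBl => /(_ t1 t0 ay yx).
by rewrite [(1 - t) * y + _]addrC [(1 - t) * W y + _]addrC.
Qed.

(** In [m = c * W + s] strictness comes from [W], and [s] contributes convexity. *)
Lemma scale_derivative_strictly_convex :
  strictly_convex_on [set x : R | (astar W < x%:E)%E] m.
Proof.
move=> t x y t0 t1 /= ax ay xy.
have x0 := astar_gt0 ax; have y0 := astar_gt0 ay.
have t1' : 0 < 1 - t by rewrite subr_gt0.
have p0 : 0 < t * x + (1 - t) * y by rewrite addr_gt0// mulr_gt0.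
rewrite !scale_derivativeE//.
have H1 := scale_strictly_convex t0 t1 ax ay xy.
have H2 := (convex_onE `]0, +oo[ s).1 ((three_slopeP s).1 sC) t x y (ltW t0) (ltW t1).
have {}H2 : s (t * x + (1 - t) * y) <= t * s x + (1 - t) * s y.
  by apply: H2; rewrite /= in_itv/= andbT.
have -> : t * (c * W x + s x) + (1 - t) * (c * W y + s y) =
  c * (t * W x + (1 - t) * W y) + (t * s x + (1 - t) * s y) by ring.
by apply: ltr_leD => //; rewrite ltr_pM2l.
Qed.

End scale_derivative.

(** * Log-convex densities and scale functions *)

Section log_convex_density.
Context (R : realType).
Local Notation mu := (@lebesgue_measure R).

Lemma log_convex_three_slope (f : R -> R) : log_convex_on `]0, +oo[ f -> three_slope f.
Proof.
move=> /log_convex_posP[f0 lf]; apply/three_slopeP/convex_onE => t x y t0 t1.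
rewrite /= !in_itv/= !andbT => x0 y0.
rewrite -[f _]lnK ?posrE ?f0 ?conv_gt0//.
rewrite -[in leRHS](lnK (f0 x x0 : f x \is Num.pos)) -[in leRHS](lnK (f0 y y0 : f y \is Num.pos)).
by apply: le_trans (expR_convex _ _ t0 t1); rewrite ler_expR lf.
Qed.

Variables (Pi : {measure set (measurableTypeR R) -> \bar R}) (pi : R -> R).
Hypotheses (hPi : levy_measure Pi) (hpi : positive_density Pi pi).
Hypothesis lpi : log_convex_on `]0, +oo[ pi.

(* A convex function that increases somewhere is bounded below by a positive
   constant at infinity, hence not integrable there. *)
Lemma log_convex_density_nonincreasing : nonincreasing_on `]0, +oo[ pi.
Proof.
move=> x y; rewrite /= !in_itv/= !andbT => x0 y0.
rewrite le_eqVlt => /predU1P[->//|xy]; rewrite leNgt; apply/negP => pxy.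
have sl := log_convex_three_slope lpi.
have [_ pi0 _] := hpi.
have big z : y < z -> pi y <= pi z.
  move=> yz; have := sl x y z x0 xy yz => h.
  have h1 : (z - y) * pi x <= (z - y) * pi y by rewrite ler_wpM2l ?subr_ge0// ltW.
  have yx : 0 < y - x by rewrite subr_gt0.
  rewrite -(ler_pM2l yx); move: h; rewrite (_ : z - x = (z - y) + (y - x)); last by ring.
  by rewrite [in X in X -> _]mulrDl; lra.
have fin := tailE hPi hpi y0; rewrite (shift_transform0E hpi y0) in fin.
have : (\int[mu]_(s in `]y, +oo[) (pi y)%:E <= \int[mu]_(s in `]y, +oo[) (pi s)%:E)%E.
  apply: ge0_le_integral => //.
  - by move=> s _; rewrite lee_fin ltW// pi0.
  - apply/measurable_EFinP; case: hpi => mpi _ _; apply: measurable_funS mpi => //.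
    by move=> s/=; rewrite !in_itv/= !andbT; exact: lt_trans.
  - by move=> s; rewrite /= in_itv/= andbT => ys; rewrite lee_fin big.
by rewrite fin integral_cst//= lebesgue_measure_itv/= ltry/= gt0_muley ?lte_fin ?pi0// leNgt ltry.
Qed.

(** The tail mixes translates of [pi] with constant weight, an instance of [log_convex_integral]. *)
Lemma tail_log_convex : log_convex_on `]0, +oo[ (tail pi).
Proof.
apply: (@log_convex_integral R pi (exp_pos 0) ((EFin \o pi) \_ `]0%R, +oo[) (tail pi) lpi _
  (density_ge0 hpi) (measurable_density hpi) (measurable_exp_pos 0) (exp_pos_ge0 0)).
- by move=> x x0; exact: densityE.
- by move=> t t0; rewrite /exp_pos ltNge t0.
- by move=> x x0; exact: (tailE hPi hpi x0).
- by move=> x x0; exact: (tail_gt0 hPi hpi x0).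
Qed.

End log_convex_density.

(** * Measurability, continuity and positivity of the scale function *)

Section scale_function_regularity.
Context (R : realType).
Local Notation mu := (@lebesgue_measure R).
Variables (psi : R -> R) (q : R) (W : R -> R).
Hypothesis hW : scale_function psi q W.

Lemma measurable_scale : measurable_fun setT W.
Proof.
have -> : W = W \_ `[0, +oo[.
  apply/funext => x; rewrite patchE; case: ifPn => //.
  rewrite notin_setE/= in_itv/= andbT => /negP; rewrite -ltNge => x0.
  exact: scale_neg hW _ x0.
apply/(measurable_restrictT _ _).1 => //.
apply: subspace_continuous_measurable_fun => //; exact: scale_continuous hW.
Qed.

Lemma scale_continuous_pos x : 0 < x -> {for x, continuous W}.
Proof.
move=> x0; have [H _] := (continuous_within_itvcyP 0 W).1 (scale_continuous hW).
by apply: H; rewrite in_itv/= andbT.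
Qed.

Lemma scale_right0 : W y @[y --> 0^'+] --> W 0.
Proof. exact: ((continuous_within_itvcyP 0 W).1 (scale_continuous hW)).2. Qed.

Lemma scale_laplace_pos th : Phi psi q < th ->
  (\int[mu]_y (exp_pos th y * W y)%:E = ((psi th - q)^-1)%:E)%E.
Proof.
move=> cth; rewrite -(scale_laplace hW cth) -integral_itv_obnd_cbnd; last first.
  apply/measurable_EFinP; apply: measurable_funTS; apply: measurable_funM.
    exact: measurable_expM.
  exact: measurable_scale.
rewrite [RHS]integral_mkcond; apply: eq_integral => y _; rewrite patchE /exp_pos.
have [y0|y0] := ltP 0 y.
  by rewrite ifT ?mulNr// inE/= in_itv/= y0.
by rewrite mul0r ifF//; apply/negbTE; rewrite notin_setE/= in_itv/= andbT; apply/negP; rewrite -leNgt.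
Qed.

(** A function vanishing on the positive axis has transform 0, whereas [(psi th - q)^-1] is not
    0. *)
Lemma scale_pos : (forall th, Phi psi q < th -> q < psi th) -> exists2 x, 0 < x & 0 < W x.
Proof.
move=> hpsi; apply: contrapT => nW.
have W0 x : 0 < x -> W x = 0.
  move=> x0; apply/eqP; rewrite eq_le (scale_ge0 hW) andbT leNgt; apply/negP => Wx.
  by apply: nW; exists x.
have cth : Phi psi q < Phi psi q + 1 by rewrite ltrDl.
have := scale_laplace_pos cth.
rewrite integral0_eq; last first.
  by move=> y _; rewrite /exp_pos; case: ifP => y0; rewrite ?mul0r// W0// mulr0.
move=> [/esym/eqP]; rewrite invr_eq0 subr_eq0 => /eqP E.
by have := hpsi _ cth; rewrite E ltxx.
Qed.

End scale_function_regularity.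

(** The second derivative is [c * (c * W + s)] plus the derivative of [s], which is continuous
    because a derivable convex function is of class C^1. *)
Lemma C2_on_affine_derivative (R : realType) (W s : R -> R) (c : R) :
  (forall x : R, 0 < x -> is_derive x (1 : R) W (c * W x + s x)) ->
  three_slope s -> (forall x, 0 < x -> derivable s x 1) ->
  C2_on `]0, +oo[ W.
Proof.
move=> dW sC ds.
have mE x : 0 < x -> derive1 W x = c * W x + s x.
  by move=> x0; have := dW x x0; rewrite derive1E => d; exact: derive_val.
have Wc x : 0 < x -> {for x, continuous W}.
  move=> x0; apply: differentiable_continuous; apply/derivable1_diffP.
  by case: (dW x x0).
have dm (x : R) : 0 < x -> is_derive x (1 : R) (derive1 W) (c * (c * W x + s x) + derive1 s x).
  move=> x0; have d1 := dW x x0.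
  have d2 : is_derive x (1 : R) s (derive1 s x) by rewrite derive1E; exact/derivableP/ds.
  have d3 : is_derive x (1 : R) (fun y => c * W y + s y) (c * (c * W x + s x) + derive1 s x).
    apply: (is_derive_eq (is_deriveD (is_deriveM (is_derive_cst c x 1) d1) d2)).
    by rewrite /GRing.scale/= mulr0 addr0.
  apply: near_eq_is_derive d3; near=> y.
  by rewrite mE//; near: y; exact: lt_nbhsr.
have m2E x : 0 < x -> derive1 (derive1 W) x = c * (c * W x + s x) + derive1 s x.
  by move=> x0; have := dm x x0; rewrite [derive1 (derive1 W) x]derive1E => d; exact: derive_val.
split=> x; rewrite /= in_itv/= andbT => x0.
- by case: (dW x x0).
- by case: (dm x x0).
have H : {for x, continuous (fun y => c * (c * W y + s y) + derive1 s y)}.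
  apply: continuousD; last exact: three_slope_derive1_continuous.
  apply: continuousM; first exact: cst_continuous.
  apply: continuousD; last exact: three_slope_continuous.
  by apply: continuousM; [exact: cst_continuous|exact: Wc].
rewrite /prop_for /continuous_at /= m2E//.
apply: cvg_trans H; apply: near_eq_cvg; near=> y.
by rewrite m2E//; near: y; exact: lt_nbhsr.
Unshelve. all: by end_near.
Qed.

Theorem theorem2p6 (R : realType) (d : measure_display) (T : measurableType d)
    (P : probability T R) (X : R -> {RV P >-> R})
    (gamma sigma : R) (Pi : {measure set (measurableTypeR R) -> \bar R})
    (pi : R -> R) (q : R) (W : R -> R)
    (psi := laplace_exponent gamma sigma Pi)
    (g := fun x : R => expR (- Phi psi q * x) * W x)
    (hX : spectrally_negative_levy X)
    (hXtriplet : has_triplet X gamma sigma Pi)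
    (hpi : positive_density Pi pi)
    (hq0 : Phi0 psi = 0 -> 0 < q)
    (hq1 : 0 < Phi0 psi -> 0 <= q)
    (hW : scale_function psi q W) :
  [/\ log_convex_on `]0, +oo[ (tail pi) -> concave_on `]0, +oo[ g,
      log_convex_on `]0, +oo[ pi ->
        [/\ nonincreasing_on `]0, +oo[ pi,
            log_convex_on `]0, +oo[ (tail pi),
            [/\ derivable_on `]0, +oo[ g,
                nonincreasing_on `]0, +oo[ (derive1 g) &
                convex_on `]0, +oo[ (derive1 g)],
            [/\ derivable_on `]0, +oo[ W,
                cvg ((derive1 W y)%:E @[y --> 0^'+]) &
                (astar W < +oo)%E] &
            strictly_convex_on [set x : R | (astar W < x%:E)%E] W /\
            strictly_convex_on [set x : R | (astar W < x%:E)%E] (derive1 W)] &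
      log_convex_on `]0, +oo[ pi -> 0 < sigma -> C2_on `]0, +oo[ W].
Proof.
have [s0 hPi _] := hXtriplet.
have pos := laplace_exponent_pos hX hXtriplet.
have psi0 := laplace_exponent0 gamma sigma Pi.
have cpsi := laplace_exponent_convex gamma sigma hPi.
pose c := Phi psi q.
have [c0 psic psiq] : [/\ 0 < c, psi c = q & forall th, c < th -> q < psi th].
  exact: (@Phi_spec R psi psi0 cpsi pos q hq0 hq1).
have q0 : 0 <= q.
  have := @Phi0_ge0 R psi psi0 cpsi pos.
  by rewrite le_eqVlt => /predU1P[/esym/hq0/ltW|/hq1].
pose b := 2^-1 * sigma ^+ 2.
have b0 : 0 <= b by rewrite mulr_ge0// sqr_ge0.
pose V := potential pi c q.
have mW := measurable_scale hW.
have W0 := scale_ge0 hW.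
have cW := @scale_continuous_pos R psi q W hW.
have mV : measurable_fun setT V by exact: (measurable_potential hpi c q).
have V0 y : 0 <= V y by exact: (potential_ge0 hpi c0 q0 y).
(* The factor shared by the transforms of [W] and [V]; it does not vanish beyond [c]. *)
pose K th := psi th - q.
have K0 th : c < th -> K th != 0 by move=> cth; rewrite /K subr_eq0 gt_eqF//; exact: psiq.
have LW := @scale_laplace_pos R psi q W hW.
have LV := @laplace_potential R gamma sigma Pi pi hPi hpi c q c0 q0 psic.
have a0 N := @potential_mass_gt0 R gamma sigma Pi pi hPi hpi c q c0 q0 psic N%:R.
have aN N := @potential_mass_nonincreasing R gamma sigma Pi pi hPi hpi c q c0 q0 psic N%:R.
have aL lt N cN := @potential_mass_log_convex R gamma sigma Pi pi hPi hpi c q c0 q0 psic N%:R cN lt.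
have dN N := @potential_massB_gt0 R gamma sigma Pi pi hPi hpi c q c0 q0 psic N%:R.
have dL lp N cN := @potential_massB_log_convex R gamma sigma Pi pi hPi hpi c q c0 q0 psic N%:R cN lp.
have lpt := tail_log_convex hPi hpi.
pose s := slope_excess c W.
have key (lp : log_convex_on `]0, +oo[ pi) : [/\ forall x : R, 0 < x -> is_derive x (1 : R) W (c * W x + s x),
    forall x, 0 < x -> 0 <= s x, forall x y, 0 < x -> x <= y -> s y <= s x & three_slope s].
  have aL' := aL (lpt lp); have dL' := dL lp.
  split.
  - move=> x; exact: (is_derive_scale c0 b0 mW W0 cW mV V0 K0 LW LV a0 aN aL' dN dL').
  - move=> x; exact: (slope_excess_ge0 c0 b0 mW W0 cW mV V0 K0 LW LV a0 aN aL' dN dL').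
  - move=> x y; exact: (slope_excess_nonincreasing c0 b0 mW W0 cW mV V0 K0 LW LV a0 aN aL' dN dL').
  - exact: (slope_excess_three_slope c0 b0 mW W0 cW mV V0 K0 LW LV a0 aN aL' dN dL').
split.
- move=> lt; apply/three_slopeP.
  exact: (tilted_concave c0 b0 mW W0 cW mV V0 K0 LW LV a0 aN (aL lt)).
- move=> lp; have [dW s0' sN sC] := key lp.
  have aL' := aL (lpt lp); have dL' := dL lp.
  have Wr := scale_right0 hW; have Wp := scale_pos hW psiq.
  have Wm := scale_nondecreasing hW.
  split.
  + exact: (log_convex_density_nonincreasing hPi hpi lp).
  + exact: lpt.
  + split.
    * move=> x; rewrite /= in_itv/= andbT.
      exact: (tilted_derivable c0 b0 mW W0 cW mV V0 K0 LW LV a0 aN aL' dN dL').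
    * move=> x y; rewrite /= !in_itv/= !andbT => x0 _.
      exact: (derive1_tilted_nonincreasing c0 b0 mW W0 cW mV V0 K0 LW LV a0 aN aL' dN dL').
    * apply/three_slopeP.
      exact: (derive1_tilted_three_slope c0 b0 mW W0 cW mV V0 K0 LW LV a0 aN aL' dN dL').
  + split.
    * by move=> x; rewrite /= in_itv/= andbT => x0; case: (dW x x0).
    * exact: (@scale_derivative_cvg R c W s).
    * exact: (@astar_lty R c W s).
  + split.
    * exact: (@scale_strictly_convex R c W s).
    * exact: (@scale_derivative_strictly_convex R c W s).
- move=> lp sp; have [dW s0' sN sC] := key lp.
  have aL' := aL (lpt lp); have dL' := dL lp.
  have bp : 0 < b by rewrite mulr_gt0// exprn_gt0.
  (* Up to a constant [V] is log-convex, hence convex, hence continuous. *)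
  have cV x : 0 < x -> {for x, continuous V}.
    move=> x0; apply: continuousD; last exact: cst_continuous.
    apply: three_slope_continuous x0; apply: log_convex_three_slope.
    exact: (shift_tail_log_convex hPi hpi c0 (lpt lp)).
  apply: (C2_on_affine_derivative dW sC) => x.
  exact: (slope_excess_derivable c0 b0 mW W0 cW mV V0 K0 LW LV a0 aN aL' dN dL' bp cV).
Qed.
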